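(* Let $1<p<\infty$ and let $\psi\in H(\mathbb{U})$ satisfy $$\int_{\mathbb{U}}(1-|z|^2)^{p-2}|\psi'(z)|^p\left(\log\frac{2}{1-|z|^2}\right)^{p-1}dA(z)<\infty.$$ Suppose that $M_{\psi}$ is a bounded operator on the Besov space $\mathcal{B}_p$. Then $M_{\psi}$ is uniformly mean ergodic on $\mathcal{B}_p$ if and only if $\|\psi\|_{\infty}\le 1$ and either $\psi\equiv\xi$ for some $\xi\in\partial\mathbb{U}$ or $\frac{1}{1-\psi}\in H^{\infty}(\mathbb{U})$.
   Context: $\mathbb{U}=\{z\in\mathbb{C}:|z|<1\}$ is the open unit disk, $\partial\mathbb{U}$ the unit circle, $dA$ is Lebesgue area measure on $\mathbb{U}$, and $H(\mathbb{U})$ is the space of holomorphic functions on $\mathbb{U}$. $\|\psi\|_\infty=\sup_{z\in\mathbb{U}}|\psi(z)|$ and $H^\infty(\mathbb{U})=\{f\in H(\mathbb{U}):\|f\|_\infty<\infty\}$; $\frac{1}{1-\psi}\in H^\infty(\mathbb{U})$ means that $1-\psi$ has no zero in $\mathbb{U}$ and $1/(1-\psi)$ is bounded on $\mathbb{U}$. For $1<p<\infty$ the Besov space $\mathcal{B}_p$ is the Banach space of all $f\in H(\mathbb{U})$ with $\gamma_f^p=\int_{\mathbb{U}}|f'(z)|^p(1-|z|^2)^{p-2}dA(z)<\infty$, normed by $\|f\|_p=|f(0)|+\gamma_f$. The multiplication operator is $M_\psi f=\psi f$. For a bounded linear operator $T$ on a Banach space $X$, put $T_{[n]}=\frac1n\sum_{m=1}^n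 T^m$ for $n\ge 1$. $T$ is uniformly mean ergodic if $(T_{[n]})_n$ converges in operator norm. *)

(* Defs.v *)
From HB Require Import structures.
From mathcomp Require Import all_boot all_order all_algebra.
From mathcomp Require Import all_classical all_reals all_analysis.
From mathcomp Require Import complex.

Set Implicit Arguments.
Unset Strict Implicit.
Unset Printing Implicit Defensive.

Import Order.TTheory GRing.Theory Num.Theory.
Import numFieldNormedType.Exports.
Import Normc.

Local Open Scope ring_scope.
Local Open Scope complex_scope.
Local Open Scope classical_set_scope.

(* [X] is the underlying set of a normed subspace of [E] with norm [N];
   operators on [X] are functions on [E], considered only on [X]. *)
Section operators.
Context {R : realType} {K : numFieldType} {E : lmodType K}.
Variables (X : set E) (N : E -> R).
Implicit Types (T S : E -> E).

Definition bounded_operator T : Prop :=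
  [/\ (forall f, X f -> X (T f)),
      (forall (a : K) f g, X f -> X g -> T (a *: f + g) = a *: T f + T g)
    & exists M : R, forall f, X f -> N (T f) <= M * N f].

Definition operator_norm T : \bar R :=
  ereal_sup [set (N (T f))%:E | f in [set f | X f /\ N f <= 1]].

Definition cesaro_mean T (n : nat) : E -> E :=
  fun f => n%:R^-1 *: \sum_(1 <= m < n.+1) iter m T f.

Definition uniformly_mean_ergodic T : Prop :=
  exists2 P : E -> E, bounded_operator P
    & operator_norm (fun f => cesaro_mean T n f - P f) @[n --> \oo] --> 0%E.

End operators.

Section disk.
Context {R : realType}.

(* [R[i]] seen as a [numFieldType], whence its topology. *)
Local Notation CC := (Num.NumField.sort (R[i] : numFieldType)).

Definition unit_disk : set R[i] := [set z | normc z < 1].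

Definition holomorphic (f : R[i] -> R[i]) : Prop :=
  forall z, unit_disk z -> derivable (f : CC -> CC) z 1.

Definition cderive (f : R[i] -> R[i]) (z : R[i]) : R[i] :=
  derive1 (f : CC -> CC) z.

Definition disk_integral (g : R[i] -> R) : \bar R :=
  (\int[lebesgue_measure \x lebesgue_measure]_(w in
     [set w : R * R | unit_disk (w.1 +i* w.2)]) (g (w.1 +i* w.2))%:E)%E.

Definition sup_norm (f : R[i] -> R[i]) : \bar R :=
  ereal_sup [set (normc (f z))%:E | z in unit_disk].

Definition Hinfty (f : R[i] -> R[i]) : Prop :=
  holomorphic f /\ (sup_norm f < +oo)%E.

Definition besov_integral (p : R) (f : R[i] -> R[i]) : \bar R :=
  disk_integral
    (fun z => normc (cderive f z) `^ p * (1 - normc z ^+ 2) `^ (p - 2)).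

(* A function on the disk is represented by its extension by [0], so that
   equality in the Besov space is equality of functions on [R[i]]. *)
Definition besov (p : R) : set (R[i] -> R[i]) :=
  [set f | [/\ holomorphic f, (forall z, ~ unit_disk z -> f z = 0)
             & (besov_integral p f < +oo)%E]].

Definition besov_norm (p : R) (f : R[i] -> R[i]) : R :=
  normc (f 0) + fine (besov_integral p f) `^ p^-1.

Definition multiplication (psi f : R[i] -> R[i]) : R[i] -> R[i] :=
  fun z => psi z * f z.

End disk.

(* Main.v *)
Require Import Defs.
From HB Require Import structures.
From mathcomp Require Import all_boot all_order all_algebra.
From mathcomp Require Import all_classical all_reals all_analysis.
From mathcomp Require Import measurable_realfun complex ring lra.

Set Implicit Arguments.
Unset Strict Implicit.
Unset Printing Implicit Defensive.

Import Order.TTheory GRing.Theory Num.Theory.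
Import numFieldNormedType.Exports.
Import Normc.

Local Open Scope ring_scope.
Local Open Scope complex_scope.
Local Open Scope classical_set_scope.

Local Notation Re := complex.Re.
Local Notation Im := complex.Im.

(** For a multiplication operator the Cesaro means are again multiplications, by
    [q_n psi] with [q_n x = (x + ... + x ^ n) / n], and
    [(1 - x) q_n x = (x - x ^ (n + 1)) / n].

    Sufficiency. If [psi = 1] all means are the identity. Otherwise [1 - psi] is
    bounded away from 0 and [q_n psi] is of order [1 / n], but its derivative is not
    small: besides terms of order [1 / n] it contains a multiple of [psi ^ n psi']
    ([mean_poly_deriv]). The means tend to 0 in norm as soon as the integral of
    [|psi| ^ (n p) |psi'| ^ p |f| ^ p (1 - |z| ^ 2) ^ (p - 2)] tends to 0 uniformly for
    [f] in the unit ball. The growth bound [besov_growth],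
    [|f z| ^ p <= C (log (2 / (1 - |z| ^ 2))) ^ (p - 1) ||f|| ^ p], removes [f] from the
    integral; then dominated convergence applies, with the hypothesis on [psi] as
    the dominating function. The integrand does tend to 0 everywhere: at a point
    where [|psi| = 1] the derivative of [psi] vanishes ([contact_critical]).

    Necessity uses only that point evaluations are bounded. Evaluating the means
    shows [|psi| <= 1], since [psi ^ n / n] stays bounded. The limit operator is the
    multiplication by the pointwise limit of [q_n psi], the indicator function of
    the set where [psi = 1]; a holomorphic function with values 0 and 1 is constant,
    so either [psi = 1] or the limit is 0. In the second case some [q_n psi] is at
    most 1/2 in modulus, and [|1 - q_n x| <= n |1 - x|] for [|x| <= 1] bounds [1 - psi]
    from below.

    The growth bound rests on complex analysis that is built from Goursat's
    theorem ([goursat]) and Cauchy's formula on squares ([cauchy_square]): the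
    derivative of a holomorphic function is holomorphic ([deriv_cdiff]), hence
    bounded by its means over squares ([area_mean]). Along the dyadic points of a
    radius this bounds each increment of [f] by the p-th root of the part of the
    Besov integral that lies over a shell around the corresponding step
    ([shell_step]). The shells overlap boundedly and the number of steps up to [z] is
    of the order of [log (2 / (1 - |z| ^ 2))], so that Hoelder's inequality for the sum
    of the increments yields the exponent [p - 1] ([growth_diff]). *)

(** * Moduli and complex derivatives *)

(** Increments in place of quotients: [h = 0] needs no exception, and the
    estimate composes with affine paths without any division. *)
Lemma is_derive_epsP (K : numFieldType) (F : K -> K) (z d : K) :
  is_derive z 1 F d <-> forall e : K, 0 < e -> exists2 a : K, 0 < a &
    forall h, `|h| < a -> `|F (z + h) - F z - d * h| <= e * `|h|.
Proof.
have quotE (h : K) : h != 0 ->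
    `|d - h^-1 *: ((F \o shift z) (h *: 1) - F z)|
      = `|h|^-1 * `|F (z + h) - F z - d * h|.
  move=> h0; rewrite -normfV -normrM -normrN; congr `|_|.
  rewrite /= [h *: 1]mulr1 (addrC h z) /GRing.scale /=.
  by field.
split => [[dF eqd] e e0|dF].
  have cv : h^-1 *: ((F \o shift z) (h *: (1 : K)) - F z) @[h --> (0 : K)^'] --> d.
    by move: dF; rewrite -eqd; exact.
  have /cvgrPdist_le/(_ _ e0) := cv.
  rewrite near_withinE => /nbhs_normP[a a0 aF].
  exists a => // h ha.
  have [->|h0] := eqVneq h 0.
    by rewrite addr0 subrr mulr0 subr0 normr0 mulr0.
  have := aF h; rewrite /ball_ /= sub0r normrN => /(_ ha h0) le_e.
  by rewrite (mulrC e) -ler_pdivrMl ?normr_gt0 // -quotE.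
have cv : h^-1 *: ((F \o shift z) (h *: 1) - F z) @[h --> 0^'] --> d.
  apply/cvgrPdist_le => e e0.
  have [a a0 aF] := dF _ e0.
  near=> h.
  have ha : `|h| < a by near: h; exact: dnbhs0_lt.
  have h0 : h != 0 by near: h; exact: nbhs_dnbhs_neq.
  by rewrite quotE // ler_pdivrMl ?normr_gt0 // (mulrC _ e); exact: aF.
split; last exact: cvg_lim cv.
by apply/cvg_ex; exists d.
Unshelve. all: by end_near.
Qed.

Lemma is_derive_inv (K : numFieldType) (F : K -> K) (z d : K) : F z != 0 ->
  is_derive z 1 F d -> is_derive z 1 (fun x => (F x)^-1) (- d / F z ^+ 2).
Proof.
move=> F0 [dF dE]; split; first exact: derivableV.
by rewrite deriveV // dE /GRing.scale /= !mulNr mulrC.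
Qed.

Section ComplexPlane.
Context {R : realType}.
Implicit Types (z w h d : R[i]) (F G : R[i] -> R[i]).

Local Notation CC := (Num.NumField.sort (R[i] : numFieldType)).

Lemma normc_ge0 z : 0 <= normc z.
Proof. by case: z => a b; exact: sqrtr_ge0. Qed.

Lemma normrE_normc z : `|z| = ((normc z)%:C : R[i]).
Proof. by []. Qed.

Lemma normcD z w : normc (z + w) <= normc z + normc w.
Proof. exact: le_normcD. Qed.

Lemma normc_opp z : normc (- z) = normc z.
Proof. exact: normcN. Qed.

Lemma normcB z w : normc (z - w) <= normc z + normc w.
Proof. by rewrite -(normc_opp w); exact: normcD. Qed.

Lemma normcBC z w : normc (z - w) = normc (w - z).
Proof. by rewrite -normc_opp opprB. Qed.

Lemma normc_real (x : R) : normc x%:C = `|x|.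
Proof. by rewrite /= expr0n /= addr0 sqrtr_sqr. Qed.

Lemma normc_imag (x : R) : normc (0 +i* x) = `|x|.
Proof. by rewrite /= expr0n /= add0r sqrtr_sqr. Qed.

Lemma normc_i : normc ('i : R[i]) = 1.
Proof. by rewrite normc_imag normr1. Qed.

Lemma normc_Re z : `|Re z| <= normc z.
Proof.
case: z => a b /=; rewrite -sqrtr_sqr ler_sqrt ?lerDl ?sqr_ge0 //.
by rewrite addr_ge0 ?sqr_ge0.
Qed.

Lemma normc_Im z : `|Im z| <= normc z.
Proof.
case: z => a b /=; rewrite -sqrtr_sqr ler_sqrt ?lerDr ?sqr_ge0 //.
by rewrite addr_ge0 ?sqr_ge0.
Qed.

Lemma normc_le z : normc z <= `|Re z| + `|Im z|.
Proof.
have -> : z = (Re z)%:C + 0 +i* Im z.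
  by case: z => a b /=; apply/eqP; rewrite eq_complex /= addr0 add0r !eqxx.
apply: (le_trans (normcD _ _)); rewrite normc_real normc_imag.
by case: z => a b /=; rewrite addr0 add0r.
Qed.

Lemma normcX z n : normc (z ^+ n) = normc z ^+ n.
Proof.
by elim: n => [|n IH]; rewrite ?expr0 ?normc1 // !exprS normcM IH.
Qed.

Lemma normc_gt0 z : (0 < normc z) = (z != 0).
Proof.
rewrite lt0r normc_ge0 andbT; congr (~~ _); apply/eqP/eqP => [/eq0_normc //|->].
exact: normc0.
Qed.

Lemma normc_dist z w : `|normc z - normc w| <= normc (z - w).
Proof.
have h1 := normcD (z - w) w; have h2 := normcD (w - z) z.
rewrite !subrK in h1 h2; rewrite (normcBC w z) in h2.
by rewrite ler_norml; apply/andP; split; lra.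
Qed.

(** The complex derivative with real radii and tolerances, so that every estimate
    built on it stays in the ordered field [R]. *)
Definition cdiff F z d := forall e : R, 0 < e -> exists2 a : R, 0 < a &
  forall h, normc h < a -> normc (F (z + h) - F z - d * h) <= e * normc h.

Definition ccont F z := forall e : R, 0 < e -> exists2 a : R, 0 < a &
  forall h, normc h < a -> normc (F (z + h) - F z) <= e.

Lemma cdiffP F z d : cdiff F z d <-> is_derive (z : CC) 1 (F : CC -> CC) d.
Proof.
have posE (e : R[i]) : 0 < e -> exists2 x : R, 0 < x & e = x%:C.
  rewrite ltcE => /andP[/eqP im0 re0].
  by exists (Re e) => //; case: (e) im0 => ? ? /= ->.
split => [dF|/is_derive_epsP dF].
  apply/is_derive_epsP => _ /posE[e e0 ->].
  have [a a0 aF] := dF _ e0.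
  exists a%:C; first by rewrite ltcR.
  move=> h; rewrite !normrE_normc ltcR => /aF.
  by rewrite -lecR rmorphM.
move=> e e0.
have e0' : (0 : CC) < e%:C by rewrite ltcR.
have [_ /posE[a a0 ->] aF] := dF _ e0'.
exists a => // h; rewrite -ltcR => /aF.
by rewrite !normrE_normc -rmorphM lecR.
Qed.

Lemma cdiff_cont F z d : cdiff F z d -> ccont F z.
Proof.
move=> dF e e0.
have [a a0 aF] := dF 1 ltr01.
have n0 := normc_ge0 d.
have b0 : 0 < e / (1 + normc d) by rewrite divr_gt0 //; lra.
exists (Num.min a (e / (1 + normc d))); first by rewrite lt_min a0.
move=> h; rewrite lt_min => /andP[ha hb].
have h1 := aF _ ha.
have h2 : normc (F (z + h) - F z) <= normc (F (z + h) - F z - d * h) + normc (d * h).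
  by rewrite -[X in normc X <= _](subrK (d * h)); exact: normcD.
rewrite normcM in h2.
move: hb; rewrite ltr_pdivlMr; last by lra.
by nra.
Qed.

Lemma cdiff_uniq F z d d' : cdiff F z d -> cdiff F z d' -> d = d'.
Proof.
move=> /cdiffP d1 /cdiffP d2.
by rewrite -(@derive_val _ _ _ _ _ _ _ d1) -(@derive_val _ _ _ _ _ _ _ d2).
Qed.

Lemma cdiff_local F G z d (a : R) : 0 < a ->
  (forall h, normc h < a -> F (z + h) = G (z + h)) -> cdiff F z d -> cdiff G z d.
Proof.
move=> a0 eFG dF e e0; have [b b0 bF] := dF _ e0.
exists (Num.min a b); first by rewrite lt_min a0.
move=> h; rewrite lt_min => /andP[ha hb].
have := eFG 0; rewrite normc0 addr0 => /(_ a0) <-.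
by rewrite -eFG //; exact: bF.
Qed.

Lemma cdiff_cst c z : cdiff (fun=> c) z 0.
Proof.
move=> e e0; exists 1 => // h _; rewrite subrr mul0r subrr normc0.
by rewrite mulr_ge0 ?normc_ge0 // ltW.
Qed.

Lemma cdiff_id z : cdiff id z 1.
Proof.
move=> e e0; exists 1 => // h _.
rewrite (_ : id (z + h) - id z - 1 * h = 0); last by rewrite /=; ring.
by rewrite normc0 mulr_ge0 ?normc_ge0 // ltW.
Qed.

Lemma cdiffD F G z d d' :
  cdiff F z d -> cdiff G z d' -> cdiff (fun x => F x + G x) z (d + d').
Proof. by move=> /cdiffP ? /cdiffP ?; apply/cdiffP; exact: is_deriveD. Qed.

Lemma cdiffM F G z d d' : cdiff F z d -> cdiff G z d' ->
  cdiff (fun x => F x * G x) z (d * G z + F z * d').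
Proof.
move=> /cdiffP ? /cdiffP ?; apply/cdiffP.
have -> : d * G z + F z * d' = F z *: (d' : CC) + G z *: (d : CC).
  by rewrite addrC (mulrC d).
exact: (@is_deriveM _ _ (F : CC -> CC) (G : CC -> CC)).
Qed.

Lemma cdiffN F z d : cdiff F z d -> cdiff (fun x => - F x) z (- d).
Proof. by move=> /cdiffP ?; apply/cdiffP; exact: is_deriveN. Qed.

Lemma cdiffB F G z d d' :
  cdiff F z d -> cdiff G z d' -> cdiff (fun x => F x - G x) z (d - d').
Proof. by move=> dF dG; apply: cdiffD => //; exact: cdiffN. Qed.

Lemma cdiffV F z d : F z != 0 -> cdiff F z d ->
  cdiff (fun x => (F x)^-1) z (- d / F z ^+ 2).
Proof.
by move=> F0 /cdiffP dF; apply/cdiffP; exact: (@is_derive_inv (R[i] : numFieldType) F z d F0 dF).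
Qed.

End ComplexPlane.

(** * The mean value inequality and integrals on segments *)

Section Segments.
Context {R : realType}.
Implicit Types (z w h d : R[i]) (F G : R[i] -> R[i]) (phi : R -> R[i]).

Lemma normc_mulr_real (t : R) z : normc (t%:C * z) = `|t| * normc z.
Proof. by rewrite normcM normc_real. Qed.

Lemma ReB z w : Re (z - w) = Re z - Re w.
Proof. by case: z; case: w. Qed.

Lemma ImB z w : Im (z - w) = Im z - Im w.
Proof. by case: z; case: w. Qed.

Lemma ReZ (t : R) z : Re (t%:C * z) = t * Re z.
Proof. by case: z => a b /=; rewrite mul0r subr0. Qed.

Lemma ImZ (t : R) z : Im (t%:C * z) = t * Im z.
Proof. by case: z => a b /=; rewrite mul0r addr0. Qed.

Lemma cdiff_path F z w d (t : R) : cdiff F (z + t%:C * w) d ->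
  forall e : R, 0 < e -> exists2 a : R, 0 < a & forall s : R, `|s| < a ->
  normc (F (z + (t + s)%:C * w) - F (z + t%:C * w) - s%:C * (d * w)) <= e * `|s|.
Proof.
move=> dF e e0; have w0 := normc_ge0 w.
have e1 : 0 < e / (1 + normc w) by rewrite divr_gt0 //; lra.
have [a a0 aF] := dF _ e1.
have a1 : 0 < a / (1 + normc w) by rewrite divr_gt0 //; lra.
exists (a / (1 + normc w)) => // s; rewrite ltr_pdivlMr; last by lra.
move=> sa.
have := aF (s%:C * w); rewrite normc_mulr_real.
have s0 := normr_ge0 s.
rewrite mulrDr mulr1 in sa; move=> /(_ ltac:(lra)).
rewrite (_ : z + t%:C * w + s%:C * w = z + (t + s)%:C * w); last first.
  by rewrite rmorphD /=; ring.
rewrite (_ : d * (s%:C * w) = s%:C * (d * w)); last by ring.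
move=> le1; apply: (le_trans le1).
rewrite -mulrA ler_pM2l // ler_pdivrMl; last by lra.
by nra.
Qed.

Lemma is_derive_Re_path F z w d (t : R) : cdiff F (z + t%:C * w) d ->
  is_derive t 1 (fun s : R => Re (F (z + s%:C * w))) (Re (d * w)).
Proof.
move=> dF; apply/is_derive_epsP => e e0.
have [a a0 aF] := cdiff_path dF e0.
exists a => // s /aF; apply: le_trans.
by rewrite (mulrC _ s) -ReZ -!ReB; exact: normc_Re.
Qed.

Lemma is_derive_Im_path F z w d (t : R) : cdiff F (z + t%:C * w) d ->
  is_derive t 1 (fun s : R => Im (F (z + s%:C * w))) (Im (d * w)).
Proof.
move=> dF; apply/is_derive_epsP => e e0.
have [a a0 aF] := cdiff_path dF e0.
exists a => // s /aF; apply: le_trans.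
by rewrite (mulrC _ s) -ImZ -!ImB; exact: normc_Im.
Qed.

Lemma real_mean_value (f df : R -> R) (M : R) :
  (forall t : R, 0 <= t <= 1 -> is_derive t 1 f (df t)) ->
  (forall t : R, 0 <= t <= 1 -> `|df t| <= M) -> `|f 1 - f 0| <= M.
Proof.
move=> dF dM.
have [|t||c cI ->] := @MVT_segment R f df 0 1.
- exact: ler01.
- by rewrite in_itv /= => /andP[t0 t1]; apply: dF; lra.
- apply: derivable_within_continuous => t; rewrite in_itv /= => tI.
  by case: (dF t tI).
- by rewrite subr0 mulr1; apply: dM; move: cI; rewrite in_itv.
Qed.

(** The real and the imaginary part obey the real mean value theorem separately
    along the segment; adding the two bounds costs the factor 2. *)
Lemma mean_value_ineq F (D : R[i] -> R[i]) z w (M : R) :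
  (forall t : R, 0 <= t <= 1 -> cdiff F (z + t%:C * (w - z)) (D (z + t%:C * (w - z))))
  -> (forall t : R, 0 <= t <= 1 -> normc (D (z + t%:C * (w - z))) <= M) ->
  normc (F w - F z) <= 2 * (M * normc (w - z)).
Proof.
move=> dF dM.
have bnd t : 0 <= t <= 1 -> normc (D (z + t%:C * (w - z)) * (w - z)) <= M * normc (w - z).
  by move=> tI; rewrite normcM ler_wpM2r ?normc_ge0 ?dM.
have hRe := @real_mean_value _ _ (M * normc (w - z))
  (fun t tI => is_derive_Re_path (dF t tI))
  (fun t tI => le_trans (normc_Re _) (bnd t tI)).
have hIm := @real_mean_value _ _ (M * normc (w - z))
  (fun t tI => is_derive_Im_path (dF t tI))
  (fun t tI => le_trans (normc_Im _) (bnd t tI)).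
apply: (le_trans (normc_le _)).
have e1 : z + 1%:C * (w - z) = w by rewrite mul1r addrC subrK.
have e0 : z + 0%:C * (w - z) = z by rewrite mul0r addr0.
rewrite e1 e0 -ReB in hRe; rewrite e1 e0 -ImB in hIm.
by lra.
Qed.

Definition rint (f : R -> R) (a b : R) : R :=
  \int[lebesgue_measure]_(x in `[a, b]) f x.

Definition cint phi a b : R[i] :=
  (rint (fun t => Re (phi t)) a b) +i* (rint (fun t => Im (phi t)) a b).

(** Continuity relative to the segment: the integrands below are controlled on
    the contour and nowhere else. *)
Definition segcont phi (a b : R) := forall t, a <= t <= b ->
  forall e : R, 0 < e -> exists2 c : R, 0 < c &
  forall s, a <= s <= b -> `|s - t| < c -> normc (phi s - phi t) <= e.

Definition rintegrable (f : R -> R) (a b : R) :=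
  lebesgue_measure.-integrable `[a, b] (EFin \o f).

Lemma epsdelta_rintegrable (f : R -> R) a b : (forall t, a <= t <= b ->
    forall e : R, 0 < e -> exists2 c : R, 0 < c &
    forall s, a <= s <= b -> `|s - t| < c -> `|f s - f t| <= e) ->
  rintegrable f a b.
Proof.
move=> fc; apply: continuous_compact_integrable; first exact: segment_compact.
apply/subspace_continuousP => t; rewrite /= in_itv /= => tI.
apply/cvgrPdist_le => e e0.
have [c c0 cf] := fc _ tI _ e0.
rewrite near_withinE; apply/nbhs_normP; exists c => // s.
rewrite /ball_ /= => st; rewrite in_itv /= => sI.
by rewrite distrC; apply: cf => //; rewrite distrC.
Qed.

Lemma segcont_Re phi a b : segcont phi a b ->
  rintegrable (fun t => Re (phi t)) a b.
Proof.
move=> pc; apply: epsdelta_rintegrable => t tI e e0.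
have [c c0 cf] := pc t tI e e0; exists c => // s sI st.
by rewrite -ReB; apply: (le_trans (normc_Re _)); exact: cf.
Qed.

Lemma segcont_Im phi a b : segcont phi a b ->
  rintegrable (fun t => Im (phi t)) a b.
Proof.
move=> pc; apply: epsdelta_rintegrable => t tI e e0.
have [c c0 cf] := pc t tI e e0; exists c => // s sI st.
by rewrite -ImB; apply: (le_trans (normc_Im _)); exact: cf.
Qed.

Lemma segcont_norm phi a b : segcont phi a b ->
  rintegrable (fun t => normc (phi t)) a b.
Proof.
move=> pc; apply: epsdelta_rintegrable => t tI e e0.
have [c c0 cf] := pc t tI e e0; exists c => // s sI st.
by apply: (le_trans (normc_dist _ _)); exact: cf.
Qed.

Lemma segcontD phi psi a b : segcont phi a b -> segcont psi a b ->
  segcont (fun t => phi t + psi t) a b.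
Proof.
move=> hp hq t tI e e0; have e1 : 0 < e / 2 by lra.
have [c c0 cf] := hp t tI _ e1; have [c' c'0 cf'] := hq t tI _ e1.
exists (Num.min c c'); first by rewrite lt_min c0.
move=> s sI; rewrite lt_min => /andP[s1 s2].
rewrite (_ : _ - _ = (phi s - phi t) + (psi s - psi t)); last by ring.
apply: (le_trans (normcD _ _)).
by have := cf s sI s1; have := cf' s sI s2; lra.
Qed.

Lemma segcontZ k phi a b : segcont phi a b -> segcont (fun t => k * phi t) a b.
Proof.
move=> hp t tI e e0; have k0 := normc_ge0 k.
have e1 : 0 < e / (1 + normc k) by rewrite divr_gt0 //; lra.
have [c c0 cf] := hp t tI _ e1; exists c => // s sI st.
rewrite -mulrBr normcM; have := cf s sI st.
have n0 := normc_ge0 (phi s - phi t).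
by rewrite ler_pdivlMr; [nra|lra].
Qed.

Lemma segcont_cst k a b : segcont (fun=> k) a b.
Proof.
by move=> t _ e e0; exists 1 => // s _ _; rewrite subrr normc0 ltW.
Qed.

Lemma segcontN phi a b : segcont phi a b -> segcont (fun t => - phi t) a b.
Proof.
move=> /(segcontZ (-1)) hp.
by rewrite (_ : (fun t => _) = (fun t => - 1 * phi t)) //; apply/funext => t; ring.
Qed.

Lemma segcontB phi psi a b : segcont phi a b -> segcont psi a b ->
  segcont (fun t => phi t - psi t) a b.
Proof. by move=> hp hq; apply: segcontD => //; exact: segcontN. Qed.

Lemma segcont_path F z w a b :
  (forall t, a <= t <= b -> ccont F (z + t%:C * w)) ->
  segcont (fun t => F (z + t%:C * w)) a b.
Proof.
move=> hF t tI e e0; have w0 := normc_ge0 w.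
have [c c0 cF] := hF t tI _ e0.
have c1 : 0 < c / (1 + normc w) by rewrite divr_gt0 //; lra.
exists (c / (1 + normc w)) => // s sI; rewrite ltr_pdivlMr; last by lra.
move=> st; have s0 := normr_ge0 (s - t).
have := cF ((s - t)%:C * w); rewrite normc_mulr_real => /(_ ltac:(nra)).
rewrite (_ : z + t%:C * w + (s - t)%:C * w = z + s%:C * w) //.
by rewrite rmorphB /=; ring.
Qed.

Lemma rintD f g a b : rintegrable f a b -> rintegrable g a b ->
  rint (fun t => f t + g t) a b = rint f a b + rint g a b.
Proof. by move=> hf hg; rewrite /rint RintegralD. Qed.

Lemma rintZ k f a b : rintegrable f a b ->
  rint (fun t => k * f t) a b = k * rint f a b.
Proof. by move=> hf; rewrite /rint RintegralZl. Qed.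

Lemma rint_cst k a b : a <= b -> rint (fun=> k) a b = k * (b - a).
Proof.
move=> ab; rewrite /rint Rintegral_cst //= lebesgue_measure_itv /= lte_fin.
by case: ltP => // ba; have -> : a = b by [lra]; rewrite subrr mulr0.
Qed.

Lemma rint_split f a c b : a <= c <= b -> rintegrable f a b ->
  rint f a b = rint f a c + rint f c b.
Proof.
move=> /andP[ac cb] hf; rewrite /rint.
have hcb : lebesgue_measure.-integrable `]c, b] (EFin \o f).
  apply: integrableS hf => //= x; rewrite /= !in_itv /= => /andP[? ?]; lra.
rewrite -(Rintegral_itv_obnd_cbnd hcb).
rewrite -(@Rintegral_itvB R f (BLeft a) (BRight b) c) //; ring.
Qed.

Lemma le_rint f g a b : rintegrable f a b -> rintegrable g a b ->
  (forall t, a <= t <= b -> f t <= g t) -> rint f a b <= rint g a b.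
Proof.
by move=> hf hg fg; apply: le_Rintegral => // t; rewrite /= in_itv /=; exact: fg.
Qed.

Lemma abs_rint f a b : rintegrable f a b -> `|rint f a b| <= rint (fun t => `|f t|) a b.
Proof. by move=> hf; exact: le_normr_Rintegral. Qed.

Lemma eq_rint f g a b : (forall t, a <= t <= b -> f t = g t) ->
  rint f a b = rint g a b.
Proof.
by move=> fg; apply: eq_Rintegral => t; rewrite inE /= in_itv /= => /fg.
Qed.

Lemma eq_cint phi psi a b : (forall t, a <= t <= b -> phi t = psi t) ->
  cint phi a b = cint psi a b.
Proof.
by move=> pq; rewrite /cint; congr (_ +i* _); apply: eq_rint => t /pq ->.
Qed.

Lemma cintD phi psi a b : segcont phi a b -> segcont psi a b ->
  cint (fun t => phi t + psi t) a b = cint phi a b + cint psi a b.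
Proof.
move=> hp hq; rewrite /cint.
have -> : (fun t => Re (phi t + psi t)) = (fun t => Re (phi t) + Re (psi t)).
  by apply/funext => t; case: (phi t); case: (psi t).
have -> : (fun t => Im (phi t + psi t)) = (fun t => Im (phi t) + Im (psi t)).
  by apply/funext => t; case: (phi t); case: (psi t).
by rewrite !rintD //; (exact: segcont_Re || exact: segcont_Im).
Qed.

Lemma cintZ k phi a b : segcont phi a b ->
  cint (fun t => k * phi t) a b = k * cint phi a b.
Proof.
move=> hp; have hRe := segcont_Re hp; have hIm := segcont_Im hp.
case: k => k l; rewrite /cint.
have int_mul (x : R) f : rintegrable f a b -> rintegrable (fun t => x * f t) a b.
  by move=> hf; apply: (@integrableZl _ _ _ lebesgue_measure _ _ x (EFin \o f)).
have -> : (fun t => Re ((k +i* l) * phi t)) = (fun t => k * Re (phi t) + (- l) * Im (phi t)).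
  by apply/funext => t; case: (phi t) => ? ? /=; rewrite mulNr.
have -> : (fun t => Im ((k +i* l) * phi t)) = (fun t => k * Im (phi t) + l * Re (phi t)).
  by apply/funext => t; case: (phi t) => ? ? /=; rewrite addrC; ring.
rewrite !rintD ?rintZ //; try exact: int_mul.
by apply/eqP; rewrite eq_complex /= mulNr addrC [X in X == _]addrC !eqxx /= addrC eqxx.
Qed.

Lemma cintB phi psi a b : segcont phi a b -> segcont psi a b ->
  cint (fun t => phi t - psi t) a b = cint phi a b - cint psi a b.
Proof.
move=> hp hq.
rewrite (_ : (fun t => _) = (fun t => phi t + (- 1) * psi t)); last first.
  by apply/funext => t; ring.
rewrite cintD ?cintZ //; last exact: segcontZ.
by ring.
Qed.

Lemma cint_cst k a b : a <= b -> cint (fun=> k) a b = k * (b - a)%:C.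
Proof.
move=> ab; rewrite /cint !rint_cst //; case: k => k l.
by apply/eqP; rewrite eq_complex /= !mulr0 subr0 add0r !eqxx.
Qed.

Lemma cint_split phi a c b : a <= c <= b -> segcont phi a b ->
  cint phi a b = cint phi a c + cint phi c b.
Proof.
move=> acb hp; rewrite /cint (rint_split acb); last exact: segcont_Re.
by rewrite (rint_split acb); last exact: segcont_Im.
Qed.

(** The factor 2 again comes from treating real and imaginary parts separately. *)
Lemma cint_norm phi a b : segcont phi a b ->
  normc (cint phi a b) <= 2 * rint (fun t => normc (phi t)) a b.
Proof.
move=> hp; apply: (le_trans (normc_le _)).
have hn := segcont_norm hp; have hRe := segcont_Re hp; have hIm := segcont_Im hp.
have absi f : rintegrable f a b -> rintegrable (fun t => `|f t|) a b.
  by move=> hf; exact: (integrable_norm hf).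
have h1 : `|rint (fun t => Re (phi t)) a b| <= rint (fun t => normc (phi t)) a b.
  apply: (le_trans (abs_rint hRe)); apply: le_rint => //; first exact: absi.
  by move=> t _; exact: normc_Re.
have h2 : `|rint (fun t => Im (phi t)) a b| <= rint (fun t => normc (phi t)) a b.
  apply: (le_trans (abs_rint hIm)); apply: le_rint => //; first exact: absi.
  by move=> t _; exact: normc_Im.
by rewrite /cint /=; lra.
Qed.

Lemma cint_bound phi a b (M : R) : a <= b -> segcont phi a b ->
  (forall t, a <= t <= b -> normc (phi t) <= M) ->
  normc (cint phi a b) <= 2 * (M * (b - a)).
Proof.
move=> ab hp pM; apply: (le_trans (cint_norm hp)).
rewrite ler_pM2l // -rint_cst //; apply: le_rint => //; first exact: segcont_norm.
by apply: (@epsdelta_rintegrable (fun=> M)) => t _ e e0; exists 1 => // s _ _; rewrite subrr normr0 ltW.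
Qed.

End Segments.

(** * Goursat's theorem on rectangles *)

Section Goursat.
Context {R : realType}.
Implicit Types (z w d : R[i]) (F G : R[i] -> R[i]) (x y : R).

Lemma horizontalE x y : x +i* y = 0 +i* y + x%:C * 1 :> R[i].
Proof. by rewrite mulr1; apply/eqP; rewrite eq_complex /= add0r addr0 !eqxx. Qed.

Lemma verticalE x y : x +i* y = x%:C + y%:C * 'i :> R[i].
Proof. by apply/eqP; rewrite eq_complex /= !(mulr0, mulr1, mul0r, addr0, subr0, add0r) !eqxx. Qed.

Lemma segcont_horizontal F a b y :
  (forall x, a <= x <= b -> ccont F (x +i* y)) ->
  segcont (fun x => F (x +i* y)) a b.
Proof.
move=> hF; rewrite (_ : (fun x => _) = (fun x => F (0 +i* y + x%:C * 1))); last first.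
  by apply/funext => x; rewrite -horizontalE.
by apply: segcont_path => x /hF; rewrite -horizontalE.
Qed.

Lemma segcont_vertical F a b x :
  (forall y, a <= y <= b -> ccont F (x +i* y)) ->
  segcont (fun y => F (x +i* y)) a b.
Proof.
move=> hF; rewrite (_ : (fun y => _) = (fun y => F (x%:C + y%:C * 'i))); last first.
  by apply/funext => y; rewrite -verticalE.
by apply: segcont_path => y /hF; rewrite -verticalE.
Qed.

(** The contour integral over the boundary of [x1, x2] x [y1, y2]. Opposite sides
    share one integrand: for an affine function both integrands are constant and
    the two contributions visibly cancel. *)
Definition rect F x1 x2 y1 y2 : R[i] :=
  cint (fun x => F (x +i* y1) - F (x +i* y2)) x1 x2
  + 'i * cint (fun y => F (x2 +i* y) - F (x1 +i* y)) y1 y2.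

Definition rcont F x1 x2 y1 y2 := forall x y,
  x1 <= x <= x2 -> y1 <= y <= y2 -> ccont F (x +i* y).

(** Continuity is asked on the sides and on the cut, not inside: cuts can thus
    isolate a singularity. *)
Lemma rect_splitx F x1 c x2 y1 y2 : x1 <= c <= x2 -> y1 <= y2 ->
  (forall x y, x1 <= x <= x2 -> y1 <= y <= y2 ->
    [\/ x = c, x = x1 \/ x = x2, y = y1 | y = y2] -> ccont F (x +i* y)) ->
  rect F x1 x2 y1 y2 = rect F x1 c y1 y2 + rect F c x2 y1 y2.
Proof.
move=> /[dup] cI /andP[x1c cx2] y12 hF.
have sh x x' y : x1 <= x -> x' <= x2 -> y = y1 \/ y = y2 ->
    segcont (fun t => F (t +i* y)) x x'.
  move=> xx xx' yE; apply: segcont_horizontal => t tI; apply: hF; [lra|lra|].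
  by case: yE => ->; [apply: Or43|apply: Or44].
have sv x : [\/ x = c, x = x1 | x = x2] -> segcont (fun y => F (x +i* y)) y1 y2.
  move=> xE; apply: segcont_vertical => t tI; apply: hF; [by case: xE => ->; lra|lra|].
  by case: xE => ->; [apply: Or41|apply: Or42; left|apply: Or42; right].
have [y1E y2E] : (y1 = y1 \/ y1 = y2) /\ (y2 = y1 \/ y2 = y2) by split; [left|right].
have v1 := sv _ (Or31 _ _ (erefl c)); have v2 := sv _ (Or32 _ _ (erefl x1)).
have v3 := sv _ (Or33 _ _ (erefl x2)).
rewrite /rect (cint_split cI); last by apply: segcontB; apply: sh.
rewrite !cintB //; last 4 first.
- exact: sh.
- exact: sh.
- exact: sh.
- exact: sh.
by ring.
Qed.

Lemma rect_splity F x1 x2 y1 c y2 : y1 <= c <= y2 -> x1 <= x2 ->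
  (forall x y, x1 <= x <= x2 -> y1 <= y <= y2 ->
    [\/ y = c, y = y1 \/ y = y2, x = x1 | x = x2] -> ccont F (x +i* y)) ->
  rect F x1 x2 y1 y2 = rect F x1 x2 y1 c + rect F x1 x2 c y2.
Proof.
move=> /[dup] cI /andP[y1c cy2] x12 hF.
have sv y y' x : y1 <= y -> y' <= y2 -> x = x1 \/ x = x2 ->
    segcont (fun t => F (x +i* t)) y y'.
  move=> yy yy' xE; apply: segcont_vertical => t tI; apply: hF; [lra|lra|].
  by case: xE => ->; [apply: Or43|apply: Or44].
have sh y : [\/ y = c, y = y1 | y = y2] -> segcont (fun x => F (x +i* y)) x1 x2.
  move=> yE; apply: segcont_horizontal => t tI; apply: hF; [lra|by case: yE => ->; lra|].
  by case: yE => ->; [apply: Or41|apply: Or42; left|apply: Or42; right].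
have [x1E x2E] : (x1 = x1 \/ x1 = x2) /\ (x2 = x1 \/ x2 = x2) by split; [left|right].
have h1 := sh _ (Or31 _ _ (erefl c)); have h2 := sh _ (Or32 _ _ (erefl y1)).
have h3 := sh _ (Or33 _ _ (erefl y2)).
rewrite /rect (cint_split cI); last by apply: segcontB; apply: sv.
rewrite !cintB //; last 4 first.
- exact: sv.
- exact: sv.
- exact: sv.
- exact: sv.
by ring.
Qed.

(** The affine part of [F] integrates to 0, so only the remainder counts: it is at
    most [e] times the diameter, on a contour of comparable length. *)
Lemma rect_affine_bound F x1 x2 y1 y2 A d z0 (e : R) : x1 <= x2 -> y1 <= y2 ->
  0 <= e -> x1 <= Re z0 <= x2 -> y1 <= Im z0 <= y2 -> rcont F x1 x2 y1 y2 ->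
  (forall x y, x1 <= x <= x2 -> y1 <= y <= y2 ->
     normc (F (x +i* y) - A - d * (x +i* y - z0)) <= e * normc (x +i* y - z0)) ->
  normc (rect F x1 x2 y1 y2) <= 4 * e * (x2 - x1 + (y2 - y1)) ^+ 2.
Proof.
move=> x12 y12 e0 Re0 Im0 hF hA; set s := x2 - x1 + (y2 - y1).
have hs x y : x1 <= x <= x2 -> y1 <= y <= y2 ->
    normc (F (x +i* y) - A - d * (x +i* y - z0)) <= e * s.
  move=> xI yI; apply: (le_trans (hA x y xI yI)); apply: ler_wpM2l => //.
  apply: (le_trans (normc_le _)); rewrite ReB ImB /=.
  have h1 : `|x - Re z0| <= x2 - x1 by rewrite ler_norml; apply/andP; split; lra.
  have h2 : `|y - Im z0| <= y2 - y1 by rewrite ler_norml; apply/andP; split; lra.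
  by rewrite /s; lra.
have ch : segcont (fun x => F (x +i* y1) - F (x +i* y2)) x1 x2.
  by apply: segcontB; apply: segcont_horizontal => x xI; apply: hF; lra.
have cv : segcont (fun y => F (x2 +i* y) - F (x1 +i* y)) y1 y2.
  by apply: segcontB; apply: segcont_vertical => y yI; apply: hF; lra.
pose k := d * (0 +i* (y1 - y2)); pose l := d * (x2 - x1)%:C.
have s0 : 0 <= s by rewrite /s; lra.
have bh : normc (cint (fun x => F (x +i* y1) - F (x +i* y2) - k) x1 x2)
    <= 2 * ((2 * (e * s)) * (x2 - x1)).
  apply: cint_bound => //; first by apply: segcontB => //; exact: segcont_cst.
  move=> x xI.
  have -> : F (x +i* y1) - F (x +i* y2) - k =
    (F (x +i* y1) - A - d * (x +i* y1 - z0)) - (F (x +i* y2) - A - d * (x +i* y2 - z0)).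
    rewrite /k (_ : 0 +i* (y1 - y2) = (x +i* y1) - (x +i* y2)); first by ring.
    by apply/eqP; rewrite eq_complex /= subrr !eqxx.
  apply: (le_trans (normcB _ _)).
  have yI1 : y1 <= y1 <= y2 by lra.
  have yI2 : y1 <= y2 <= y2 by lra.
  by have := hs x y1 xI yI1; have := hs x y2 xI yI2; lra.
have bv : normc (cint (fun y => F (x2 +i* y) - F (x1 +i* y) - l) y1 y2)
    <= 2 * ((2 * (e * s)) * (y2 - y1)).
  apply: cint_bound => //; first by apply: segcontB => //; exact: segcont_cst.
  move=> y yI.
  have -> : F (x2 +i* y) - F (x1 +i* y) - l =
    (F (x2 +i* y) - A - d * (x2 +i* y - z0)) - (F (x1 +i* y) - A - d * (x1 +i* y - z0)).
    rewrite /l (_ : (x2 - x1)%:C = (x2 +i* y) - (x1 +i* y)); first by ring.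
    by apply/eqP; rewrite eq_complex /= subrr !eqxx.
  apply: (le_trans (normcB _ _)).
  have xI1 : x1 <= x1 <= x2 by lra.
  have xI2 : x1 <= x2 <= x2 by lra.
  by have := hs x1 y xI1 yI; have := hs x2 y xI2 yI; lra.
rewrite cintB // in bh; last exact: segcont_cst.
rewrite cintB // in bv; last exact: segcont_cst.
rewrite !cint_cst // in bh bv.
have -> : rect F x1 x2 y1 y2 =
   (cint (fun x => F (x +i* y1) - F (x +i* y2)) x1 x2 - k * (x2 - x1)%:C)
   + 'i * (cint (fun y => F (x2 +i* y) - F (x1 +i* y)) y1 y2 - l * (y2 - y1)%:C).
  rewrite /rect (_ : k * (x2 - x1)%:C = - ('i * (l * (y2 - y1)%:C))); first by ring.
  rewrite /k /l; have -> : 0 +i* (y1 - y2) = - ('i * (y2 - y1)%:C) :> R[i].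
    by apply/eqP; rewrite eq_complex /= !(mulr0, mul0r, mul1r, subr0, oppr0, addr0, add0r, opprB) !eqxx.
  by ring.
apply: (le_trans (normcD _ _)); rewrite normcM normc_i mul1r.
rewrite (_ : 4 * e * s ^+ 2 = 2 * (2 * (e * s) * (x2 - x1)) + 2 * (2 * (e * s) * (y2 - y1))); last by rewrite /s; ring.
by rewrite lerD.
Qed.

Lemma nested_intervals (a b : nat -> R) : (forall n, a n <= a n.+1) ->
  (forall n, b n.+1 <= b n) -> (forall n, a n <= b n) ->
  exists l, forall n, a n <= l <= b n.
Proof.
move=> ha hb hab.
have ma m n : (m <= n)%N -> a m <= a n.
  by move=> mn; apply: (@homo_leq _ a (fun u v => u <= v)) mn => // ? ? ?; exact: le_trans.
have mb m n : (m <= n)%N -> b n <= b m.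
  by move=> mn; apply: (@homo_leq _ b (fun u v => v <= u)) mn => // ? ? ? h1 h2; exact: le_trans h2 h1.
have ub m n : a m <= b n.
  case/orP: (leq_total m n) => mn; first exact: le_trans (ma _ _ mn) (hab n).
  exact: le_trans (hab m) (mb _ _ mn).
have hs : has_sup (range a).
  by split; [exists (a 0%N); exists 0%N | exists (b 0%N) => _ [m _ <-]].
exists (sup (range a)) => n; apply/andP; split.
  by apply: ub_le_sup; [case: hs | exists n].
by apply: ge_sup; [exists (a 0%N); exists 0%N | move=> _ [m _ <-]].
Qed.

Lemma exists_pow2 (M e : R) : 0 < e -> exists n : nat, M < e * 2 ^+ n.
Proof.
move=> e0; exists (Num.bound (`|M| / e)).
have : `|M| / e < (Num.bound (`|M| / e))%:R.
  by apply: archi_boundP; rewrite divr_ge0 // ltW.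
rewrite ltr_pdivrMr // => h1; apply: (le_lt_trans (ler_norm M)); apply: (lt_le_trans h1).
rewrite mulrC ler_pM2l // -natrX ler_nat; apply: ltnW; exact: ltn_expl.
Qed.

(** Four quarters share the total, so one of them carries a fourth of it. *)
Lemma rect_quarter F x u y v : 0 <= u -> 0 <= v ->
  rcont F x (x + u + u) y (y + v + v) ->
  exists x' y', [/\ x' = x \/ x' = x + u, y' = y \/ y' = y + v &
    normc (rect F x (x + u + u) y (y + v + v))
      <= 4 * normc (rect F x' (x' + u) y' (y' + v))].
Proof.
move=> u0 v0 cF.
rewrite (@rect_splitx F x (x + u)); [|lra|lra|by move=> ? ? ? ? _; exact: cF].
rewrite (@rect_splity F x _ y (y + v)); [|lra|lra|by move=> ? ? ? ? _; apply: cF; lra].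
rewrite (@rect_splity F (x + u) _ y (y + v)); [|lra|lra|by move=> ? ? ? ? _; apply: cF; lra].
clear cF.
have four (a b c d : R[i]) : [\/ normc (a + b + (c + d)) <= 4 * normc a,
    normc (a + b + (c + d)) <= 4 * normc b, normc (a + b + (c + d)) <= 4 * normc c
  | normc (a + b + (c + d)) <= 4 * normc d].
  have t1 := normcD (a + b) (c + d); have t2 := normcD a b; have t3 := normcD c d.
  move: t1 t2 t3; move: (normc (a + b + _)) (normc (a + b)) (normc (c + d)) (normc a)
    (normc b) (normc c) (normc d) => k0 k1 k2 k3 k4 k5 k6 t1 t2 t3.
  have [|g1] := leP k0 (4 * k3); first by move=> ?; apply: Or41.
  have [|g2] := leP k0 (4 * k4); first by move=> ?; apply: Or42.
  have [|g3] := leP k0 (4 * k5); first by move=> ?; apply: Or43.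
  by apply: Or44; lra.
case: (four (rect F x (x + u) y (y + v)) (rect F x (x + u) (y + v) (y + v + v))
  (rect F (x + u) (x + u + u) y (y + v)) (rect F (x + u) (x + u + u) (y + v) (y + v + v))).
- by exists x, y; split => //; left.
- by exists x, (y + v); split => //; [left|right].
- by exists (x + u), y; split => //; [right|left].
- by exists (x + u), (y + v); split => //; right.
Qed.

Lemma nest_facts (x1 x2 x u U x' : R) : x1 <= x -> x + U <= x2 -> U = u + u ->
  0 <= u -> x' = x \/ x' = x + u ->
  [/\ x1 <= x', x' + u <= x2, x <= x' & x' + u <= x + U].
Proof. by move=> ? ? ? ? [->|->]; split; lra. Qed.

(** Bisection: along nested quarters the contour integral shrinks at most like
    [4 ^- n], that is, like the squared diameter; at the common limit point
    differentiability makes it of smaller order than the squared diameter. *)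
Lemma goursat F (D : R[i] -> R[i]) x1 x2 y1 y2 : x1 <= x2 -> y1 <= y2 ->
  (forall x y, x1 <= x <= x2 -> y1 <= y <= y2 -> cdiff F (x +i* y) (D (x +i* y))) ->
  rect F x1 x2 y1 y2 = 0.
Proof.
move=> x12 y12 hF; apply: eq0_normc; apply/eqP; rewrite eq_le normc_ge0 andbT.
set c := normc _; rewrite leNgt; apply/negP => c0.
pose u n : R := (x2 - x1) / 2 ^+ n; pose v n : R := (y2 - y1) / 2 ^+ n.
have p2 n : 0 < 2 ^+ n :> R by rewrite exprn_gt0.
have u0 n : 0 <= u n by rewrite divr_ge0 ?subr_ge0 // ltW.
have v0 n : 0 <= v n by rewrite divr_ge0 ?subr_ge0 // ltW.
have uS n : u n = u n.+1 + u n.+1.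
  by rewrite /u exprS; field; rewrite gt_eqF.
have vS n : v n = v n.+1 + v n.+1.
  by rewrite /v exprS; field; rewrite gt_eqF.
(* The state is a generation and a corner; the invariant says that the rectangle
   of that generation still carries its share of the integral. *)
pose Inv (s : nat * (R * R)) := let: (n, (x, y)) := s in
  [/\ c <= 4 ^+ n * normc (rect F x (x + u n) y (y + v n)),
      x1 <= x, x + u n <= x2, y1 <= y & y + v n <= y2].
pose Step (s s' : nat * (R * R)) := let: (n, (x, y)) := s in
  let: (n', (x', y')) := s' in
  [/\ n' = n.+1, x <= x', x' + u n.+1 <= x + u n, y <= y' & y' + v n.+1 <= y + v n].
have [f Hf] : exists f, forall s, Inv s -> Inv (f s) /\ Step s (f s).
  suff H s : exists s', Inv s -> Inv s' /\ Step s s' by have [g hg] := boolp.choice H; exists g.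
  case: s => n [x y]; have [hI|] := pselect (Inv (n, (x, y))); last by exists (0%N, (0, 0)).
  case: (hI) => hc hx hx' hy hy'.
  have u1 := u0 n.+1; have v1 := v0 n.+1; have uSn := uS n; have vSn := vS n.
  have cF : rcont F x (x + u n.+1 + u n.+1) y (y + v n.+1 + v n.+1).
    move=> p q; rewrite -!addrA -uSn -vSn => pI qI.
    by apply: cdiff_cont (D (p +i* q)) _; apply: hF; clear -pI qI hx hx' hy hy'; lra.
  have := rect_quarter u1 v1 cF; rewrite -!addrA -uSn -vSn => -[x' [y' [hx1 hy1 hq]]].
  exists (n.+1, (x', y')) => _.
  have [i1 i2 i3 i4] := nest_facts hx hx' uSn u1 hx1.
  have [j1 j2 j3 j4] := nest_facts hy hy' vSn v1 hy1.
  split; split => //; rewrite exprSr -mulrA; apply: (le_trans hc).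
  by rewrite ler_pM2l // exprn_gt0.
have StepP t t' : Step t t' -> t'.1 = t.1.+1 /\
    [/\ t.2.1 <= t'.2.1, t'.2.1 + u t.1.+1 <= t.2.1 + u t.1,
        t.2.2 <= t'.2.2 & t'.2.2 + v t.1.+1 <= t.2.2 + v t.1].
  by case: t t' => m [a b] [m' [a' b']] [-> h1 h2 h3 h4].
pose s n := iter n f (0%N, (x1, y1)).
have s1 n : (s n).1 = n /\ Inv (s n).
  elim: n => [|n [IH1 IH2]].
    split; first by [].
    change (Inv (0%N, (x1, y1))); rewrite /Inv /u /v !expr0 !divr1 mul1r.
    by rewrite !(addrC _ (_ - _)) !subrK; split.
  have [i1 /StepP[i2 _]] := Hf _ IH2.
  by split; [exact: (etrans i2 (congr1 S IH1))|exact: i1].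
have s3 n : [/\ (s n).2.1 <= (s n.+1).2.1, (s n.+1).2.1 + u n.+1 <= (s n).2.1 + u n,
   (s n).2.2 <= (s n.+1).2.2 & (s n.+1).2.2 + v n.+1 <= (s n).2.2 + v n].
  have [e1 i1] := s1 n.
  by have [_ /StepP[_]] := Hf _ i1; rewrite e1.
have [X hX] := @nested_intervals (fun n => (s n).2.1) (fun n => (s n).2.1 + u n)
  (fun n => let: And4 h _ _ _ := s3 n in h) (fun n => let: And4 _ h _ _ := s3 n in h)
  (fun n => ltac:(by rewrite lerDl)).
have [Y hY] := @nested_intervals (fun n => (s n).2.2) (fun n => (s n).2.2 + v n)
  (fun n => let: And4 _ _ h _ := s3 n in h) (fun n => let: And4 _ _ _ h := s3 n in h)
  (fun n => ltac:(by rewrite lerDl)).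
have XI : x1 <= X <= x2.
  by have [_] := s1 0%N; have := hX 0%N; rewrite /s /= => ? []; lra.
have YI : y1 <= Y <= y2.
  by have [_] := s1 0%N; have := hY 0%N; rewrite /s /= => ? []; lra.
pose S := x2 - x1 + (y2 - y1) + 1.
have S0 : 0 < S by rewrite /S; lra.
have S2 : 0 < S ^+ 2 by rewrite exprn_gt0.
have e0 : 0 < c / (8 * S ^+ 2) by rewrite divr_gt0 // mulr_gt0.
have [a a0 aF] := hF X Y XI YI _ e0.
have [n hn] := exists_pow2 S a0.
have uv : u n + v n < a.
  by rewrite /u /v -mulrDl ltr_pdivrMr //; rewrite /S in hn; lra.
have := hX n; have := hY n; have [] := s1 n; case: (s n) => m [p q] /= -> {m}.
case=> h1 h2 h3 h4 h5 hq hp.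
have un := u0 n; have vn := v0 n.
have : normc (rect F p (p + u n) q (q + v n)) <=
   4 * (c / (8 * S ^+ 2)) * (p + u n - p + (q + v n - q)) ^+ 2.
  apply: (@rect_affine_bound F _ _ _ _ (F (X +i* Y)) (D (X +i* Y)) (X +i* Y)) => //=.
  - lra.
  - lra.
  - exact: ltW.
  - by move=> x y xI yI; apply: cdiff_cont (D (x +i* y)) _; apply: hF; lra.
  - move=> x y xI yI; have := aF (x +i* y - X +i* Y).
    rewrite (addrC _ (_ - _)) subrK; apply.
    apply: (le_lt_trans (normc_le _)) => /=.
    have i1 : `|x - X| <= u n by rewrite ler_norml; apply/andP; split; lra.
    have i2 : `|y - Y| <= v n by rewrite ler_norml; apply/andP; split; lra.
    by lra.
have -> : p + u n - p + (q + v n - q) = u n + v n by ring.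
have le2 : (u n + v n) ^+ 2 <= S ^+ 2 / 4 ^+ n.
  have -> : S ^+ 2 / 4 ^+ n = (S / 2 ^+ n) ^+ 2.
    by rewrite expr_div_n -exprM mulnC exprM; congr (_ / _ ^+ _); ring.
  have Sn : 0 <= S / 2 ^+ n by apply: divr_ge0; apply: ltW.
  rewrite ler_sqr ?nnegrE ?addr_ge0 //.
  rewrite /u /v -mulrDl ler_pM2r ?invr_gt0 //; rewrite /S; lra.
have p4 : 0 < 4 ^+ n :> R by rewrite exprn_gt0.
move=> h6.
have h7 : normc (rect F p (p + u n) q (q + v n)) <= 4 * (c / (8 * S ^+ 2)) * (S ^+ 2 / 4 ^+ n).
  by apply: (le_trans h6); rewrite ler_wpM2l // mulr_ge0 // ltW.
have h8 : 4 ^+ n * normc (rect F p (p + u n) q (q + v n)) <= c / 2.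
  apply: (@le_trans _ _ (4 ^+ n * (4 * (c / (8 * S ^+ 2)) * (S ^+ 2 / 4 ^+ n)))).
    by rewrite ler_pM2l.
  by rewrite le_eqVlt; apply/orP; left; apply/eqP; field; rewrite !gt_eqF.
have half_absurd (k : R) : 0 < k -> k <= k / 2 -> False by lra.
exact: (half_absurd _ c0 (le_trans h1 h8)).
Qed.

End Goursat.

(** * Cauchy's formula on squares *)

Section Cauchy.
Context {R : realType}.
Implicit Types (z w d : R[i]) (F G f g D : R[i] -> R[i]) (x y r : R).

(** The maximum norm of the plane, whose balls are squares with sides parallel to
    the axes. *)
Definition snorm z : R := Num.max `|Re z| `|Im z|.

Lemma snorm_le z r : (snorm z <= r) = (`|Re z| <= r) && (`|Im z| <= r).
Proof. by rewrite /snorm ge_max. Qed.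

Lemma snorm_le_normc z : snorm z <= normc z.
Proof. by rewrite snorm_le normc_Re normc_Im. Qed.

Lemma normc_le_snorm z : normc z <= 2 * snorm z.
Proof.
have h1 : `|Re z| <= snorm z by rewrite /snorm le_max lexx.
have h2 : `|Im z| <= snorm z by rewrite /snorm le_max lexx orbT.
by have := normc_le z; lra.
Qed.

Lemma snorm_xy_le x y r : -r <= x <= r -> -r <= y <= r -> snorm (x +i* y) <= r.
Proof. by move=> hx hy; rewrite snorm_le !ler_norml hx. Qed.

Lemma snorm_re_ge x y r : 0 <= r -> r <= x \/ x <= - r -> r <= snorm (x +i* y).
Proof.
move=> r0 h; rewrite /snorm le_max /=; apply/orP; left.
by case: h => h; [rewrite (le_trans h)// ler_norm|rewrite -normrN (le_trans _ (ler_norm _))//; lra].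
Qed.

Lemma snorm_im_ge x y r : 0 <= r -> r <= y \/ y <= - r -> r <= snorm (x +i* y).
Proof.
move=> r0 h; rewrite /snorm le_max /=; apply/orP; right.
by case: h => h; [rewrite (le_trans h)// ler_norm|rewrite -normrN (le_trans _ (ler_norm _))//; lra].
Qed.

(** The contour integral over the square of half-side [r] centred at 0. Other
    centres are reached by translating the integrand, so that all centres share
    one parametrised contour. *)
Definition sq F r : R[i] := rect F (- r) r (- r) r.

(** The frame between two concentric squares splits into four rectangles that
    avoid the centre, and Goursat's theorem applies to each of them. *)
Lemma sq_annulus F D r r' : 0 < r -> r <= r' ->
  (forall z, r <= snorm z <= r' -> cdiff F z (D z)) -> sq F r' = sq F r.
Proof.
move=> r0 rr' hF.
have hF' x y : -r' <= x <= r' -> -r' <= y <= r' ->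
    (r <= x \/ x <= - r) \/ (r <= y \/ y <= - r) -> cdiff F (x +i* y) (D (x +i* y)).
  move=> xI yI h; apply: hF; apply/andP; split; last exact: snorm_xy_le.
  by case: h => h; [apply: snorm_re_ge|apply: snorm_im_ge] => //; exact: ltW.
have cF x y : -r' <= x <= r' -> -r' <= y <= r' ->
    (r <= x \/ x <= - r) \/ (r <= y \/ y <= - r) -> ccont F (x +i* y).
  by move=> xI yI h; exact: cdiff_cont (hF' x y xI yI h).
rewrite /sq (@rect_splitx _ F (- r') (- r)); [|lra|lra|]; last first.
  move=> x y xI yI h; apply: cF => //.
  case: h => [h|h|h|h]; [left|left|right|right]; lra.
rewrite (@rect_splitx _ F (- r) r r'); [|lra|lra|]; last first.
  move=> x y xI yI h; apply: cF => //; first by lra.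
  case: h => [h|h|h|h]; [left|left|right|right]; lra.
rewrite (@rect_splity _ F (- r) r (- r') (- r)); [|lra|lra|]; last first.
  move=> x y xI yI h; apply: cF => //; first by lra.
  case: h => [h|h|h|h]; [right|right|left|left]; lra.
rewrite (@rect_splity _ F (- r) r (- r) r r'); [|lra|lra|]; last first.
  move=> x y xI yI h; apply: cF => //; [lra|lra|].
  case: h => [h|h|h|h]; [right|right|left|left]; lra.
rewrite (@goursat _ F D (- r') (- r)); [|lra|lra|]; last first.
  by move=> x y xI yI; apply: hF'; [lra|lra|left; lra].
rewrite (@goursat _ F D r r'); [|lra|lra|]; last first.
  by move=> x y xI yI; apply: hF'; [lra|lra|left; lra].
rewrite (@goursat _ F D (- r) r (- r')); [|lra|lra|]; last first.
  by move=> x y xI yI; apply: hF'; [lra|lra|right; lra].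
rewrite (@goursat _ F D (- r) r r r'); [|lra|lra|]; last first.
  by move=> x y xI yI; apply: hF'; [lra|lra|right; lra].
by rewrite add0r addr0 add0r addr0.
Qed.

Definition bcont F r := forall z, snorm z = r -> ccont F z.

Section boundary.
Variables (F : R[i] -> R[i]) (r : R).
Hypotheses (r0 : 0 <= r) (cF : bcont F r).

Lemma snorm_sides t : - r <= t <= r ->
  [/\ snorm (t +i* - r) = r, snorm (t +i* r) = r,
      snorm (r +i* t) = r & snorm (- r +i* t) = r].
Proof using r0.
move=> tI; split; apply/eqP; rewrite eq_le snorm_xy_le ?lexx /=; try lra.
- by apply: snorm_im_ge => //; right.
- by apply: snorm_im_ge => //; left.
- by apply: snorm_re_ge => //; left.
- by apply: snorm_re_ge => //; right.
Qed.

Lemma segcont_sides : [/\ segcont (fun x => F (x +i* - r)) (- r) r,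
  segcont (fun x => F (x +i* r)) (- r) r,
  segcont (fun y => F (r +i* y)) (- r) r &
  segcont (fun y => F (- r +i* y)) (- r) r].
Proof using r0 cF.
by split; (apply: segcont_horizontal || apply: segcont_vertical) => t tI;
  apply: cF; have [] := snorm_sides tI.
Qed.

Lemma sq_norm_int : normc (sq F r) <=
  2 * (rint (fun x => normc (F (x +i* - r))) (- r) r
     + rint (fun x => normc (F (x +i* r))) (- r) r
     + rint (fun y => normc (F (r +i* y))) (- r) r
     + rint (fun y => normc (F (- r +i* y))) (- r) r).
Proof using r0 cF.
have [s1 s2 s3 s4] := segcont_sides.
rewrite /sq /rect !cintB //; apply: (le_trans (normcD _ _)).
rewrite normcM normc_i mul1r.
have := normcB (cint (fun x => F (x +i* - r)) (- r) r) (cint (fun x => F (x +i* r)) (- r) r).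
have := normcB (cint (fun y => F (r +i* y)) (- r) r) (cint (fun y => F (- r +i* y)) (- r) r).
by have := cint_norm s1; have := cint_norm s2; have := cint_norm s3; have := cint_norm s4; lra.
Qed.

Lemma sq_bound (M : R) : (forall z, snorm z = r -> normc (F z) <= M) ->
  normc (sq F r) <= 16 * (M * r).
Proof using r0 cF.
move=> hM; have [s1 s2 s3 s4] := segcont_sides.
rewrite /sq /rect !cintB //; apply: (le_trans (normcD _ _)).
rewrite normcM normc_i mul1r.
have rr : - r <= r by move: r0; lra.
have b1 := @cint_bound _ _ _ _ M rr s1 (fun t tI => let: And4 h _ _ _ := snorm_sides tI in hM _ h).
have b2 := @cint_bound _ _ _ _ M rr s2 (fun t tI => let: And4 _ h _ _ := snorm_sides tI in hM _ h).
have b3 := @cint_bound _ _ _ _ M rr s3 (fun t tI => let: And4 _ _ h _ := snorm_sides tI in hM _ h).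
have b4 := @cint_bound _ _ _ _ M rr s4 (fun t tI => let: And4 _ _ _ h := snorm_sides tI in hM _ h).
have := normcB (cint (fun x => F (x +i* - r)) (- r) r) (cint (fun x => F (x +i* r)) (- r) r).
have := normcB (cint (fun y => F (r +i* y)) (- r) r) (cint (fun y => F (- r +i* y)) (- r) r).
by lra.
Qed.

End boundary.

Lemma eq_sq F G r : 0 <= r -> (forall z, snorm z = r -> F z = G z) -> sq F r = sq G r.
Proof.
move=> r0 h; rewrite /sq /rect; congr (_ + 'i * _); apply: eq_cint => t tI;
  by have [h1 h2 h3 h4] := snorm_sides r0 tI; rewrite !h.
Qed.

Lemma sqD F G r : 0 <= r -> bcont F r -> bcont G r ->
  sq (fun z => F z + G z) r = sq F r + sq G r.
Proof.
move=> r0 cF cG; have [s1 s2 s3 s4] := segcont_sides r0 cF.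
have [t1 t2 t3 t4] := segcont_sides r0 cG.
rewrite /sq /rect.
rewrite (cintB (segcontD s1 t1) (segcontD s2 t2)) (cintB (segcontD s3 t3) (segcontD s4 t4)).
rewrite (cintB s1 s2) (cintB s3 s4) (cintB t1 t2) (cintB t3 t4).
by rewrite (cintD s1 t1) (cintD s2 t2) (cintD s3 t3) (cintD s4 t4); ring.
Qed.

Lemma sqZ k F r : 0 <= r -> bcont F r -> sq (fun z => k * F z) r = k * sq F r.
Proof.
move=> r0 cF; have [s1 s2 s3 s4] := segcont_sides r0 cF.
rewrite /sq /rect (cintB (segcontZ k s1) (segcontZ k s2)) (cintB (segcontZ k s3) (segcontZ k s4)).
rewrite (cintB s1 s2) (cintB s3 s4).
by rewrite (cintZ k s1) (cintZ k s2) (cintZ k s3) (cintZ k s4); ring.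
Qed.

Lemma snorm0 : snorm (0 : R[i]) = 0.
Proof. by rewrite /snorm /= normr0 maxxx. Qed.

Lemma snorm_neq0 z : 0 < snorm z -> z != 0.
Proof. by apply: contraTneq => ->; rewrite snorm0 ltxx. Qed.

Lemma cdiff_inv z : z != 0 -> cdiff (fun z => z^-1) z (- 1 / z ^+ 2).
Proof. by move=> z0; apply: cdiffV => //; exact: cdiff_id. Qed.

Lemma bcont_inv r : 0 < r -> bcont (fun z => z^-1) r.
Proof.
move=> r0 z zr; apply: cdiff_cont (- 1 / z ^+ 2) _; apply: cdiff_inv.
by apply: snorm_neq0; rewrite zr.
Qed.

(** The value is [2 i pi] for every [r > 0]; the estimates below only use that its
    modulus is bounded away from 0, which spares computing an arctangent. *)
Definition kappa r := sq (fun z => z^-1) r.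

(** Both integrands reduce to [2 i r / (t ^ 2 + r ^ 2)] up to the factor in front,
    and [t ^ 2 + r ^ 2 <= 2 r ^ 2] on the sides. *)
Lemma kappa_ge r : 0 < r -> 4 <= normc (kappa r).
Proof.
move=> r0.
have rr : - r <= r by lra.
have [s1 s2 s3 s4] := segcont_sides (ltW r0) (bcont_inv r0).
apply: le_trans (normc_Im _); apply: le_trans (ler_norm _).
rewrite /kappa /sq /rect.
set A := cint _ _ _; set B := cint _ _ _.
have -> : Im (A + 'i * B) = Im A + Re B.
  by case: A => ? ?; case: B => ? ? /=; rewrite mul0r mul1r add0r.
have cstc : rintegrable (fun=> r^-1) (- r) r.
  by apply: epsdelta_rintegrable => t _ e e0; exists 1 => // s _ _; rewrite subrr normr0 ltW.
have val t : - r <= t <= r -> r^-1 <= 2 * r / (t ^+ 2 + r ^+ 2).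
  move=> tI; rewrite ler_pdivlMr; last by nra.
  by rewrite ler_pdivrMl //; nra.
have hA : 2 <= Im A.
  have -> : 2 = rint (fun=> r^-1) (- r) r by rewrite rint_cst //; field; rewrite gt_eqF.
  apply: le_rint => //; first exact: (segcont_Im (segcontB s1 s2)).
  move=> t tI; apply: (le_trans (val t tI)).
  rewrite /= !sqrrN le_eqVlt; apply/orP; left; apply/eqP; field.
  by rewrite gt_eqF //; nra.
have hB : 2 <= Re B.
  have -> : 2 = rint (fun=> r^-1) (- r) r by rewrite rint_cst //; field; rewrite gt_eqF.
  apply: le_rint => //; first exact: (segcont_Re (segcontB s3 s4)).
  move=> t tI; apply: (le_trans (val t tI)).
  rewrite /= !sqrrN le_eqVlt; apply/orP; left; apply/eqP; field.
  by rewrite ?gt_eqF //; nra.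
by lra.
Qed.

Lemma kappa_neq0 r : 0 < r -> kappa r != 0.
Proof. by move=> /kappa_ge h; rewrite -normc_gt0; lra. Qed.

Lemma snorm_invr z r : 0 < r -> snorm z = r -> normc z^-1 <= r^-1.
Proof.
move=> r0 zr; rewrite normcV lef_pV2 ?posrE //.
  by rewrite -zr snorm_le_normc.
by apply: lt_le_trans (snorm_le_normc z); rewrite zr.
Qed.

Lemma bcontP F D r : (forall z, snorm z = r -> cdiff F z (D z)) -> bcont F r.
Proof. by move=> h z /h; exact: cdiff_cont. Qed.

(** After subtraction of [g 0] the integrand has size [e / s] on the square of
    half-side [s], hence a contour integral of order [e]; it does not depend on [s]
    by [sq_annulus], so it is 0. *)
Lemma cauchy_square g D r : 0 < r -> ccont g 0 ->
  (forall z, z != 0 -> snorm z <= r -> cdiff g z (D z)) ->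
  sq (fun z => g z / z) r = kappa r * g 0.
Proof.
move=> r0 cg dg.
pose D' z := (D z - 0) * z^-1 + (g z - g 0) * (- 1 / z ^+ 2).
have dF z : z != 0 -> snorm z <= r -> cdiff (fun z => (g z - g 0) / z) z (D' z).
  move=> z0 zr; apply: cdiffM; last exact: cdiff_inv.
  by apply: cdiffB; [exact: dg|exact: cdiff_cst].
have bF s : 0 < s -> s <= r -> bcont (fun z => (g z - g 0) / z) s.
  move=> s0 sr; apply: (@bcontP _ D') => z zs; apply: dF; last by rewrite zs.
  by apply: snorm_neq0; rewrite zs.
have eqF : sq (fun z => (g z - g 0) / z) r = 0.
  apply: eq0_normc; apply/eqP; rewrite eq_le normc_ge0 andbT.
  apply/ler_addgt0Pr => e e0; rewrite add0r.
  have e1 : 0 < e / 16 by lra.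
  have [a a0 ga] := cg _ e1.
  pose s := Num.min r (a / 4).
  have s0 : 0 < s by rewrite lt_min r0 /=; lra.
  have sr : s <= r by rewrite ge_min lexx.
  have sa : s <= a / 4 by rewrite ge_min lexx orbT.
  rewrite (@sq_annulus _ D' s r) //; last first.
    move=> z /andP[sz zr]; apply: dF => //; apply: snorm_neq0; exact: lt_le_trans sz.
  apply: (le_trans (@sq_bound _ s (ltW s0) (bF _ s0 sr) (e / 16 / s) _)); last first.
    by rewrite divfK ?gt_eqF //; lra.
  move=> z zs; rewrite normcM; apply: ler_pM; rewrite ?normc_ge0 ?(snorm_invr s0) //.
  have := ga z; rewrite add0r; apply; have := normc_le_snorm z; rewrite zs; lra.
have bi := bcont_inv r0.
have := @sqD (fun z => (g z - g 0) / z) (fun z => g 0 * z^-1) r (ltW r0) (bF _ r0 (lexx _)).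
rewrite eqF sqZ ?ltW // add0r mulrC => <-.
  by congr (sq _ r); apply/funext => z; rewrite -mulrDl subrK.
apply: (@bcontP _ (fun z => 0 * z^-1 + g 0 * (- 1 / z ^+ 2))) => z zr.
apply: cdiffM; first exact: cdiff_cst.
by apply: cdiff_inv; apply: snorm_neq0; rewrite zr.
Qed.

End Cauchy.

(** * The derivative of a holomorphic function is holomorphic *)

Section DerivativeHolomorphic.
Context {R : realType}.
Implicit Types (z w a b c d h : R[i]) (F G f D : R[i] -> R[i]) (r rho : R).

Lemma ccontM F G z : ccont F z -> ccont G z -> ccont (fun x => F x * G x) z.
Proof.
move=> cF cG e e0; have F0 := normc_ge0 (F z); have G0 := normc_ge0 (G z).
pose e' := e / (2 + normc (F z) + normc (G z)).
have e'0 : 0 < e' by rewrite divr_gt0 //; lra.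
have m0 : 0 < Num.min e' 1 by rewrite lt_min e'0 ltr01.
have [a a0 aF] := cF _ e'0; have [b b0 bG] := cG _ m0.
exists (Num.min a b); first by rewrite lt_min a0.
move=> h; rewrite lt_min => /andP[/aF h1 /bG]; rewrite le_min => /andP[h2 h3].
rewrite (_ : _ - _ = (F (z + h) - F z) * G (z + h) + F z * (G (z + h) - G z)); last by ring.
apply: (le_trans (normcD _ _)); rewrite !normcM.
have h4 : normc (G (z + h)) <= normc (G z) + 1.
  by have := normcD (G (z + h) - G z) (G z); rewrite subrK; lra.
have h5 : e = e' * (normc (G z) + 1) + e' * (normc (F z) + 1).
  by rewrite /e'; field; rewrite gt_eqF //; lra.
have h6 : normc (F (z + h) - F z) * normc (G (z + h)) <= e' * (normc (G z) + 1).
  by rewrite ler_pM ?normc_ge0.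
have h7 : normc (F z) * normc (G (z + h) - G z) <= normc (F z) * e' by rewrite ler_wpM2l.
by move: (e') h5 h6 h7 e'0; clear -F0; move=> k ? ? ? ?; lra.
Qed.

Lemma cdiff_shift f a z d : cdiff f (a + z) d -> cdiff (fun x => f (a + x)) z d.
Proof.
by move=> df e e0; have [b b0 bf] := df e e0; exists b => // h /bf; rewrite addrA.
Qed.

Lemma ccont_shift f a z : ccont f (a + z) -> ccont (fun x => f (a + x)) z.
Proof.
by move=> df e e0; have [b b0 bf] := df e e0; exists b => // h /bf; rewrite addrA.
Qed.

Lemma normc_segment a z w rho (t : R) : normc (z - a) < rho -> normc (w - a) < rho ->
  0 <= t <= 1 -> normc (z + t%:C * (w - z) - a) < rho.
Proof.
move=> hz hw /andP[t0 t1].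
have -> : z + t%:C * (w - z) - a = (1 - t)%:C * (z - a) + t%:C * (w - a).
  by rewrite rmorphB /=; ring.
apply: (le_lt_trans (normcD _ _)); rewrite !normc_mulr_real !ger0_norm ?subr_ge0 //.
have z0 := normc_ge0 (z - a); have w0 := normc_ge0 (w - a).
have [->|t0'] := eqVneq t 0; first by lra.
have {}t0 : 0 < t by rewrite lt0r t0'.
have : (1 - t) * normc (z - a) <= (1 - t) * rho by rewrite ler_wpM2l; lra.
have : t * normc (w - a) < t * rho by rewrite ltr_pM2l.
by lra.
Qed.

Section local.
Variables (f D : R[i] -> R[i]).

Definition cdiff_ball a rho := forall z, normc (z - a) < rho -> cdiff f z (D z).

(** Cauchy's formula for the difference quotient of [f], which is continuous at the
    centre once it is given the value [D a] there. *)
Lemma deriv_cauchy a r : 0 < r ->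
  (forall z, snorm z <= r -> cdiff f (a + z) (D (a + z))) ->
  sq (fun z => (f (a + z) - f a) / z / z) r = kappa r * D a.
Proof.
move=> r0 df.
pose g z := if z == 0 then D a else (f (a + z) - f a) / z.
have g0 : g 0 = D a by rewrite /g eqxx.
have df0 : cdiff f a (D a).
  by have := df 0; rewrite snorm0 addr0; apply; exact: ltW.
have cg : ccont g 0.
  move=> e e0; have [b b0 bf] := df0 _ e0; exists b => // h /bf hb.
  rewrite add0r g0 /g; case: eqVneq => [_|h0]; first by rewrite subrr normc0 ltW.
  have -> : (f (a + h) - f a) / h - D a = (f (a + h) - f a - D a * h) / h.
    by field.
  by rewrite normcM normcV ler_pdivrMr ?normc_gt0.
pose D' z := (D (a + z) - 0) * z^-1 + (f (a + z) - f a) * (- 1 / z ^+ 2).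
have dg z : z != 0 -> snorm z <= r -> cdiff g z (D' z).
  move=> z0 zr; apply: (@cdiff_local _ (fun z => (f (a + z) - f a) / z) g z _ (normc z)).
  - by rewrite normc_gt0.
  - move=> h hz; rewrite /g; case: eqVneq => // zh0.
    have hE : h = - z by apply/eqP; rewrite -addr_eq0 addrC zh0.
    by move: hz; rewrite hE normc_opp ltxx.
  - apply: cdiffM; last exact: cdiff_inv.
    by apply: cdiffB; [apply: cdiff_shift; exact: df|exact: cdiff_cst].
rewrite -g0 -(cauchy_square r0 cg dg); apply: eq_sq; first exact: ltW.
move=> z zr; rewrite /g; case: eqVneq => // z0.
by move: zr r0; rewrite z0 snorm0 => ->; rewrite ltxx.
Qed.

Lemma bcont_quot a r : 0 < r ->
  (forall z, snorm z <= r -> cdiff f (a + z) (D (a + z))) ->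
  bcont (fun z => (f (a + z) - f a) / z / z) r.
Proof.
move=> r0 df z zr; have z0 : z != 0 by apply: snorm_neq0; rewrite zr.
have ci : ccont (fun z => z^-1) z by apply: cdiff_cont (cdiff_inv z0).
apply: ccontM => //; apply: ccontM => //.
apply: (cdiff_cont (d := D (a + z) - 0)); apply: cdiffB; last exact: cdiff_cst.
by apply: cdiff_shift; apply: df; rewrite zr.
Qed.

Lemma normc_quot z r w (M : R) : 0 < r -> snorm z = r -> normc w <= M ->
  normc (w / z / z) <= M / r / r.
Proof.
move=> r0 zr wM; have zi := snorm_invr r0 zr; rewrite !normcM.
by rewrite !ler_pM ?mulr_ge0 ?normc_ge0.
Qed.

Lemma deriv_bound a r (M : R) : 0 < r ->
  (forall z, snorm z <= r -> cdiff f (a + z) (D (a + z))) ->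
  (forall z, snorm z = r -> normc (f (a + z) - f a) <= M) ->
  normc (D a) <= 4 * M / r.
Proof.
move=> r0 df fM; have := kappa_ge r0.
have := sq_bound (ltW r0) (bcont_quot r0 df) (fun z zr => normc_quot r0 zr (fM z zr)).
rewrite (deriv_cauchy r0 df) normcM divfK ?gt_eqF // => h1 h2.
have : 4 * normc (D a) <= normc (kappa r) * normc (D a) by rewrite ler_wpM2r ?normc_ge0.
by rewrite -mulrA; lra.
Qed.

Lemma ballD a b z r rho : normc (b - a) < rho -> snorm z <= r ->
  normc (b + z - a) < rho + 2 * r.
Proof.
move=> hb hz; rewrite addrAC; apply: (le_lt_trans (normcD _ _)).
by have := normc_le_snorm z; lra.
Qed.

(** Continuity of [f] at [a] bounds the increments of [f] on squares of a fixed
    size around all centres near [a], and [deriv_bound] applies to each. *)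
Lemma deriv_locally_bounded a rho : 0 < rho -> cdiff_ball a rho ->
  exists2 r, 0 < r <= rho & exists M : R, forall b, normc (b - a) < r -> normc (D b) <= M.
Proof.
move=> rho0 df.
have df0 : cdiff f a (D a) by apply: df; rewrite subrr normc0.
have [c c0 cf] := cdiff_cont df0 ltr01.
pose r := Num.min c rho / 4.
have r0 : 0 < r by rewrite divr_gt0 // lt_min c0.
have rc : 4 * r <= c by rewrite /r mulrCA divff // mulr1 ge_min lexx.
have rr : 4 * r <= rho by rewrite /r mulrCA divff // mulr1 ge_min lexx orbT.
exists r; first by apply/andP; split => //; lra.
exists (4 * 2 / r) => b br; apply: deriv_bound => //.
  by move=> z zr; apply: df; have := ballD br zr; lra.
move=> z zr; have fa w : normc (w - a) < c -> normc (f w - f a) <= 1.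
  by move=> /cf; rewrite (addrC a) subrK.
have h1 : normc (f (b + z) - f a) <= 1.
  by apply: fa; have := @ballD a b z r r br; rewrite zr => /(_ (lexx _)); lra.
have h2 : normc (f b - f a) <= 1 by apply: fa; lra.
rewrite (_ : f (b + z) - f b = (f (b + z) - f a) - (f b - f a)); last by ring.
by apply: (le_trans (normcB _ _)); lra.
Qed.

(** For two centres [b] and [c] the increments of [f] over the same contour differ
    by a multiple of [|b - c|], by the mean value inequality and the local bound of
    [D]; Cauchy's formula turns this into a bound of [D b - D c]. *)
Lemma deriv_locally_lipschitz a rho : 0 < rho -> cdiff_ball a rho ->
  exists2 r, 0 < r <= rho & exists2 L : R, 0 <= L & forall b c,
    normc (b - a) < r -> normc (c - a) < r -> normc (D b - D c) <= L * normc (b - c).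
Proof.
move=> rho0 df; have [s /andP[s0 srho] [M hM]] := deriv_locally_bounded rho0 df.
have M0 : 0 <= M.
  by apply: le_trans (hM a _); [exact: normc_ge0|rewrite subrr normc0].
pose r := s / 4.
have r0 : 0 < r by rewrite divr_gt0.
have rs : 4 * r = s by rewrite /r mulrCA divff // mulr1.
exists r; first by apply/andP; split => //; lra.
exists (16 * M / r); first by rewrite divr_ge0 ?mulr_ge0 // ltW.
move=> b c hb hc.
have dfb x z : normc (x - a) < r -> snorm z <= r -> cdiff f (x + z) (D (x + z)).
  by move=> hx zr; apply: df; have := ballD hx zr; lra.
have mvi x y : normc (x - a) < s -> normc (y - a) < s ->
    normc (f x - f y) <= 2 * (M * normc (x - y)).
  move=> hx hy; apply: (@mean_value_ineq _ f D) => t tI.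
    by apply: df; apply: lt_le_trans srho; exact: normc_segment.
  by apply: hM; exact: normc_segment.
have := kappa_ge r0 => k4.
pose N z := ((f (b + z) - f b) - (f (c + z) - f c)) / z / z.
have NE : sq N r = kappa r * (D b - D c).
  rewrite mulrBr -!deriv_cauchy //; [|by move=> z; exact: dfb|by move=> z; exact: dfb].
  have cb := bcont_quot r0 (fun z => dfb b z hb).
  have cc := bcont_quot r0 (fun z => dfb c z hc).
  rewrite -[X in _ - X]mul1r -mulNr -sqZ ?ltW // -sqD ?ltW //.
    by congr (sq _ r); apply/funext => z; rewrite /N mulN1r !mulrBl.
  by move=> z zr; apply: ccontM; [exact: cdiff_cont (cdiff_cst _ _)|exact: cc].
have cN : bcont N r.
  move=> z zr; have z0 : z != 0 by apply: snorm_neq0; rewrite zr.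
  have ci : ccont (fun z => z^-1) z by apply: cdiff_cont (cdiff_inv z0).
  apply: ccontM => //; apply: ccontM => //.
  apply: (cdiff_cont (d := (D (b + z) - 0) - (D (c + z) - 0))).
  by apply: cdiffB; apply: cdiffB; rewrite ?cdiff_cst //; try exact: cdiff_cst;
    apply: cdiff_shift; apply: dfb => //; rewrite zr.
have bN z : snorm z = r -> normc (N z) <= 4 * (M * normc (b - c)) / r / r.
  move=> zr; apply: normc_quot => //.
  rewrite (_ : _ - _ = (f (b + z) - f (c + z)) - (f b - f c)); last by ring.
  apply: (le_trans (normcB _ _)).
  have zr' : snorm z <= r by rewrite zr.
  have h1 := mvi (b + z) (c + z); have h2 := mvi b c.
  have i1 := ballD hb zr'; have i2 := ballD hc zr'.
  rewrite (_ : b + z - (c + z) = b - c) in h1; last by ring.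
  by have := h1 ltac:(lra) ltac:(lra); have := h2 ltac:(lra) ltac:(lra); lra.
have := sq_bound (ltW r0) cN bN; rewrite NE normcM divfK ?gt_eqF // => h1.
have : 4 * normc (D b - D c) <= normc (kappa r) * normc (D b - D c).
  by rewrite ler_wpM2r ?normc_ge0.
rewrite (_ : 16 * M / r * normc (b - c) = 4 * (4 * (M * normc (b - c)) / r)); last by field; rewrite gt_eqF.
by lra.
Qed.

(** Cauchy's formula can be differentiated under the integral sign: since [D] is
    locally Lipschitz, the Taylor remainder of [f] is of order [|h| ^ 2] uniformly
    on the contour. *)
Lemma deriv_cdiff a rho : 0 < rho -> cdiff_ball a rho -> exists d, cdiff D a d.
Proof.
move=> rho0 df; have [s /andP[s0 srho] [L L0 hL]] := deriv_locally_lipschitz rho0 df.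
pose r := s / 8.
have r0 : 0 < r by rewrite divr_gt0.
have rs : 8 * r = s by rewrite /r mulrCA divff // mulr1.
have taylor x y : normc (x - a) < s -> normc (y - a) < s ->
    normc (f y - f x - D x * (y - x)) <= 2 * (L * normc (y - x) * normc (y - x)).
  move=> hx hy.
  have -> : f y - f x - D x * (y - x) = (f y - D x * y) - (f x - D x * x) by ring.
  apply: (@mean_value_ineq _ (fun z => f z - D x * z) (fun z => D z - (0 * z + D x * 1))) => t tI.
    apply: cdiffB; last by apply: cdiffM; [exact: cdiff_cst|exact: cdiff_id].
    by apply: df; apply: lt_le_trans srho; exact: normc_segment.
  rewrite mul0r add0r mulr1; apply: (le_trans (hL _ _ _ hx)); first exact: normc_segment.
  rewrite ler_wpM2l // addrAC subrr add0r normc_mulr_real.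
  case/andP: tI => t0 t1; rewrite ger0_norm // ler_piMl ?normc_ge0 //.
have ha z : snorm z <= r -> cdiff f (a + z) (D (a + z)).
  move=> zr; apply: df; have := normc_le_snorm z.
  by rewrite addrAC subrr add0r; lra.
pose S := sq (fun z => (D (a + z) - D a) / z / z) r.
have k0 := kappa_neq0 r0; have k4 := kappa_ge r0.
exists (S / kappa r) => e e0.
have e1 : 0 < e * r / (16 * L + 1) by rewrite divr_gt0 ?mulr_gt0 //; lra.
exists (Num.min r (e * r / (16 * L + 1))); first by rewrite lt_min r0.
move=> h; rewrite lt_min => /andP[hr he].
have hh : normc (a + h - a) < r by rewrite addrAC subrr add0r.
have dh z : snorm z <= r -> cdiff f (a + h + z) (D (a + h + z)).
  by move=> zr; apply: df; have := ballD hh zr; lra.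
(* The integrand of the formula for [D (a + h) - D a - (S / kappa r) * h]. *)
pose N z := ((f (a + h + z) - f (a + h)) - (f (a + z) - f a) - h * (D (a + z) - D a)) / z / z.
have cD : bcont (fun z => (D (a + z) - D a) / z / z) r.
  move=> z zr; have z0 : z != 0 by apply: snorm_neq0; rewrite zr.
  have ci : ccont (fun z => z^-1) z by apply: cdiff_cont (cdiff_inv z0).
  apply: ccontM => //; apply: ccontM => //.
  move=> e' e'0; have e2 : 0 < e' / (L + 1) by rewrite divr_gt0 //; lra.
  exists (Num.min r (e' / (L + 1))); first by rewrite lt_min r0.
  move=> w; rewrite lt_min => /andP[wr we].
  have zn := normc_le_snorm z; rewrite zr in zn.
  have wn := normc_ge0 w.
  rewrite (_ : _ - _ = D (a + (z + w)) - D (a + z)); last by ring.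
  apply: (le_trans (hL _ _ _ _)).
  - by rewrite addrAC subrr add0r; apply: (le_lt_trans (normcD _ _)); lra.
  - by rewrite addrAC subrr add0r; lra.
  rewrite (_ : a + (z + w) - (a + z) = w); last by ring.
  move: we; rewrite ltr_pdivlMr; last by lra.
  by rewrite mulrDr mulr1 (mulrC L) => ?; lra.
have ch := bcont_quot r0 dh; have ca := bcont_quot r0 ha.
have cs k F : bcont F r -> bcont (fun z => k * F z) r.
  by move=> cF z zr; apply: ccontM; [exact: cdiff_cont (cdiff_cst _ _)|exact: cF].
have caddr F G : bcont F r -> bcont G r -> bcont (fun z => F z + G z) r.
  move=> cF cG z zr e' e'0; have e2 : 0 < e' / 2 by lra.
  have [b b0 bF] := cF z zr _ e2; have [b' b'0 bG] := cG z zr _ e2.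
  exists (Num.min b b'); first by rewrite lt_min b0.
  move=> w; rewrite lt_min => /andP[/bF h1 /bG h2].
  rewrite (_ : _ - _ = (F (z + w) - F z) + (G (z + w) - G z)); last by ring.
  by apply: (le_trans (normcD _ _)); lra.
have Nfun : N = fun z => ((f (a + h + z) - f (a + h)) / z / z
    + (- 1) * ((f (a + z) - f a) / z / z)) + (- h) * ((D (a + z) - D a) / z / z).
  by apply/funext => z; rewrite /N; ring.
have cN : bcont N r by rewrite Nfun; apply: (caddr _ _ (caddr _ _ ch _) _); exact: cs.
have NE : sq N r = kappa r * (D (a + h) - D a - S / kappa r * h).
  rewrite Nfun !sqD ?ltW //; [|exact: cs|by apply: (caddr _ _ ch); exact: cs|exact: cs].
  rewrite !sqZ ?ltW // (deriv_cauchy r0 dh) (deriv_cauchy r0 ha) -/S.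
  by field.
have bN z : snorm z = r -> normc (N z) <= 4 * (L * normc h * normc h) / r / r.
  move=> zr; apply: normc_quot => //.
  rewrite (_ : _ - _ = (f (a + z + h) - f (a + z) - D (a + z) * (a + z + h - (a + z)))
     - (f (a + h) - f a - D a * (a + h - a))); last first.
    by rewrite (addrAC a z h); ring.
  have zn := normc_le_snorm z; rewrite zr in zn.
  apply: (le_trans (normcB _ _)).
  have az : normc (a + z - a) < s by rewrite addrAC subrr add0r; lra.
  have azh : normc (a + z + h - a) < s.
    rewrite (_ : a + z + h - a = z + h); last by ring.
    by apply: (le_lt_trans (normcD _ _)); lra.
  have aa : normc (a - a) < s by rewrite subrr normc0.
  have ah : normc (a + h - a) < s by lra.
  have h1 := taylor _ _ az azh; have h2 := taylor _ _ aa ah.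
  rewrite (_ : a + z + h - (a + z) = h) in h1 *; last by ring.
  rewrite (_ : a + h - a = h) in h2 *; last by ring.
  by lra.
have := sq_bound (ltW r0) cN bN; rewrite NE normcM divfK ?gt_eqF //.
set T := D (a + h) - _ - _ => h1.
have h2 : 4 * normc T <= normc (kappa r) * normc T by rewrite ler_wpM2r ?normc_ge0.
have h3 : normc T <= 16 * L * normc h / r * normc h.
  rewrite (_ : 16 * L * normc h / r * normc h = 4 * (4 * (L * normc h * normc h) / r)); last by field; rewrite gt_eqF.
  by lra.
apply: (le_trans h3); rewrite ler_wpM2r ?normc_ge0 //.
rewrite ler_pdivrMr //; move: he; rewrite ltr_pdivlMr; last by lra.
by have := normc_ge0 h; lra.
Qed.

End local.
End DerivativeHolomorphic.

(** * Translations, reflections and open sets in the plane *)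

Section Plane.
Context {R : realType}.
Local Notation mu := (@lebesgue_measure R).
Local Notation mu2 := (mu \x mu)%E.

Lemma lebesgue_measure_shift (c : R) (A : set R) : measurable A ->
  pushforward mu ((fun x => x + c) : _ -> measurableTypeR R) A = mu A.
Proof.
have mshift : measurable_fun [set: R] ((fun x => x + c) : R -> R).
  by apply: measurable_funD => //; exact: measurable_cst.
move=> mA; apply/esym/lebesgue_measure_unique => //= _ [[a b]] _ <-.
rewrite /pushforward.
have -> : (fun x : R => x + c) @^-1` `]a, b] = `]a - c, b - c]%classic.
  by apply/seteqP; split => x; rewrite /= !in_itv /= => /andP[? ?]; lra.
rewrite !lebesgue_measure_itv /= !lte_fin ltrD2r.
by case: ifP => // _; rewrite -!EFinB; congr EFin; ring.
Qed.

Lemma ge0_integral_shift (c : R) (F : R -> \bar R) : measurable_fun [set: R] F ->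
  (forall x, 0 <= F x)%E -> (\int[mu]_x F (x + c)%R = \int[mu]_x F x)%E.
Proof.
move=> mF F0.
have mshift : measurable_fun [set: R] ((fun x => x + c) : R -> R).
  by apply: measurable_funD => //; exact: measurable_cst.
transitivity (\int[pushforward mu ((fun x => (x + c)%R) : R -> measurableTypeR R)]_x F x)%E.
  by rewrite ge0_integral_pushforward.
by apply: eq_measure_integral => A mA _; exact: lebesgue_measure_shift.
Qed.

Lemma ge0_integral_opp (F : R -> \bar R) : measurable_fun [set: R] F ->
  (forall x, 0 <= F x)%E -> (\int[mu]_x F (- x)%R = \int[mu]_x F x)%E.
Proof.
move=> mF F0.
transitivity (\int[pushforward mu (-%R : R -> measurableTypeR R)]_x F x)%E.
  by rewrite ge0_integral_pushforward.
by apply: eq_measure_integral => A mA _; exact: lebesgue_measureN.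
Qed.

Lemma ge0_integral_reflect (c : R) (F : R -> \bar R) : measurable_fun [set: R] F ->
  (forall x, 0 <= F x)%E -> (\int[mu]_x F (c - x)%R = \int[mu]_x F x)%E.
Proof.
move=> mF F0.
rewrite -(ge0_integral_shift c mF F0) -(@ge0_integral_opp (fun x => F (x + c)%R)) //.
  by apply: eq_integral => x _; rewrite addrC.
apply: (measurableT_comp mF).
by apply: measurable_funD => //; exact: measurable_cst.
Qed.

(** Openness for the maximum norm in coordinates: such a set is the union of the
    rational boxes it contains, hence measurable for the product structure. *)
Definition box_open (A : set (R * R)) := forall w, A w -> exists2 e : R, 0 < e &
  forall w', `|w'.1 - w.1| < e -> `|w'.2 - w.2| < e -> A w'.

Lemma box_open_measurable (A : set (R * R)) : box_open A -> measurable A.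
Proof.
move=> oA.
pose B (i : (rat * rat) * (rat * rat)) : set (R * R) :=
  `]ratr i.1.1, ratr i.1.2[%classic `*` `]ratr i.2.1, ratr i.2.2[%classic.
pose C i := if `[< B i `<=` A >] then B i else set0.
have -> : A = \bigcup_i C i.
  apply/seteqP; split => [w Aw|w [i _]].
    have [e e0 eA] := oA w Aw.
    have h1 : w.1 - e < w.1 by lra.
    have h2 : w.1 < w.1 + e by lra.
    have h3 : w.2 - e < w.2 by lra.
    have h4 : w.2 < w.2 + e by lra.
    have [q1] := rat_in_itvoo h1; rewrite in_itv /= => /andP[q11 q12].
    have [q2] := rat_in_itvoo h2; rewrite in_itv /= => /andP[q21 q22].
    have [q3] := rat_in_itvoo h3; rewrite in_itv /= => /andP[q31 q32].
    have [q4] := rat_in_itvoo h4; rewrite in_itv /= => /andP[q41 q42].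
    have BA : B ((q1, q2), (q3, q4)) `<=` A.
      move=> w' [] /=; rewrite !in_itv /= => /andP[a1 a2] /andP[a3 a4].
      by apply: eA; rewrite ltr_norml; apply/andP; split; lra.
    exists ((q1, q2), (q3, q4)) => //; rewrite /C (asboolT BA).
    by split; rewrite /= in_itv /=; apply/andP.
  by rewrite /C; case: asboolP => // BA /BA.
apply: countable_bigcupT_measurable; first exact: countableP.
move=> i; rewrite /C; case: asboolP => // _.
by apply: measurableX; exact: measurable_itv.
Qed.

Definition box_continuous (A : set (R * R)) (k : R * R -> R) := forall w, A w ->
  forall e : R, 0 < e -> exists2 a : R, 0 < a & forall w',
  `|w'.1 - w.1| < a -> `|w'.2 - w.2| < a -> `|k w' - k w| < e.

Lemma box_continuous_measurable (A : set (R * R)) (k : R * R -> R) :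
  box_open A -> box_continuous A k -> measurable_fun A k.
Proof.
move=> oA ck mA.
apply: (measurability _ (measurable_realfun.RGenOInfty.measurableE R)) => //.
move=> _ [_ [x ->] <-]; apply: box_open_measurable => w [Aw].
rewrite /= in_itv /= andbT => xk.
have [e e0 eA] := oA w Aw.
have d0 : 0 < k w - x by lra.
have [a a0 ak] := ck w Aw _ d0.
exists (Num.min e a); first by rewrite lt_min e0.
move=> w'; rewrite !lt_min => /andP[h1 h2] /andP[h3 h4]; split; first exact: eA.
rewrite /= in_itv /= andbT; have := ak w' h2 h4; rewrite ltr_norml; lra.
Qed.

Definition cpt (w : R * R) : R[i] := w.1 +i* w.2.

Lemma normc_cptB (w w' : R * R) (e : R) : `|w'.1 - w.1| < e -> `|w'.2 - w.2| < e ->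
  normc (cpt w' - cpt w) < 2 * e.
Proof.
by move=> h1 h2; apply: (le_lt_trans (normc_le _)); rewrite /cpt /=; lra.
Qed.

Definition disk2 : set (R * R) := [set w | unit_disk (w.1 +i* w.2)].

Lemma disk2_open : box_open disk2.
Proof.
move=> w; rewrite /disk2 /unit_disk => /= wD.
exists ((1 - normc (cpt w)) / 2); first by rewrite divr_gt0 // subr_gt0.
move=> w' h1 h2; have := normc_cptB h1 h2.
by have := normcD (cpt w' - cpt w) (cpt w); rewrite subrK /cpt /=; lra.
Qed.

Lemma disk2_measurable : measurable disk2.
Proof. exact: box_open_measurable disk2_open. Qed.

Lemma ccont_measurable (g : R[i] -> R[i]) :
  (forall z, unit_disk z -> ccont g z) ->
  measurable_fun disk2 (fun w => normc (g (w.1 +i* w.2))).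
Proof.
move=> cg; apply: box_continuous_measurable; first exact: disk2_open.
move=> w wD e e0; have e2 : 0 < e / 2 by lra.
have [a a0 ag] := cg _ wD _ e2.
exists (a / 2); first by lra.
move=> w' h1 h2; apply: (le_lt_trans (normc_dist _ _)).
have := ag (cpt w' - cpt w); have := normc_cptB h1 h2.
by rewrite (addrC (w.1 +i* w.2)) subrK /cpt; lra.
Qed.

End Plane.

(** * The area mean value inequality *)

Section AreaMean.
Context {R : realType}.
Local Notation mu := (@lebesgue_measure R).
Local Notation mu2 := (mu \x mu)%E.
Implicit Types (g E : R[i] -> R[i]) (r rho : R).

Lemma le_integral_segment (f : R -> R) (k : R -> \bar R) (c r : R) :
  measurable_fun [set: R] k -> (forall x, 0 <= k x)%E -> rintegrable f (- r) r ->
  (forall t, - r <= t <= r -> ((f t)%:E <= k (t + c)%R)%E) ->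
  (forall t, - r <= t <= r -> 0 <= f t) ->
  ((rint f (- r) r)%:E <= \int[mu]_x k x)%E.
Proof.
move=> mk k0 fi fk f0.
have mkc : measurable_fun [set: R] (fun x => k (x + c)%R).
  apply: (measurableT_comp mk).
  by apply: measurable_funD => //; exact: measurable_cst.
rewrite /rint /Rintegral fineK; last exact: integrable_fin_num.
rewrite -(ge0_integral_shift c mk k0).
apply: (@le_trans _ _ (\int[mu]_(x in `[(- r)%R, r]) k (x + c)%R)%E).
  apply: ge0_le_integral => //.
  - by case/integrableP: fi.
  - exact: measurable_funTS.
by apply: ge0_subset_integral => //; exact: measurable_itv.
Qed.

Definition square2 (a : R[i]) rho : set (R * R) :=
  [set w | snorm (w.1 +i* w.2 - a) <= rho].

Lemma square2E a rho : square2 a rho =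
  `[Re a - rho, Re a + rho]%classic `*` `[Im a - rho, Im a + rho]%classic.
Proof.
apply/seteqP; split => -[x y]; rewrite /square2 /= snorm_le ReB ImB /=.
  by rewrite !ler_norml => /andP[/andP[? ?] /andP[? ?]]; split; rewrite /= in_itv /=; lra.
by case=> /=; rewrite !in_itv /= !ler_norml => ? ?; lra.
Qed.

Lemma square2_measurable a rho : measurable (square2 a rho).
Proof. by rewrite square2E; apply: measurableX; exact: measurable_itv. Qed.

(** Cauchy's formula with moduli; the factor [r] compensates [|1 / z| <= 1 / r] on
    the contour. *)
Lemma square_mean_sides g E (a : R[i]) r : 0 < r ->
  (forall z, snorm z <= r -> cdiff g (a + z) (E (a + z))) ->
  2 * r * normc (g a) <=
    rint (fun x => r * normc (g (a + (x +i* - r)) / (x +i* - r))) (- r) r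
  + rint (fun x => r * normc (g (a + (x +i* r)) / (x +i* r))) (- r) r
  + rint (fun y => r * normc (g (a + (r +i* y)) / (r +i* y))) (- r) r
  + rint (fun y => r * normc (g (a + (- r +i* y)) / (- r +i* y))) (- r) r.
Proof.
move=> r0 dg.
have dg' z : snorm z <= r -> cdiff (fun x => g (a + x)) z (E (a + z)).
  by move=> /dg; exact: cdiff_shift.
have cF : bcont (fun z => g (a + z) / z) r.
  move=> z zr; apply: ccontM.
    by apply: (cdiff_cont (d := E (a + z))); apply: dg'; rewrite zr.
  by apply: cdiff_cont (cdiff_inv _); apply: snorm_neq0; rewrite zr.
have cg0 : ccont (fun x => g (a + x)) 0.
  by apply: (cdiff_cont (d := E (a + 0))); apply: dg'; rewrite snorm0 ltW.
have := cauchy_square r0 cg0 (fun z _ => dg' z); rewrite addr0 => sqE.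
have := sq_norm_int (ltW r0) cF; rewrite sqE normcM.
have [s1 s2 s3 s4] := segcont_sides (ltW r0) cF.
rewrite !rintZ; [|exact: segcont_norm..].
have := kappa_ge r0.
have n0 := normc_ge0 (g a).
set A := rint _ _ _; set B := rint _ _ _; set C := rint _ _ _; set D := rint _ _ _.
move=> k4 h1.
have h2 : 4 * normc (g a) <= 2 * (A + B + C + D).
  by apply: le_trans h1; rewrite ler_wpM2r.
by rewrite -!mulrDr mulrAC mulrC ler_pM2l //; lra.
Qed.

Lemma normc_side g z r : 0 < r -> snorm z = r ->
  forall w, r * normc (g w / z) <= normc (g w).
Proof.
move=> r0 zr w; rewrite normcM mulrCA ler_piMr ?normc_ge0 //.
by rewrite -ler_pdivlMl // mulr1; exact: snorm_invr.
Qed.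

(** Average [square_mean_sides] over the half-sides [r] between [rho / 2] and [rho]:
    each of the four sides then sweeps a part of the square, and by Tonelli's
    theorem each sweep is at most the area integral. Squares make these sweeps
    iterated integrals in Cartesian coordinates, where circles would require a
    change to polar coordinates. *)
Lemma area_mean g E a rho : 0 < rho ->
  (forall z, snorm (z - a) <= rho -> cdiff g z (E z)) ->
  measurable_fun (square2 a rho) (fun w => normc (g (w.1 +i* w.2))) ->
  ((rho ^+ 2 * normc (g a))%:E <=
    8%:E * \int[mu2]_(w in square2 a rho) (normc (g (w.1 +i* w.2)))%:E)%E.
Proof.
case: a => al be rho0 dg mg; set Q := square2 (al +i* be) rho.
have mQ : measurable Q by exact: square2_measurable.
pose H := (fun w : R * R => (normc (g (w.1 +i* w.2)))%:E) \_ Q.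
have mH : measurable_fun [set: R * R] H.
  by apply/(measurable_restrictT _ mQ); exact/measurable_EFinP.
have H0 w : (0 <= H w)%E.
  by rewrite /H /patch; case: ifP => _ //; rewrite lee_fin normc_ge0.
have HQ w : Q w -> H w = (normc (g (w.1 +i* w.2)))%:E.
  by move=> Qw; rewrite /H /patch mem_set.
pose V := fubini_G mu H; pose W := fubini_F mu H.
have mV : measurable_fun [set: R] V by exact: measurable_fun_fubini_tonelli_G.
have mW : measurable_fun [set: R] W by exact: measurable_fun_fubini_tonelli_F.
have V0 y : (0 <= V y)%E by apply: integral_ge0 => x _; exact: H0.
have W0 x : (0 <= W x)%E by apply: integral_ge0 => y _; exact: H0.
set I := (\int[mu2]_(w in Q) _)%E.
have IE : I = (\int[mu2]_w H w)%E by rewrite /I integral_mkcond.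
have VI : (\int[mu]_y V y = I)%E by rewrite IE fubini_tonelli2.
have WI : (\int[mu]_x W x = I)%E by rewrite IE fubini_tonelli1.
have dga z : snorm z <= rho -> cdiff g (al +i* be + z) (E (al +i* be + z)).
  by move=> zr; apply: dg; rewrite addrAC subrr add0r.
have key r : 0 < r -> r <= rho -> ((2 * r * normc (g (al +i* be)))%:E <=
    V (be - r)%R + V (r + be)%R + W (r + al)%R + W (al - r)%R)%E.
  move=> r0 rrho.
  have dgr z : snorm z <= r -> cdiff g (al +i* be + z) (E (al +i* be + z)).
    by move=> zr; apply: dga; exact: le_trans rrho.
  have cF : bcont (fun z => g (al +i* be + z) / z) r.
    move=> z zr; apply: ccontM.
      by apply: ccont_shift; apply: cdiff_cont (dgr _ _); rewrite zr.
    by apply: cdiff_cont (cdiff_inv _); apply: snorm_neq0; rewrite zr.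
  have [s1 s2 s3 s4] := segcont_sides (ltW r0) cF.
  have rI phi : segcont phi (- r) r -> rintegrable (fun t => r * normc (phi t)) (- r) r.
    move=> /(segcontZ r%:C)/segcont_norm.
    rewrite (_ : (fun t => normc (r%:C * phi t)) = (fun t => r * normc (phi t))) //.
    by apply/funext => t; rewrite normc_mulr_real gtr0_norm.
  apply: (@le_trans _ _ ((_ + _ + _ + _)%:E)).
    rewrite lee_fin; exact: (square_mean_sides r0 dgr).
  have f0 phi t : 0 <= r * normc (phi t : R[i]) by rewrite mulr_ge0 ?normc_ge0 // ltW.
  have side z : snorm z = r -> ((r * normc (g (al +i* be + z) / z))%:E <= H (al + Re z, be + Im z)%R)%E.
    move=> zr; have zE : al +i* be + z = (al + Re z) +i* (be + Im z) by case: (z).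
    rewrite HQ; last by rewrite /Q /square2 /= -zE addrAC subrr add0r zr.
    by rewrite lee_fin /= -zE; exact: normc_side.
  rewrite !EFinD; apply: leeD; [apply: leeD; [apply: leeD|]|].
  - apply: (@le_integral_segment _ (fun x => H (x, be - r)%R) al) => //.
    + exact: measurableT_comp mH (measurable_pair2 _).
    + exact: rI s1.
    + move=> t tI; rewrite (addrC t); apply: (side (t +i* - r)).
      by case: (snorm_sides (ltW r0) tI).
  - apply: (@le_integral_segment _ (fun x => H (x, r + be)%R) al) => //.
    + exact: measurableT_comp mH (measurable_pair2 _).
    + exact: rI s2.
    + move=> t tI; rewrite (addrC t) (addrC r); apply: (side (t +i* r)).
      by case: (snorm_sides (ltW r0) tI).
  - apply: (@le_integral_segment _ (fun y => H (r + al, y)%R) be) => //.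
    + exact: measurableT_comp mH (measurable_pair1 _).
    + exact: rI s3.
    + move=> t tI; rewrite (addrC t) (addrC r); apply: (side (r +i* t)).
      by case: (snorm_sides (ltW r0) tI).
  - apply: (@le_integral_segment _ (fun y => H (al - r, y)%R) be) => //.
    + exact: measurableT_comp mH (measurable_pair1 _).
    + exact: rI s4.
    + move=> t tI; rewrite (addrC t); apply: (side (- r +i* t)).
      by case: (snorm_sides (ltW r0) tI).
pose S r := (V (be - r)%R + V (r + be)%R + W (r + al)%R + W (al - r)%R)%E.
have mrefl (k : R -> \bar R) c : measurable_fun [set: R] k -> measurable_fun [set: R] (fun r => k (c - r)%R).
  move=> mk; apply: (measurableT_comp mk).
  by apply: measurable_funB => //; exact: measurable_cst.
have mshift (k : R -> \bar R) c : measurable_fun [set: R] k -> measurable_fun [set: R] (fun r => k (r + c)%R).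
  move=> mk; apply: (measurableT_comp mk).
  by apply: measurable_funD => //; exact: measurable_cst.
have m1 := mrefl _ be mV; have m2 := mshift _ be mV.
have m3 := mshift _ al mW; have m4 := mrefl _ al mW.
have m12 := emeasurable_funD m1 m2; have m123 := emeasurable_funD m12 m3.
have mS : measurable_fun [set: R] S := emeasurable_funD m123 m4.
have P2 x : (0 <= V (be - x)%R + V (x + be)%R)%E by apply: adde_ge0; exact: V0.
have P3 x : (0 <= V (be - x)%R + V (x + be)%R + W (x + al)%R)%E.
  by apply: adde_ge0; [exact: P2|exact: W0].
have S0 x : (0 <= S x)%E by apply: adde_ge0; [exact: P3|exact: W0].
have SI : (\int[mu]_r S r = 4%:E * I)%E.
  rewrite /S ge0_integralD; [|exact: measurableT|by move=> x _; exact: P3|exact: m123|by move=> x _; exact: W0|exact: m4].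
  rewrite ge0_integralD; [|exact: measurableT|by move=> x _; exact: P2|exact: m12|by move=> x _; exact: W0|exact: m3].
  rewrite ge0_integralD; [|exact: measurableT|by move=> x _; exact: V0|exact: m1|by move=> x _; exact: V0|exact: m2].
  rewrite !ge0_integral_shift // !ge0_integral_reflect // VI WI.
  have I0 : (0 <= I)%E by rewrite -VI; apply: integral_ge0.
  have -> : 4%:E = (1 + 1 + 1 + 1)%:E :> \bar R by congr EFin; ring.
  by rewrite !EFinD !ge0_muleDl ?adde_ge0 ?lee_fin // mul1e.
set n := normc _ in key *.
have n0 : 0 <= n by exact: normc_ge0.
have half : ((rho / 2 * (rho * n))%:E <= 4%:E * I)%E.
  rewrite -SI.
  apply: (@le_trans _ _ (\int[mu]_(r in `[(rho / 2)%R, rho]) S r)%E); last first.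
    by apply: ge0_subset_integral => //; exact: measurable_itv.
  apply: (@le_trans _ _ (\int[mu]_(r in `[(rho / 2)%R, rho]) (cst (rho * n)%:E r))%E).
    rewrite integral_cst //= lebesgue_measure_itv /= lte_fin ifT; last by lra.
    by rewrite -EFinB -EFinM lee_fin; nra.
  apply: ge0_le_integral => //.
  - by move=> x _; rewrite lee_fin mulr_ge0 // ltW.
  - exact: measurable_funTS.
  - move=> x; rewrite /= in_itv /= => /andP[x1 x2].
    apply: le_trans (key x _ x2); last by lra.
    by rewrite lee_fin ler_wpM2r //; lra.
have -> : (rho ^+ 2 * n)%:E = (2%:E * (rho / 2 * (rho * n))%:E)%E.
  by rewrite -EFinM; congr EFin; field.
have -> : (8%:E * I = 2%:E * (4%:E * I))%E.
  by rewrite muleA -EFinM; congr (_%:E * _)%E; ring.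
by apply: lee_pmul => //; rewrite lee_fin //; rewrite !mulr_ge0 // ltW //; lra.
Qed.

End AreaMean.

(** * Real powers *)

Section RealPowers.
Context {R : realType}.
Implicit Types (x y S a B p : R).

Lemma powR_split x p : 0 <= x -> 1 < p -> x `^ p = x * x `^ (p - 1).
Proof.
move=> x0 p1; have {1}-> : p = 1 + (p - 1) by ring.
rewrite (@powRD _ x 1 (p - 1)) ?powRr1 //; apply/implyP; rewrite (_ : 1 + (p - 1) = p); last by ring.
by rewrite gt_eqF //; lra.
Qed.

Lemma powR_compl d p : 0 < d -> d `^ (1 - p) = (d `^ (p - 1))^-1.
Proof. by move=> d0; rewrite -powRN opprB. Qed.

(** Below the level [d] the first term suffices; above it [(x / d) ^ (p - 1) >= 1]. *)
Lemma truncation d x p : 0 < d -> 0 <= x -> 1 < p -> x <= d + d `^ (1 - p) * x `^ p.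
Proof.
move=> d0 x0 p1; have [xd|dx] := leP x d.
  by rewrite (le_trans xd) // lerDl mulr_ge0 // powR_ge0.
rewrite (powR_split x0 p1) powR_compl // mulrCA.
have dp : 0 < d `^ (p - 1) by rewrite powR_gt0.
have : 1 <= (d `^ (p - 1))^-1 * x `^ (p - 1).
  rewrite ler_pdivlMl // mulr1; apply: ge0_ler_powR; rewrite ?nnegrE; try lra.
move=> h; apply: (@le_trans _ _ (x * ((d `^ (p - 1))^-1 * x `^ (p - 1)))).
  by rewrite -{1}[x]mulr1 ler_wpM2l.
by rewrite lerDr ltW.
Qed.

(** Truncation plays the part of Hoelder's inequality: a bound that is linear in
    the level [d] turns, at the optimal level, into a bound of the p-th power. The
    choice [d = S / (2 a)] makes the first term half of [S]. *)
Lemma absorb S a B p : 0 <= S -> 0 < a -> 0 <= B -> 1 < p ->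
  (forall d, 0 < d -> S <= a * d + B * d `^ (1 - p)) ->
  S `^ p <= 2 * (2 * a) `^ (p - 1) * B.
Proof.
move=> S0 a0 B0 p1 h; have [S_eq0|S_neq0] := eqVneq S 0.
  by rewrite S_eq0 powR0 ?mulr_ge0 ?powR_ge0 // gt_eqF //; lra.
have {S_neq0}S0 : 0 < S by rewrite lt0r S_neq0.
pose d := S / (2 * a).
have a2 : 0 < 2 * a by lra.
have d0 : 0 < d by rewrite divr_gt0.
have hd := h d d0.
have Sd : S = 2 * a * d by rewrite /d; field; rewrite gt_eqF.
have dp : 0 < d `^ (p - 1) by rewrite powR_gt0.
rewrite powR_compl // in hd.
have : S / 2 <= B * (d `^ (p - 1))^-1 by move: hd; rewrite {1 2}Sd; lra.
rewrite ler_pdivlMr // => h2.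
rewrite (powR_split (ltW S0) p1) {2}Sd (powRM _ (ltW a2) (ltW d0)).
have ap : 0 < (2 * a) `^ (p - 1) by rewrite powR_gt0.
have -> : S * ((2 * a) `^ (p - 1) * d `^ (p - 1)) = 2 * (2 * a) `^ (p - 1) * (S / 2 * d `^ (p - 1)) by field.
by rewrite ler_wpM2l // mulr_ge0 // ltW.
Qed.

(** Hoelder's inequality for a finite sum, up to a constant. *)
Lemma powR_sum_bound (N : nat) (x : nat -> R) p (J : R) : 1 < p ->
  (forall k, 0 <= x k) -> \sum_(k < N) x k `^ p <= J ->
  (\sum_(k < N) x k) `^ p <= 2 `^ p * N%:R `^ (p - 1) * J.
Proof.
move=> p1 x0 hJ.
have J0 : 0 <= J by apply: le_trans hJ; apply: sumr_ge0 => k _; exact: powR_ge0.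
case: N hJ => [|N] hJ.
  rewrite big_ord0 powR0 ?mulr_ge0 ?powR_ge0 // gt_eqF //; lra.
have S0 : 0 <= \sum_(k < N.+1) x k by apply: sumr_ge0.
rewrite (powR_split (ltW (ltr0n _ 2)) p1).
rewrite -[2 * _ * _]mulrA -powRM //.
rewrite (_ : 2%:R * N.+1%:R = 2 * N.+1%:R) //; apply: absorb => //.
move=> d d0.
apply: (@le_trans _ _ (\sum_(k < N.+1) (d + d `^ (1 - p) * x k `^ p))).
  by apply: ler_sum => k _; exact: truncation.
rewrite big_split /= sumr_const card_ord -mulr_sumr -[d *+ _]mulr_natl lerD2l.
by rewrite mulrC ler_wpM2r // powR_ge0.
Qed.

Lemma powRD_le x y p : 0 <= x -> 0 <= y -> 1 < p ->
  (x + y) `^ p <= 2 `^ p * (x `^ p + y `^ p).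
Proof.
move=> x0 y0 p1.
have xp := powR_ge0 x p; have yp := powR_ge0 y p.
have t2 : 0 <= 2 `^ p :> R by exact: powR_ge0.
have p0 : 0 <= p by lra.
wlog yx : x y x0 y0 xp yp / y <= x.
  by move=> H; case/orP: (le_total x y) => h; [rewrite addrC (addrC (x `^ p))|]; exact: H.
apply: (@le_trans _ _ ((2 * x) `^ p)).
  by apply: ge0_ler_powR; rewrite ?nnegrE //; lra.
by rewrite powRM // ler_wpM2l // lerDl.
Qed.

(** Powers of comparable numbers are comparable, whatever the sign of the exponent. *)
Lemma weight_ge (t u p : R) : 0 < t -> t / 4 <= u <= 4 * t ->
  4 `^ (- `|p - 2|) * t `^ (p - 2) <= u `^ (p - 2).
Proof.
move=> t0 /andP[tu ut].
have u0 : 0 < u by apply: lt_le_trans tu; rewrite divr_gt0.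
have f0 : 0 < 4 :> R by [].
have [p2|p2] := leP 0 (p - 2).
  rewrite ger0_norm // powRN mulrC ler_pdivrMr ?powR_gt0 // -(powRM _ (ltW u0) (ltW f0)).
  by apply: ge0_ler_powR; rewrite ?nnegrE //; lra.
rewrite ltr0_norm // opprK -(powRM _ (ltW f0) (ltW t0)).
have e : p - 2 = - (2 - p) by ring.
rewrite e !powRN lef_pV2 ?posrE ?powR_gt0 ?mulr_gt0 //.
by apply: ge0_ler_powR; rewrite ?nnegrE; lra.
Qed.

End RealPowers.

(** * Pointwise bounds by the weighted area integral *)

Section Growth.
Context {R : realType}.
Local Notation mu := (@lebesgue_measure R).
Local Notation mu2 := (mu \x mu)%E.
Implicit Types (f g : R[i] -> R[i]) (z a e : R[i]) (r rho p : R).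

Lemma cdiff_cderive f z d : cdiff f z d -> cderive f z = d.
Proof.
move=> /cdiffP H; rewrite /cderive derive1E.
exact: (@derive_val _ _ _ _ _ _ _ H).
Qed.

Lemma hol_cdiff f z : holomorphic f -> unit_disk z -> cdiff f z (cderive f z).
Proof.
move=> hf zD; have /cdiffP H := derivableP (hf z zD).
by rewrite (cdiff_cderive H).
Qed.

Lemma cdiff_hol f : (forall z, unit_disk z -> exists d, cdiff f z d) -> holomorphic f.
Proof. by move=> h z /h[d /cdiffP []]. Qed.

Lemma unit_disk_ball z w : normc (w - z) < 1 - normc z -> unit_disk w.
Proof. by rewrite /unit_disk /= => h; have := normcD (w - z) z; rewrite subrK; lra. Qed.

Lemma cderive_hol f : holomorphic f -> holomorphic (cderive f).
Proof.
move=> hf; apply: cdiff_hol => z zD.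
have rho0 : 0 < 1 - normc z by rewrite subr_gt0.
apply: (deriv_cdiff rho0) => w hw.
by apply: hol_cdiff => //; exact: unit_disk_ball hw.
Qed.

Lemma hol_measurable f : holomorphic f ->
  measurable_fun disk2 (fun w : R * R => normc (f (w.1 +i* w.2))).
Proof.
by move=> hf; apply: ccont_measurable => z zD; exact: cdiff_cont (hol_cdiff hf zD).
Qed.

Lemma normc_measurable : measurable_fun disk2 (fun w : R * R => normc (w.1 +i* w.2)).
Proof.
by apply: (@ccont_measurable _ id) => z _; exact: cdiff_cont (cdiff_id z).
Qed.

Definition weight (s : R) (w : R * R) : R := (1 - normc (w.1 +i* w.2) ^+ 2) `^ s.

Definition density p f (w : R * R) : R :=
  normc (cderive f (w.1 +i* w.2)) `^ p * weight (p - 2) w.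

Lemma weight_measurable s : measurable_fun disk2 (weight s).
Proof.
apply: (measurableT_comp (measurable_powR s)).
apply: measurable_funB; first exact: measurable_cst.
by apply: measurable_funX; exact: normc_measurable.
Qed.

Lemma density_measurable p f : holomorphic f -> measurable_fun disk2 (density p f).
Proof.
move=> hf; apply: measurable_funM; last exact: weight_measurable.
apply: (measurableT_comp (measurable_powR p)).
exact: hol_measurable (cderive_hol hf).
Qed.

Lemma weight_ge0 s w : 0 <= weight s w.
Proof. exact: powR_ge0. Qed.

Lemma density_ge0 p f w : 0 <= density p f w.
Proof. by rewrite mulr_ge0 ?powR_ge0. Qed.

Lemma besov_integralE p f : besov_integral p f = (\int[mu2]_(w in disk2) (density p f w)%:E)%E.
Proof. by []. Qed.

Lemma square2_measure a rho : 0 < rho -> mu2 (square2 a rho) = (4 * rho ^+ 2)%:E.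
Proof.
move=> rho0; rewrite square2E product_measure1E; [|exact: measurable_itv|exact: measurable_itv].
rewrite /= !lebesgue_measure_itv /= !lte_fin !ifT; [|lra|lra].
by rewrite -!EFinB -EFinM; congr EFin; ring.
Qed.

Lemma square2_disk a rho : normc a + 2 * rho < 1 -> square2 a rho `<=` disk2.
Proof.
move=> h w hw; change (normc (w.1 +i* w.2) < 1).
have {hw} : snorm (w.1 +i* w.2 - a) <= rho := hw.
have := normcD (w.1 +i* w.2 - a) a; rewrite subrK.
by have := normc_le_snorm (w.1 +i* w.2 - a); lra.
Qed.

(** The area mean value inequality for the holomorphic function [cderive f],
    truncated at a level [d] and absorbed; [c] bounds the Besov weight from below on
    the square. *)
Lemma deriv_powR_bound p f a rho (c J : R) (A : set (R * R)) : 1 < p ->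
  holomorphic f -> 0 < rho -> 0 < c -> normc a + 2 * rho < 1 ->
  measurable A -> A `<=` disk2 -> square2 a rho `<=` A ->
  (forall w, square2 a rho w -> c <= weight (p - 2) w) ->
  (\int[mu2]_(w in A) (density p f w)%:E <= J%:E)%E ->
  normc (cderive f a) `^ p <= 2 * (2 * 32) `^ (p - 1) * (8 * J / (rho ^+ 2 * c)).
Proof.
move=> p1 hf rho0 c0 arho mA AD QA cw hJ.
set Q := square2 a rho in QA cw *.
have mQ : measurable Q by exact: square2_measurable.
have QD := square2_disk arho.
have md := density_measurable p hf.
have mdA : measurable_fun A (fun w => (density p f w)%:E).
  by apply/measurable_EFinP; exact: measurable_funS disk2_measurable AD md.
have mdQ : measurable_fun Q (fun w => (density p f w)%:E).
  by apply/measurable_EFinP; exact: measurable_funS disk2_measurable QD md.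
have d0 w : (0 <= (density p f w)%:E)%E by rewrite lee_fin density_ge0.
have J0 : 0 <= J by rewrite -lee_fin; apply: le_trans hJ; exact: integral_ge0.
have hQ : (\int[mu2]_(w in Q) (density p f w)%:E <= J%:E)%E.
  by apply: le_trans hJ; exact: ge0_subset_integral.
have rc : 0 < rho ^+ 2 * c by rewrite mulr_gt0 ?exprn_gt0.
apply: absorb => //; first exact: normc_ge0.
  by rewrite divr_ge0 ?mulr_ge0 // ltW.
move=> d d_gt0.
have hmf : measurable_fun Q (fun w => normc (cderive f (w.1 +i* w.2))).
  by apply: measurable_funS disk2_measurable QD _; exact: hol_measurable (cderive_hol hf).
have dg z : snorm (z - a) <= rho -> cdiff (cderive f) z (cderive (cderive f) z).
  move=> zr; apply: (hol_cdiff (cderive_hol hf)).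
  by case: z zr => x y zr; exact: (QD (x, y) zr).
have am := area_mean rho0 dg hmf; rewrite -/Q in am.
pose k := d `^ (1 - p) / c.
have k0 : 0 <= k by rewrite divr_ge0 ?powR_ge0 // ltW.
have le1 : (\int[mu2]_(w in Q) (normc (cderive f (w.1 +i* w.2)))%:E
    <= \int[mu2]_(w in Q) (d%:E + k%:E * (density p f w)%:E))%E.
  apply: ge0_le_integral => //.
  - by move=> w _; rewrite lee_fin normc_ge0.
  - exact/measurable_EFinP.
  - apply: emeasurable_funD; first exact: measurable_cst.
    by apply: emeasurable_funM => //; exact: measurable_cst.
  - move=> w Qw; rewrite -EFinM -EFinD lee_fin.
    set x := normc _; have x0 : 0 <= x by exact: normc_ge0.
    apply: (le_trans (truncation d_gt0 x0 p1)); rewrite lerD2l /k -mulrA.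
    apply: ler_wpM2l; first exact: powR_ge0.
    rewrite ler_pdivlMl // mulrC /density -/x.
    by apply: ler_wpM2l; [exact: powR_ge0|exact: cw].
have eq1 : (\int[mu2]_(w in Q) (d%:E + k%:E * (density p f w)%:E)
    <= (d * (4 * rho ^+ 2) + k * J)%:E)%E.
  rewrite ge0_integralD; first last.
  - by apply: emeasurable_funM => //; exact: measurable_cst.
  - by move=> w _; apply: mule_ge0; rewrite lee_fin ?density_ge0.
  - exact: measurable_cst.
  - by move=> w _; rewrite lee_fin ltW.
  - by [].
  rewrite EFinD; apply: leeD.
    by rewrite EFinM -(square2_measure a rho0) (integral_cst mu2 mQ).
  rewrite ge0_integralZl_EFin //.
  by rewrite [leRHS]EFinM; apply: lee_wpmul2l; rewrite ?lee_fin.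
have le2 := le_trans le1 eq1.
have : ((rho ^+ 2 * normc (cderive f a))%:E <= (8 * (d * (4 * rho ^+ 2) + k * J))%:E)%E.
  apply: (le_trans am); rewrite [leRHS]EFinM.
  by apply: lee_wpmul2l.
rewrite lee_fin => h.
rewrite -(ler_pM2l (exprn_gt0 2 rho0)); apply: (le_trans h).
rewrite le_eqVlt; apply/orP; left; apply/eqP; rewrite /k; field.
by rewrite !gt_eqF.
Qed.

End Growth.

(** * Dyadic chains towards the boundary *)

Section DyadicChain.
Context {R : realType}.
Local Notation mu := (@lebesgue_measure R).
Local Notation mu2 := (mu \x mu)%E.
Implicit Types (f : R[i] -> R[i]) (z e : R[i]) (r p t : R) (k N : nat).

Definition dyadic k : R := (2 ^+ k)^-1.

Lemma dyadic_gt0 k : 0 < dyadic k.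
Proof. by rewrite invr_gt0 exprn_gt0. Qed.

Lemma dyadicS k : dyadic k = 2 * dyadic k.+1.
Proof. by rewrite /dyadic exprS; field; rewrite gt_eqF // exprn_gt0. Qed.

Lemma dyadic0 : dyadic 0 = 1.
Proof. by rewrite /dyadic expr0 invr1. Qed.

(** The points whose distance to the unit circle is comparable to [dyadic k]. The
    square of half-side [dyadic k / 8] around any point at a distance between
    [dyadic k / 2] and [dyadic k] stays inside. *)
Definition shell k : set (R * R) :=
  disk2 `&` (fun w => normc (w.1 +i* w.2)) @^-1` `[1 - 2 * dyadic k, 1 - dyadic k / 4]%classic.

(** Shells overlap, but [shell k] lies in [collar k] and misses [collar (k + 4)]: the
    overlaps are controlled by telescoping instead of counting. *)
Definition collar k : set (R * R) :=
  disk2 `&` (fun w => normc (w.1 +i* w.2)) @^-1` `[1 - 2 * dyadic k, 1]%classic.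

Lemma shell_measurable k : measurable (shell k).
Proof. by apply: normc_measurable; [exact: disk2_measurable|exact: measurable_itv]. Qed.

Lemma collar_measurable k : measurable (collar k).
Proof. by apply: normc_measurable; [exact: disk2_measurable|exact: measurable_itv]. Qed.

Definition shell_const p : R := 2 * (2 * 32) `^ (p - 1) * (8 * 64 * 4 `^ `|p - 2|).

Lemma shell_const_ge0 p : 0 <= shell_const p.
Proof. by rewrite !mulr_ge0 ?powR_ge0. Qed.

Lemma powR_sqr t p : 0 < t -> t `^ p = t ^+ 2 * t `^ (p - 2).
Proof.
move=> t0; rewrite -powR_mulrn ?ltW // -powRD; first by congr (_ `^ _); ring.
by apply/implyP => _; rewrite gt_eqF.
Qed.

Lemma shell_deriv p f e (sigma J : R) k : 1 < p -> holomorphic f -> normc e = 1 ->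
  0 <= sigma -> 1 - dyadic k <= sigma <= 1 - dyadic k / 2 ->
  (\int[mu2]_(w in shell k) (density p f w)%:E <= J%:E)%E ->
  normc (cderive f (sigma%:C * e)) `^ p <= shell_const p * J / dyadic k `^ p.
Proof.
move=> p1 hf e1 s0 /andP[s1 s2] hJ; set t := dyadic k in s1 s2 *.
have t0 : 0 < t by exact: dyadic_gt0.
have r0 : 0 < t / 8 by rewrite divr_gt0.
have c0 : 0 < 4 `^ (- `|p - 2|) * t `^ (p - 2) by rewrite mulr_gt0 ?powR_gt0.
have ns : normc (sigma%:C * e) = sigma by rewrite normc_mulr_real e1 mulr1 ger0_norm.
have near w : square2 (sigma%:C * e) (t / 8) w ->
    sigma - t / 4 <= normc (w.1 +i* w.2) <= sigma + t / 4.
  move=> hw; have {hw} : snorm (w.1 +i* w.2 - sigma%:C * e) <= t / 8 := hw.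
  have := normc_le_snorm (w.1 +i* w.2 - sigma%:C * e).
  have := normc_dist (w.1 +i* w.2) (sigma%:C * e); rewrite ns ler_norml.
  move: (normc _) (snorm _) (normc _) => x y u; lra.
have lt1 : normc (sigma%:C * e) + 2 * (t / 8) < 1 by rewrite ns; lra.
have sub : square2 (sigma%:C * e) (t / 8) `<=` shell k.
  move=> w hw; split; first exact: square2_disk lt1 _ hw.
  by have := near w hw; rewrite /= in_itv /= -/t; lra.
have wt w : square2 (sigma%:C * e) (t / 8) w ->
    4 `^ (- `|p - 2|) * t `^ (p - 2) <= weight (p - 2) w.
  move=> hw; apply: weight_ge => //; have := near w hw; have := normc_ge0 (w.1 +i* w.2).
  by move: (normc _) => x; nra.
have := deriv_powR_bound p1 hf r0 c0 lt1 (shell_measurable k) (@subIsetl _ _ _) sub wt hJ.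
suff -> : shell_const p * J / t `^ p = 2 * (2 * 32) `^ (p - 1) *
   (8 * J / ((t / 8) ^+ 2 * (4 `^ (- `|p - 2|) * t `^ (p - 2)))) by [].
rewrite (powR_sqr p t0) powRN /shell_const; field.
by rewrite !gt_eqF ?powR_gt0.
Qed.

(** Dyadic points on a radius of length [r], stopped at [r] so that later steps are
    trivial. *)
Definition ladder r k : R := Num.min r (1 - dyadic k).

(** On the k-th step [dyadic k * |f'|] is bounded by the p-th root of the share of
    [shell k] in the Besov integral, up to a constant that depends on [p] alone: the
    powers of [dyadic k] from the weight and from the area of the squares cancel.
    The step has length at most [dyadic k / 2]. *)
Lemma shell_step p f e r (J : R) k : 1 < p -> holomorphic f -> normc e = 1 ->
  0 <= r < 1 -> (\int[mu2]_(w in shell k) (density p f w)%:E <= J%:E)%E ->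
  normc (f ((ladder r k.+1)%:C * e) - f ((ladder r k)%:C * e)) `^ p
    <= shell_const p * J.
Proof.
move=> p1 hf e1 /andP[r0 r1] hJ.
have J0 : 0 <= J.
  by rewrite -lee_fin; apply: le_trans hJ; apply: integral_ge0 => w _; rewrite lee_fin density_ge0.
have t0 : 0 < dyadic k by exact: dyadic_gt0.
have tS := dyadicS k.
have CJ : 0 <= shell_const p * J by rewrite mulr_ge0 ?shell_const_ge0.
have [rk|kr] := leP r (1 - dyadic k).
  rewrite /ladder (min_l rk) min_l; last by lra.
  by rewrite subrr normc0 powR0 // gt_eqF //; lra.
have -> : ladder r k = 1 - dyadic k by rewrite /ladder min_r // ltW.
set s := ladder r k.+1.
have s1 : 1 - dyadic k <= s <= 1 - dyadic k / 2.
  by rewrite /s /ladder le_min ge_min; apply/andP; split; [apply/andP; split; lra|apply/orP; right; lra].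
have sr : s <= r by rewrite /s /ladder ge_min lexx.
have k1 : dyadic k <= 1 by rewrite /dyadic invf_le1 ?exprn_gt0 // exprn_ege1 // ler1n.
pose t := dyadic k; rewrite -/t in s1 t0 k1 *.
(* A bound of [|f'|] on the whole step. *)
pose M := (shell_const p * J / t `^ p) `^ p^-1.
have tp : 0 < t `^ p by rewrite powR_gt0.
have p0 : 0 < p by lra.
have X0 : 0 <= shell_const p * J / t `^ p by rewrite divr_ge0 // ltW.
have Mp : M `^ p = shell_const p * J / t `^ p.
  by rewrite /M -powRrM mulVf ?gt_eqF // powRr1.
have M0 : 0 <= M by exact: powR_ge0.
have hpath (tau : R) : 0 <= tau <= 1 -> exists2 sg : R, 1 - t <= sg <= s &
    (1 - t)%:C * e + tau%:C * (s%:C * e - (1 - t)%:C * e) = sg%:C * e.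
  move=> /andP[u0 u1]; exists (1 - t + tau * (s - (1 - t))).
    by case/andP: s1 => h1 h2; apply/andP; split; nra.
  by rewrite !(rmorphD, rmorphM, rmorphB, rmorphN); ring.
have mv : normc (f (s%:C * e) - f ((1 - t)%:C * e)) <=
    2 * (M * normc (s%:C * e - (1 - t)%:C * e)).
  apply: (@mean_value_ineq _ f (cderive f)) => tau /hpath[sg sgI ->].
    apply: hol_cdiff => //; rewrite /unit_disk /= normc_mulr_real e1 mulr1.
    by rewrite ger0_norm; lra.
  have sg0 : 0 <= sg by lra.
  have sgI' : 1 - dyadic k <= sg <= 1 - dyadic k / 2 by rewrite -/t; lra.
  have := shell_deriv p1 hf e1 sg0 sgI' hJ; rewrite -/t -Mp => h.
  rewrite leNgt; apply/negP => hlt; move: h; rewrite leNgt => /negP; apply.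
  by apply: gt0_ltr_powR; rewrite ?nnegrE ?normc_ge0.
have -> : shell_const p * J = (M * t) `^ p.
  by rewrite (powRM _ M0 (ltW t0)) Mp divfK // gt_eqF.
apply: ge0_ler_powR; rewrite ?nnegrE ?normc_ge0 ?mulr_ge0 ?(ltW t0) ?(ltW p0) //.
apply: (le_trans mv); rewrite -mulrBl -rmorphB normc_mulr_real e1 mulr1 ger0_norm; last by lra.
by nra.
Qed.

Lemma telescoping_sum (K J : nat -> R) (I : R) N :
  (forall k, 0 <= K k <= I) -> (forall k, J k + K (k + 4)%N <= K k) ->
  \sum_(k < N) J k <= 4 * I.
Proof.
move=> hK hJ.
have H : \sum_(k < N) J k + (K N + K (N + 1)%N + K (N + 2)%N + K (N + 3)%N) <=
    K 0%N + K 1%N + K 2%N + K 3%N.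
  elim: N => [|N IH]; first by rewrite big_ord0 add0r !add0n.
  rewrite big_ord_recr /=; have := hJ N.
  have -> : (N.+1 + 1 = N + 2)%N by rewrite addSnnS.
  have -> : (N.+1 + 2 = N + 3)%N by rewrite addSnnS.
  have -> : (N.+1 + 3 = N + 4)%N by rewrite addSnnS.
  have -> : K N.+1 = K (N + 1)%N by rewrite addn1.
  lra.
have a0 := hK N; have a1 := hK (N + 1)%N; have a2 := hK (N + 2)%N; have a3 := hK (N + 3)%N.
have b0 := hK 0%N; have b1 := hK 1%N; have b2 := hK 2%N; have b3 := hK 3%N.
by lra.
Qed.

Lemma shells_sum p f N : holomorphic f -> (besov_integral p f < +oo)%E ->
  exists J : nat -> R,
   (forall k, (\int[mu2]_(w in shell k) (density p f w)%:E <= (J k)%:E)%E) /\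
   \sum_(k < N) J k <= 4 * fine (besov_integral p f).
Proof.
move=> hf; rewrite besov_integralE => Ifin.
have md := density_measurable p hf.
have d0 w : (0 <= (density p f w)%:E)%E by rewrite lee_fin density_ge0.
have mdA A : A `<=` disk2 -> measurable_fun A (fun w => (density p f w)%:E).
  by move=> AD; apply/measurable_EFinP; exact: measurable_funS disk2_measurable AD md.
have leI A : measurable A -> A `<=` disk2 ->
    (\int[mu2]_(w in A) (density p f w)%:E <= \int[mu2]_(w in disk2) (density p f w)%:E)%E.
  by move=> mA AD; apply: ge0_subset_integral => //; [exact: disk2_measurable|exact: mdA].
have fin A : measurable A -> A `<=` disk2 ->
    (\int[mu2]_(w in A) (density p f w)%:E)%E \is a fin_num.
  move=> mA AD; rewrite ge0_fin_numE; last exact: integral_ge0.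
  exact: le_lt_trans (leI A mA AD) Ifin.
have finI := fin disk2 disk2_measurable (@subset_refl _ _).
pose J k := fine (\int[mu2]_(w in shell k) (density p f w)%:E)%E.
pose K k := fine (\int[mu2]_(w in collar k) (density p f w)%:E)%E.
have shD k : shell k `<=` disk2 by exact: subIsetl.
have coD k : collar k `<=` disk2 by exact: subIsetl.
exists J; split.
  by move=> k; rewrite /J fineK //; apply: fin => //; exact: shell_measurable.
apply: (@telescoping_sum K J) => k.
  apply/andP; split; first by apply: fine_ge0; exact: integral_ge0.
  apply: fine_le; [apply: fin => //; exact: collar_measurable|exact: finI|].
  by apply: leI => //; exact: collar_measurable.
rewrite -lee_fin EFinD /J /K !fineK; try (apply: fin => //; (exact: shell_measurable || exact: collar_measurable)).
rewrite -ge0_integral_setU //; [|exact: shell_measurable|exact: collar_measurable| |].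
- apply: ge0_subset_integral => //; [|exact: collar_measurable|exact: mdA|].
    by apply: measurableU; [exact: shell_measurable|exact: collar_measurable].
  have t1 := dyadic_gt0 (k + 4); have tk := dyadic_gt0 k.
  have t4 : dyadic k = 16 * dyadic (k + 4).
    by rewrite /dyadic exprD invfM; field; rewrite gt_eqF // exprn_gt0.
  move=> w [[wD]|[wD]]; rewrite /= !in_itv /= => hw; split=> //; rewrite /= in_itv /=; lra.
- by apply: mdA => w [[]|[]].
- have t1 := dyadic_gt0 (k + 4); have tk := dyadic_gt0 k.
  have t4 : dyadic k = 16 * dyadic (k + 4).
    by rewrite /dyadic exprD invfM; field; rewrite gt_eqF // exprn_gt0.
  apply/disj_setPS => w [[_ h1] [_ h2]]; move: h1 h2; rewrite /= !in_itv /=.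
  by move: (Num.sqrt _) => x; lra.
Qed.

End DyadicChain.

(** * Growth of Besov functions *)

Section GrowthBound.
Context {R : realType}.
Local Notation mu := (@lebesgue_measure R).
Local Notation mu2 := (mu \x mu)%E.
Implicit Types (f g : R[i] -> R[i]) (z e : R[i]) (r p : R) (k N : nat).

Definition logw z : R := ln (2 / (1 - normc z ^+ 2)).

Lemma ln2_gt0 : 0 < ln 2 :> R.
Proof. by rewrite ln_gt0 // ltr1n. Qed.

Lemma disk_sqr z : unit_disk z -> 0 < 1 - normc z ^+ 2 <= 1.
Proof.
rewrite /unit_disk /= => zD; have z0 := normc_ge0 z.
by apply/andP; split; nra.
Qed.

Lemma ln2_le_logw z : unit_disk z -> ln 2 <= logw z.
Proof.
move=> /disk_sqr /andP[h0 h1]; rewrite /logw ler_ln ?posrE ?divr_gt0 //.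
by rewrite ler_pdivlMr //; lra.
Qed.

(** The least [N] with [2 ^- N <= 1 - |z|] is of the order of [logw z]. *)
Lemma ladder_length z : unit_disk z -> exists N, ladder (normc z) N = normc z /\
  N%:R <= 2 / ln 2 * logw z.
Proof.
move=> zD; have zD' : normc z < 1 := zD; have z0 := normc_ge0 z.
have d0 : 0 < 1 - normc z by lra.
have exN : exists n, dyadic n <= 1 - normc z.
  have [n hn] := exists_pow2 1 d0; exists n.
  by rewrite /dyadic -[leLHS]mul1r ler_pdivrMr ?exprn_gt0 // ltW.
have [N hN minN] := ex_minnP exN; exists N; split.
  by rewrite /ladder min_l //; lra.
have l2 := ln2_gt0.
rewrite mulrAC ler_pdivlMr //.
have L2 := ln2_le_logw zD.
case: N hN minN => [|N] hN minN; first by rewrite mul0r mulr_ge0 //; lra.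
have hN' : 1 - normc z < dyadic N.
  by rewrite ltNge; apply/negP => /minN; rewrite ltnn.
have [sq0 sq1] := andP (disk_sqr zD).
have : ln (2 ^+ N) <= logw z.
  rewrite /logw ler_ln ?posrE ?exprn_gt0 ?divr_gt0 // ler_pdivlMr //.
  have p2 : 0 < 2 ^+ N :> R by rewrite exprn_gt0.
  have : 2 ^+ N * (1 - normc z) <= 1.
    by move: hN'; rewrite /dyadic -[ltRHS]mul1r ltr_pdivlMr // mulrC => /ltW.
  by nra.
rewrite lnXn // => h; rewrite -natr1 mulrDl mul1r.
by rewrite mulr_natl; lra.
Qed.

Definition diff_const p : R := 2 `^ p * (2 / ln 2) `^ (p - 1) * (shell_const p * 4).

(** The increment along the radius is a sum of [N] steps whose p-th powers add up to
    at most a multiple of the Besov integral; Hoelder's inequality contributes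
    [N ^ (p - 1)], and [N] is of the order of the logarithm. *)
Lemma growth_diff p f z : 1 < p -> holomorphic f -> (besov_integral p f < +oo)%E ->
  unit_disk z ->
  normc (f z - f 0) `^ p <= diff_const p * logw z `^ (p - 1) * fine (besov_integral p f).
Proof.
move=> p1 hf Ifin zD; have zD' : normc z < 1 := zD; have z0 := normc_ge0 z.
have [e e1 ze] : exists2 e : R[i], normc e = 1 & z = (normc z)%:C * e.
  have [->|zn0] := eqVneq z 0.
    by exists 1; rewrite ?normc1 // normc0 mul0r.
  have nz : normc z != 0 by rewrite gt_eqF // normc_gt0.
  exists (z / (normc z)%:C).
    by rewrite normcM normcV normc_real ger0_norm // divff.
  rewrite mulrCA divff ?mulr1 //; apply: contra nz => /eqP h.
  by apply/eqP; case: h.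
have [N [lN hN]] := ladder_length zD.
have [J [hJ sJ]] := shells_sum N hf Ifin.
pose x k := normc (f ((ladder (normc z) k.+1)%:C * e) - f ((ladder (normc z) k)%:C * e)).
have x0 k : 0 <= x k by exact: normc_ge0.
have r01 : 0 <= normc z < 1 by rewrite z0.
have xJ k : x k `^ p <= shell_const p * J k by apply: (@shell_step _ p f e (normc z) (J k)).
have tri n : normc (f ((ladder (normc z) n)%:C * e) - f 0) <= \sum_(k < n) x k.
  elim: n => [|n IH].
    by rewrite big_ord0 /ladder dyadic0 subrr min_r // mul0r subrr normc0.
  rewrite big_ord_recr /=.
  have tri3 (a b c : R[i]) : normc (a - c) <= normc (b - c) + normc (a - b).
    by have := normcD (b - c) (a - b); rewrite (_ : _ + (a - b) = a - c); [|ring].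
  by apply: (le_trans (tri3 _ (f ((ladder (normc z) n)%:C * e)) _)); rewrite lerD.
have I0 : 0 <= fine (besov_integral p f).
  by apply: fine_ge0; rewrite besov_integralE; apply: integral_ge0 => w _; rewrite lee_fin density_ge0.
have C0 := shell_const_ge0 p.
have sx : \sum_(k < N) x k `^ p <= shell_const p * 4 * fine (besov_integral p f).
  apply: (@le_trans _ _ (\sum_(k < N) shell_const p * J k)).
    by apply: ler_sum => k _; exact: xJ.
  by rewrite -mulr_sumr -mulrA; exact: ler_wpM2l.
have Sp := powR_sum_bound p1 x0 sx.
have p0 : 0 <= p by lra.
have p10 : 0 <= p - 1 by lra.
apply: (@le_trans _ _ ((\sum_(k < N) x k) `^ p)).
  apply: ge0_ler_powR; rewrite ?nnegrE ?normc_ge0 ?sumr_ge0 //.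
  by rewrite {1}ze -{1}lN; exact: tri.
apply: (le_trans Sp).
have l2 := ln2_gt0; have L2 := ln2_le_logw zD.
have NL : N%:R `^ (p - 1) <= (2 / ln 2) `^ (p - 1) * logw z `^ (p - 1).
  have q0 : 0 <= 2 / ln 2 :> R by rewrite divr_ge0 // ltW.
  have L0 : 0 <= logw z by lra.
  rewrite -powRM //.
  apply: ge0_ler_powR => //; rewrite ?nnegrE ?ler0n //.
  exact: mulr_ge0.
rewrite /diff_const.
set u := N%:R `^ (p - 1) in NL *; set v := (2 / ln 2) `^ (p - 1) in NL *.
set l := logw z `^ (p - 1) in NL *; set c := shell_const p in C0 *.
set i := fine _ in I0 *.
have -> : 2 `^ p * v * (c * 4) * l * i = 2 `^ p * (c * 4 * i) * (v * l) by ring.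
have -> : 2 `^ p * u * (c * 4 * i) = 2 `^ p * (c * 4 * i) * u by ring.
by apply: ler_wpM2l => //; rewrite !mulr_ge0 ?powR_ge0.
Qed.

Lemma besov_integral_ge0 p f : (0 <= besov_integral p f)%E.
Proof.
by rewrite besov_integralE; apply: integral_ge0 => w _; rewrite lee_fin density_ge0.
Qed.

Lemma besov_norm_ge0 p f : 0 <= besov_norm p f.
Proof. by rewrite addr_ge0 ?normc_ge0 ?powR_ge0. Qed.

Lemma besov_integral_le_norm p f : 1 < p ->
  fine (besov_integral p f) <= besov_norm p f `^ p.
Proof.
move=> p1; have I0 : 0 <= fine (besov_integral p f) by rewrite fine_ge0 ?besov_integral_ge0.
have p0 : 0 < p by lra.
rewrite -{1}[fine _]powRr1 // -(mulVf (lt0r_neq0 p0)) powRrM.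
apply: ge0_ler_powR; rewrite ?nnegrE ?powR_ge0 ?besov_norm_ge0 ?(ltW p0) //.
by rewrite /besov_norm lerDr normc_ge0.
Qed.

Lemma normc0_le_norm p f : normc (f 0) <= besov_norm p f.
Proof. by rewrite /besov_norm lerDl powR_ge0. Qed.

(** The sharp growth of Besov functions: its power [p - 1] of the logarithm is the
    one in the integrability condition on the symbol. The lower bound [ln 2] of
    [logw] lets the same form absorb the value at the origin. *)
Lemma besov_growth p : 1 < p -> exists2 C : R, 0 <= C & forall f z,
  besov p f -> unit_disk z ->
  normc (f z) `^ p <= C * logw z `^ (p - 1) * besov_norm p f `^ p.
Proof.
move=> p1; have l2 := ln2_gt0.
have D0 : 0 <= diff_const p.
  by rewrite !mulr_ge0 ?powR_ge0 ?shell_const_ge0.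
have l2p : 0 < ln 2 `^ (p - 1) :> R by rewrite powR_gt0.
exists (2 `^ p * (diff_const p + (ln 2 `^ (p - 1))^-1)).
  by rewrite mulr_ge0 ?powR_ge0 // addr_ge0 // invr_ge0 ltW.
move=> f z [hf _ Ifin] zD.
have gd := growth_diff p1 hf Ifin zD.
have p0 : 0 <= p by lra.
have L2 := ln2_le_logw zD.
have Lp : ln 2 `^ (p - 1) <= logw z `^ (p - 1).
  by apply: ge0_ler_powR; rewrite ?nnegrE; lra.
apply: (@le_trans _ _ ((normc (f z - f 0) + normc (f 0)) `^ p)).
  apply: ge0_ler_powR; rewrite ?nnegrE ?addr_ge0 ?normc_ge0 //.
  by have := normcD (f z - f 0) (f 0); rewrite subrK.
apply: (le_trans (powRD_le (normc_ge0 _) (normc_ge0 _) p1)).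
rewrite -!mulrA; apply: ler_wpM2l; first exact: powR_ge0.
rewrite mulrDl; apply: lerD.
  apply: (le_trans gd); rewrite -mulrA; apply: ler_wpM2l => //.
  by apply: ler_wpM2l; rewrite ?powR_ge0 ?besov_integral_le_norm.
have n0 : normc (f 0) `^ p <= besov_norm p f `^ p.
  by apply: ge0_ler_powR; rewrite ?nnegrE ?normc_ge0 ?besov_norm_ge0 ?normc0_le_norm.
apply: (le_trans n0); rewrite mulrA -[leLHS]mul1r.
apply: ler_wpM2r; first exact: powR_ge0.
by rewrite ler_pdivlMl // mulr1.
Qed.

Lemma point_evaluation p z : 1 < p -> unit_disk z -> exists2 C : R, 0 <= C &
  forall f, besov p f -> normc (f z) <= C * besov_norm p f.
Proof.
move=> p1 zD; have [C C0 hC] := besov_growth p1.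
have p0 : 0 < p by lra.
have X0 : 0 <= C * logw z `^ (p - 1) by rewrite mulr_ge0 ?powR_ge0.
exists ((C * logw z `^ (p - 1)) `^ p^-1); first exact: powR_ge0.
move=> f fB; rewrite leNgt; apply/negP => hlt.
have := hC f z fB zD; rewrite leNgt => /negP; apply.
have -> : C * logw z `^ (p - 1) * besov_norm p f `^ p =
   ((C * logw z `^ (p - 1)) `^ p^-1 * besov_norm p f) `^ p.
  by rewrite powRM ?powR_ge0 ?besov_norm_ge0 // -powRrM mulVf ?gt_eqF // powRr1.
by apply: gt0_ltr_powR; rewrite ?nnegrE ?mulr_ge0 ?powR_ge0 ?besov_norm_ge0 ?normc_ge0.
Qed.

(** * The Besov space as a normed space *)

Lemma cdiff_density_le p f (d : R[i]) (w : R * R) (M : R) : 0 <= p ->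
  cdiff f (w.1 +i* w.2) d -> normc d <= M ->
  density p f w <= M `^ p * weight (p - 2) w.
Proof.
move=> p0 /cdiff_cderive df dM; rewrite /density df.
apply: ler_wpM2r; first exact: weight_ge0.
by apply: ge0_ler_powR; rewrite ?nnegrE ?normc_ge0 // (le_trans _ dM) ?normc_ge0.
Qed.

Lemma ge0_integral_le2 (u v h : R * R -> R) (a b : R) :
  measurable_fun disk2 u -> measurable_fun disk2 v -> measurable_fun disk2 h ->
  (forall w, 0 <= u w) -> (forall w, 0 <= v w) -> (forall w, 0 <= h w) ->
  0 <= a -> 0 <= b -> (forall w, disk2 w -> h w <= a * u w + b * v w) ->
  (\int[mu2]_(w in disk2) (h w)%:E <=
    a%:E * \int[mu2]_(w in disk2) (u w)%:E + b%:E * \int[mu2]_(w in disk2) (v w)%:E)%E.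
Proof.
move=> /measurable_EFinP mu_ /measurable_EFinP mv /measurable_EFinP mh u0 v0 h0 a0 b0 huv.
have mD := @disk2_measurable R.
have mm F (c : R) : measurable_fun disk2 (fun w : R * R => (F w)%:E) ->
    measurable_fun disk2 (fun w => c%:E * (F w)%:E)%E.
  by move=> mF; apply: emeasurable_funM => //; exact: measurable_cst.
rewrite -!ge0_integralZl_EFin //; [|by move=> w _; rewrite lee_fin|by move=> w _; rewrite lee_fin].
rewrite -ge0_integralD //; [|by move=> w _; rewrite mule_ge0 ?lee_fin|exact: mm|by move=> w _; rewrite mule_ge0 ?lee_fin|exact: mm].
apply: ge0_le_integral => //.
- by move=> w _; rewrite lee_fin.
- by apply: emeasurable_funD; exact: mm.
Qed.

Lemma besov_integral_le2 p f g h (a b : R) : 1 < p -> holomorphic f -> holomorphic g ->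
  holomorphic h -> 0 <= a -> 0 <= b ->
  (forall w, disk2 w -> density p h w <= a * density p f w + b * density p g w) ->
  (besov_integral p h <= a%:E * besov_integral p f + b%:E * besov_integral p g)%E.
Proof.
move=> p1 hf hg hh a0 b0 le_d; rewrite !besov_integralE.
apply: ge0_integral_le2 => //; try exact: density_measurable.
all: by move=> w; exact: density_ge0.
Qed.

Lemma besovD p f g : 1 < p -> besov p f -> besov p g -> besov p (fun z => f z + g z).
Proof.
move=> p1 [hf f0 If] [hg g0 Ig].
have hfg : holomorphic (fun z => f z + g z).
  apply: cdiff_hol => z zD; exists (cderive f z + cderive g z).
  by apply: cdiffD; exact: hol_cdiff.
have t0 : 0 <= 2 `^ p :> R by exact: powR_ge0.
split; [exact: hfg|by move=> z zD; rewrite f0 // g0 // addr0|].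
have := @besov_integral_le2 p f g _ (2 `^ p) (2 `^ p) p1 hf hg hfg t0 t0.
move=> H; apply: (le_lt_trans (H _)).
  move=> w wD; have dfg := cdiffD (hol_cdiff hf wD) (hol_cdiff hg wD).
  apply: (le_trans (cdiff_density_le _ dfg (normcD _ _))); first by lra.
  rewrite /density -mulrDr -mulrDl mulrA; apply: ler_wpM2r; first exact: weight_ge0.
  by apply: powRD_le; rewrite ?normc_ge0.
have t0E : (0 <= (2 `^ p)%:E :> \bar R)%E by rewrite lee_fin.
apply: lte_add_pinfty; apply: (lte_mul_pinfty t0E isT).
- exact: If.
- exact: Ig.
Qed.

Lemma besov_integralZ p (c : R[i]) f : 1 < p -> holomorphic f ->
  besov_integral p (fun z => c * f z) = ((normc c `^ p)%:E * besov_integral p f)%E.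
Proof.
move=> p1 hf; rewrite !besov_integralE.
rewrite -ge0_integralZl_EFin ?powR_ge0 //; last 3 first.
- exact: disk2_measurable.
- by move=> w _; rewrite lee_fin density_ge0.
- by apply/measurable_EFinP; exact: density_measurable.
apply: eq_integral => w; rewrite inE => wD; rewrite -EFinM; congr EFin.
have dcf := cdiffM (cdiff_cst c (w.1 +i* w.2)) (hol_cdiff hf wD).
rewrite /density (cdiff_cderive dcf) mul0r add0r normcM powRM ?normc_ge0 //.
by rewrite mulrA.
Qed.

Lemma besovZ p (c : R[i]) f : 1 < p -> besov p f -> besov p (fun z => c * f z).
Proof.
move=> p1 [hf f0 If]; split.
- apply: cdiff_hol => z zD; exists (0 * f z + c * cderive f z).
  by apply: cdiffM; [exact: cdiff_cst|exact: hol_cdiff].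
- by move=> z zD; rewrite f0 // mulr0.
- have cE : (0 <= (normc c `^ p)%:E :> \bar R)%E by rewrite lee_fin powR_ge0.
  rewrite (besov_integralZ c p1 hf); apply: (lte_mul_pinfty cE isT).
  exact: If.
Qed.

Lemma besov_normZ p (c : R[i]) f : 1 < p -> besov p f ->
  besov_norm p (fun z => c * f z) = normc c * besov_norm p f.
Proof.
move=> p1 [hf f0 If]; rewrite /besov_norm besov_integralZ // normcM mulrDr.
congr (_ + _); rewrite fineM //; last by rewrite ge0_fin_numE ?besov_integral_ge0.
have p0 : 0 < p by lra.
rewrite powRM ?powR_ge0 ?fine_ge0 ?besov_integral_ge0 //=.
by rewrite -powRrM divff ?gt_eqF // powRr1 ?normc_ge0.
Qed.

(** The constant function 1 in the Besov space, where functions vanish off the disk. *)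
Definition disk_one : R[i] -> R[i] := fun z => if `[< unit_disk z >] then 1 else 0.

Lemma disk_oneE z : unit_disk z -> disk_one z = 1.
Proof. by move=> zD; rewrite /disk_one asboolT. Qed.

Lemma disk_one_cdiff z : unit_disk z -> cdiff disk_one z 0.
Proof.
move=> zD; have r0 : 0 < 1 - normc z by rewrite subr_gt0.
apply: (cdiff_local (F := fun=> 1) r0); last exact: cdiff_cst.
move=> h hr; rewrite disk_oneE //; apply: (@unit_disk_ball _ z).
by rewrite addrAC subrr add0r.
Qed.

Lemma disk_one_integral p : 1 < p -> besov_integral p disk_one = 0%E.
Proof.
move=> p1; rewrite besov_integralE; apply: integral0_eq => w wD.
rewrite /density (cdiff_cderive (disk_one_cdiff wD)) normc0 powR0 ?mul0r //.
by rewrite gt_eqF //; lra.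
Qed.

Lemma besov_one p : 1 < p -> besov p disk_one.
Proof.
move=> p1; split; last by rewrite disk_one_integral.
  by apply: cdiff_hol => z zD; exists 0; exact: disk_one_cdiff.
by move=> z zD; rewrite /disk_one asboolF.
Qed.

Lemma unit_disk0 : unit_disk (0 : R[i]).
Proof. by change (normc (0 : R[i]) < 1); rewrite normc0 ltr01. Qed.

Lemma besov_norm_one p : 1 < p -> besov_norm p disk_one = 1.
Proof.
move=> p1; rewrite /besov_norm disk_one_integral // disk_oneE; last exact: unit_disk0.
by rewrite normc1 powR0 ?addr0 // invr_eq0 gt_eqF //; lra.
Qed.

End GrowthBound.

(** * Cesaro means of a multiplication operator *)

Section CesaroMeans.
Context {R : realType}.
Local Notation mu := (@lebesgue_measure R).
Local Notation mu2 := (mu \x mu)%E.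
Implicit Types (f g psi : R[i] -> R[i]) (z x d : R[i]) (p : R) (n m : nat).

Lemma ereal_cvg0P (u : nat -> \bar R) : (forall n, 0 <= u n)%E ->
  u n @[n --> \oo] --> 0%E <->
  forall e : R, 0 < e -> exists n0, forall n, (n0 <= n)%N -> (u n <= e%:E)%E.
Proof.
move=> u0; split => [/fine_cvgP[ufin ucvg] e e0|h].
  move/cvgrPdist_le : ucvg => /(_ _ e0) ucvg.
  have [n0 _ hn0] := filterI ufin ucvg.
  exists n0 => n /hn0 [/= fu]; rewrite sub0r normrN => ue.
  by rewrite -(fineK fu) lee_fin; exact: le_trans (ler_norm _) ue.
apply/fine_cvgP; split.
  have [n0 hn0] := h 1 ltr01; exists n0 => // n /hn0 un.
  by rewrite /= ge0_fin_numE //; exact: le_lt_trans un (ltry _).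
apply/cvgrPdist_le => e e0; have [n0 hn0] := h e e0.
exists n0 => // n /hn0 un; rewrite /= sub0r normrN ger0_norm ?fine_ge0 //.
rewrite -lee_fin fineK // ge0_fin_numE //; exact: le_lt_trans un (ltry _).
Qed.

Lemma eventually_inv (M e : R) : 0 <= M -> 0 < e ->
  exists n0, forall n, (n0 <= n)%N -> M * n%:R^-1 <= e.
Proof.
move=> M0 e0; exists (Num.bound (M / e)).+1 => n hn.
have n0 : 0 < n%:R :> R by rewrite ltr0n; exact: leq_trans hn.
have h : M / e < (Num.bound (M / e))%:R by apply: archi_boundP; rewrite divr_ge0 // ltW.
rewrite ler_pdivrMr // mulrC -ler_pdivrMr //; apply: (le_trans (ltW h)).
by rewrite ler_nat; exact: ltnW.
Qed.

Lemma eventually_pow (x e : R) : 0 <= x < 1 -> 0 < e ->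
  exists n0, forall n, (n0 <= n)%N -> x ^+ n <= e.
Proof.
move=> /andP[x0 x1] e0.
have hx : `|x| < 1 by rewrite ger0_norm.
have /cvgrPdist_le/(_ _ e0)[n0 _ hn0] := cvg_expr hx.
by exists n0 => n /hn0 /=; rewrite sub0r normrN ger0_norm // exprn_ge0.
Qed.

(** The n-th Cesaro mean of multiplication by [psi] is multiplication by
    [mean_poly n psi]. *)
Definition mean_poly n x : R[i] := n%:R^-1 * \sum_(1 <= m < n.+1) x ^+ m.

Lemma mean_polyE n x : (1 - x) * mean_poly n x = n%:R^-1 * (x - x ^+ n.+1).
Proof.
rewrite /mean_poly mulrCA; congr (_ * _).
elim: n => [|n IH]; first by rewrite big_geq // mulr0 expr1 subrr.
by rewrite big_nat_recr //= mulrDr IH [x ^+ n.+2]exprS; ring.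
Qed.

Lemma normc_natV n : normc (n%:R^-1 : R[i]) = n%:R^-1.
Proof. by rewrite normcV normcMn normc1. Qed.

Lemma iter_multiplication psi m f z :
  iter m (multiplication psi) f z = psi z ^+ m * f z.
Proof.
elim: m => [|m IH]; first by rewrite expr0 mul1r.
by rewrite iterS /multiplication IH exprS mulrA.
Qed.

Lemma cesaro_multiplication psi n f :
  cesaro_mean (multiplication psi) n f = (fun z => mean_poly n (psi z) * f z).
Proof.
apply/funext => z; rewrite /cesaro_mean /mean_poly.
have -> : forall (c : R[i]) (F : R[i] -> R[i]), (c *: F) z = c * F z by [].
rewrite fct_sumE -mulrA mulr_suml; congr (_ * _).
by apply: eq_bigr => m _; exact: iter_multiplication.
Qed.

Lemma cdiffX psi z d n : cdiff psi z d ->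
  cdiff (fun x => psi x ^+ n.+1) z (n.+1%:R * psi z ^+ n * d).
Proof.
move=> dpsi; elim: n => [|n IH].
  rewrite mul1r expr0 mul1r; under [X in cdiff X]eq_fun do rewrite expr1.
  exact: dpsi.
have -> : n.+2%:R * psi z ^+ n.+1 * d =
    d * psi z ^+ n.+1 + psi z * (n.+1%:R * psi z ^+ n * d).
  by rewrite -[n.+2%:R]natr1 exprS; ring.
under [X in cdiff X]eq_fun do rewrite exprS.
exact: (cdiffM dpsi IH).
Qed.

Lemma sup_norm_le psi (M : R) : (sup_norm psi <= M%:E)%E <->
  forall z, unit_disk z -> normc (psi z) <= M.
Proof.
split => [h z zD|h].
  rewrite -lee_fin; apply: le_trans h; apply: ereal_sup_ubound.
  by exists z.
by apply: ge_ereal_sup => _ [z zD <-]; rewrite lee_fin; exact: h.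
Qed.

(** Interior contact with the unit circle forces a critical point: otherwise the
    linear part of [psi] could move the value radially outwards. *)
Lemma contact_critical psi z d : unit_disk z -> cdiff psi z d ->
  (forall w, unit_disk w -> normc (psi w) <= 1) -> normc (psi z) = 1 -> d = 0.
Proof.
move=> zD dpsi psi1 pz1; apply/eqP; rewrite -[_ == _]negbK; apply/negP => d0.
have nd : 0 < normc d by rewrite normc_gt0.
have nd2 : 0 < normc d / 2 by rewrite divr_gt0.
have [a a0 ha] := dpsi _ nd2.
have r0 : 0 < 1 - normc z by rewrite subr_gt0.
(* Half of the largest step that stays in the disk and in the range of the estimate. *)
pose s := Num.min a (1 - normc z) * normc d / 2.
have m0 : 0 < Num.min a (1 - normc z) by rewrite lt_min a0.
have s0 : 0 < s by rewrite /s divr_gt0 // mulr_gt0.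
(* Chosen so that [d * h] is a positive multiple of [psi z]. *)
pose h := s%:C * psi z / d.
have nh : normc h = s / normc d.
  by rewrite /h !normcM normcV normc_real pz1 mulr1 gtr0_norm.
have hm : normc h < Num.min a (1 - normc z).
  by rewrite nh ltr_pdivrMr // /s; nra.
have [h1 h2] : normc h < a /\ normc h < 1 - normc z.
  by move: hm; rewrite lt_min => /andP.
have hD : unit_disk (z + h) by apply: (@unit_disk_ball _ z); rewrite addrAC subrr add0r.
have := ha h h1; rewrite nh.
have -> : d * h = s%:C * psi z by rewrite /h; field.
have e1 : normc (psi z + s%:C * psi z) = 1 + s.
  have -> : psi z + s%:C * psi z = (1 + s)%:C * psi z by rewrite rmorphD /=; ring.
  by rewrite normc_mulr_real pz1 mulr1 gtr0_norm //; lra.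
have := normcB (psi (z + h)) (psi (z + h) - psi z - s%:C * psi z).
have -> : psi (z + h) - (psi (z + h) - psi z - s%:C * psi z) = psi z + s%:C * psi z by ring.
have -> : normc d / 2 * (s / normc d) = s / 2 by field; rewrite gt_eqF.
have := psi1 _ hD; rewrite e1.
by move: (normc (psi (z + h))) (normc _) => u v; lra.
Qed.

Section mean_bounds.
Variables (psi : R[i] -> R[i]) (C : R).
Hypothesis psi1 : forall z, unit_disk z -> normc (psi z) <= 1.
Hypothesis psiC : forall z, unit_disk z -> 1 <= C * normc (1 - psi z).

Lemma inverse_const_ge0 : 0 <= C.
Proof using psiC.
have := psiC unit_disk0; have := normc_ge0 (1 - psi 0) => h1 h2.
by rewrite leNgt; apply/negP => h; nra.
Qed.

Lemma symbol_neq1 z : unit_disk z -> 1 - psi z != 0.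
Proof using psiC.
move=> /psiC h; rewrite -normc_gt0 lt0r normc_ge0 andbT.
by apply: contraTneq h => ->; rewrite mulr0 -ltNge ltr01.
Qed.

Lemma inverse_bound z : unit_disk z -> normc (1 - psi z)^-1 <= C.
Proof using psiC.
move=> zD; rewrite normcV -[leLHS]mul1r ler_pdivrMr ?normc_gt0 ?symbol_neq1 //.
exact: psiC.
Qed.

(** Growth of the derivative of [mean_poly n psi] relative to that of [psi]: a part
    that decays uniformly, and one that decays where [|psi| < 1] only. *)
Definition mean_rate n (t : R) : R :=
  (C + 2 * C ^+ 2) * n%:R^-1 + 2 * C * t ^+ n.

Lemma mean_polyV n z : unit_disk z ->
  mean_poly n (psi z) = n%:R^-1 * (psi z - psi z ^+ n.+1) * (1 - psi z)^-1.
Proof using psiC.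
move=> zD; have h := symbol_neq1 zD.
by rewrite -mean_polyE mulrAC divff // mul1r.
Qed.

Lemma mean_poly_bound n z : unit_disk z ->
  normc (mean_poly n (psi z)) <= 2 * C * n%:R^-1.
Proof using psi1 psiC.
move=> zD; rewrite mean_polyV // !normcM normc_natV.
have p1 := psi1 zD; have p0 := normc_ge0 (psi z).
have h1 : normc (psi z - psi z ^+ n.+1) <= 2.
  apply: (le_trans (normcB _ _)); rewrite normcX.
  by have := exprn_ile1 n.+1 p0 p1; lra.
have n0 : 0 <= n%:R^-1 :> R by rewrite invr_ge0 ler0n.
have h2 := inverse_bound zD.
rewrite -mulrA mulrC; apply: ler_wpM2r => //.
by apply: ler_pM; rewrite ?normc_ge0.
Qed.

(** Differentiate [(psi - psi ^ n.+1) / (n (1 - psi))]. The factor [n + 1] produced by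
    the power cancels the division by [n]; this is where the part of [mean_rate]
    without uniform decay comes from. *)
Lemma mean_poly_deriv n z d : unit_disk z -> cdiff psi z d -> (0 < n)%N ->
  exists2 d', cdiff (fun x => mean_poly n (psi x)) z d' &
    normc d' <= normc d * mean_rate n (normc (psi z)).
Proof using psi1 psiC.
move=> zD dpsi n_gt0; set u := psi z.
have r0 : 0 < 1 - normc z by rewrite subr_gt0.
have u1 : 1 - u != 0 by exact: symbol_neq1.
have dinv := cdiffV (F := fun x => 1 - psi x) u1 (cdiffB (cdiff_cst 1 z) dpsi).
have dnum := cdiffM (cdiff_cst n%:R^-1 z) (cdiffB dpsi (cdiffX n dpsi)).
have dF := cdiffM dnum dinv.
eexists.
  apply: (cdiff_local r0 _ dF) => h hr; rewrite mean_polyV //.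
  by apply: (@unit_disk_ball _ z); rewrite addrAC subrr add0r.
rewrite -/u.
have -> : (0 * (u - u ^+ n.+1) + n%:R^-1 * (d - n.+1%:R * u ^+ n * d)) / (1 - u)
    + n%:R^-1 * (u - u ^+ n.+1) * (- (0 - d) / (1 - u) ^+ 2)
  = d * (n%:R^-1 * ((1 - n.+1%:R * u ^+ n) * (1 - u)^-1
      + (u - u ^+ n.+1) * (1 - u)^-1 * (1 - u)^-1)).
  field; by rewrite u1 pnatr_eq0 -lt0n n_gt0.
rewrite normcM; apply: ler_wpM2l; first exact: normc_ge0.
rewrite normcM normc_natV.
have p1 : normc u <= 1 := psi1 zD; have p0 := normc_ge0 u.
have ib : normc (1 - u)^-1 <= C := inverse_bound zD.
have i0 := normc_ge0 (1 - u)^-1.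
have t0 : 0 <= normc u ^+ n by rewrite exprn_ge0.
have nn1 : 0 <= n.+1%:R :> R by exact: ler0n.
have b1 : normc ((1 - n.+1%:R * u ^+ n) * (1 - u)^-1) <= (1 + n.+1%:R * normc u ^+ n) * C.
  rewrite normcM; apply: ler_pM; rewrite ?normc_ge0 //.
  by apply: (le_trans (normcB _ _)); rewrite normc1 normcM normcMn normc1 normcX.
have b2 : normc ((u - u ^+ n.+1) * (1 - u)^-1 * (1 - u)^-1) <= 2 * C * C.
  rewrite !normcM; apply: ler_pM; rewrite ?mulr_ge0 ?normc_ge0 //.
  apply: ler_pM; rewrite ?normc_ge0 //.
  apply: (le_trans (normcB _ _)); rewrite normcX.
  by have := exprn_ile1 n.+1 p0 p1; lra.
have n0 : 0 < n%:R :> R by rewrite ltr0n.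
apply: (@le_trans _ _ (n%:R^-1 * ((1 + n.+1%:R * normc u ^+ n) * C + 2 * C * C))).
  apply: ler_wpM2l; first by rewrite invr_ge0 ltW.
  by apply: (le_trans (normcD _ _)); rewrite lerD.
have n1 : n.+1%:R <= 2 * n%:R :> R.
  by rewrite -natrM ler_nat mul2n -addnn -addn1 leq_add2l.
rewrite /mean_rate ler_pdivrMl // mulrDr mulrCA divff ?gt_eqF // mulr1.
have -> : n%:R * (2 * C * normc u ^+ n) = 2 * n%:R * (C * normc u ^+ n) by ring.
have : n.+1%:R * (C * normc u ^+ n) <= 2 * n%:R * (C * normc u ^+ n).
  by apply: ler_wpM2r => //; rewrite mulr_ge0 ?inverse_const_ge0.
by lra.
Qed.

End mean_bounds.

End CesaroMeans.

(** * Decay of the logarithmically weighted integrals *)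

Section Sufficiency.
Context {R : realType}.
Local Notation mu := (@lebesgue_measure R).
Local Notation mu2 := (mu \x mu)%E.
Implicit Types (f g : R[i] -> R[i]) (z x d : R[i]) (n m : nat).
Variables (p : R) (psi : R[i] -> R[i]) (C : R).
Hypothesis p1 : 1 < p.
Hypothesis psi_hol : holomorphic psi.
Hypothesis psi1 : forall z, unit_disk z -> normc (psi z) <= 1.
Hypothesis psiC : forall z, unit_disk z -> 1 <= C * normc (1 - psi z).

Definition log_density (w : R * R) : R :=
  (1 - normc (w.1 +i* w.2) ^+ 2) `^ (p - 2) * normc (cderive psi (w.1 +i* w.2)) `^ p
    * ln (2 / (1 - normc (w.1 +i* w.2) ^+ 2)) `^ (p - 1).

Hypothesis psi_log : (\int[mu2]_(w in disk2) (log_density w)%:E < +oo)%E.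

Lemma log_density_ge0 w : 0 <= log_density w.
Proof using. by rewrite !mulr_ge0 ?powR_ge0. Qed.

Lemma logw_measurable : measurable_fun disk2 (fun w : R * R => logw (w.1 +i* w.2)).
Proof using.
have mq : measurable_fun disk2 (fun w : R * R => 1 - normc (w.1 +i* w.2) ^+ 2).
  apply: measurable_funB; first exact: measurable_cst.
  by apply: measurable_funX; exact: normc_measurable.
apply: (eq_measurable_fun (fun w : R * R => ln 2 - ln (1 - normc (w.1 +i* w.2) ^+ 2))).
  move=> w; rewrite inE => /disk_sqr/andP[h _].
  by rewrite /logw ln_div ?posrE.
apply: measurable_funB; first exact: measurable_cst.
exact: measurableT_comp (@measurable_ln R) mq.
Qed.

Lemma log_density_measurable : measurable_fun disk2 log_density.
Proof using psi_hol.
apply: measurable_funM; first apply: measurable_funM.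
- exact: (weight_measurable (p - 2)).
- apply: (measurableT_comp (measurable_powR p)).
  exact: hol_measurable (cderive_hol psi_hol).
- exact: (measurableT_comp (measurable_powR (p - 1)) logw_measurable).
Qed.

Let rate n (w : R * R) : R := mean_rate C n (normc (psi (w.1 +i* w.2))).

Let C0 : 0 <= C := inverse_const_ge0 psiC.

Let A0 : 0 <= C + 2 * C ^+ 2.
Proof. by have := C0; nra. Qed.

Lemma rate_measurable n : measurable_fun disk2 (rate n).
Proof using psi_hol.
apply: measurable_funD; first exact: measurable_cst.
apply: measurable_funM; first exact: measurable_cst.
by apply: measurable_funX; exact: hol_measurable.
Qed.

Lemma rate_ge0 n w : 0 <= rate n w.
Proof using psiC.
have := C0; have := A0 => hA hC; rewrite addr_ge0 ?mulr_ge0 ?invr_ge0 ?ler0n ?exprn_ge0 ?normc_ge0 //.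
Qed.

Lemma rate_le n w : disk2 w -> rate n w <= C + 2 * C ^+ 2 + 2 * C.
Proof using psi1 psiC.
move=> wD; have := C0; have := A0 => hA hC; rewrite /rate /mean_rate; apply: lerD.
  rewrite -[leRHS]mulr1; apply: ler_wpM2l => //.
  by case: n => [|n]; rewrite ?invr0 ?ler01 // invf_le1 ?ltr0n // ler1n.
rewrite -[leRHS]mulr1; apply: ler_wpM2l; first by rewrite mulr_ge0.
by apply: exprn_ile1; [exact: normc_ge0|exact: psi1].
Qed.

Lemma eventually_rate w (e : R) : normc (psi (w.1 +i* w.2)) < 1 -> 0 < e ->
  exists n0, forall n, (n0 <= n)%N -> rate n w <= e.
Proof using psiC.
move=> h e0; have hC := C0; have hA := A0.
have e2 : 0 < e / 2 by lra.
have [n0 hn0] := eventually_inv hA e2.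
have e3 : 0 < e / 2 / (2 * C + 1) by rewrite divr_gt0 //; lra.
have t01 : 0 <= normc (psi (w.1 +i* w.2)) < 1 by rewrite normc_ge0.
have [n1 hn1] := eventually_pow t01 e3.
exists (maxn n0 n1) => n; rewrite geq_max => /andP[/hn0 h0 /hn1].
rewrite ler_pdivlMr; last by lra.
rewrite mulrDr mulr1 => h1.
have : 0 <= normc (psi (w.1 +i* w.2)) ^+ n by rewrite exprn_ge0 ?normc_ge0.
by rewrite /rate /mean_rate; move: h0 h1; move: (_ ^+ n) => t; lra.
Qed.

Definition rate_integral n : \bar R :=
  (\int[mu2]_(w in disk2) (log_density w * rate n w `^ p)%:E)%E.

Lemma rate_integrand_measurable n :
  measurable_fun disk2 (fun w => log_density w * rate n w `^ p).
Proof using psi_hol.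
apply: measurable_funM; first exact: log_density_measurable.
exact: (measurableT_comp (measurable_powR p) (rate_measurable n)).
Qed.

Lemma rate_integral_ge0 n : (0 <= rate_integral n)%E.
Proof using.
apply: integral_ge0 => w _.
by rewrite lee_fin mulr_ge0 ?powR_ge0 ?log_density_ge0.
Qed.

(** Where [|psi| < 1] the rate tends to 0; at the remaining points [psi] touches the
    unit circle, so [psi'] and with it the density vanish. *)
Lemma rate_pointwise (w : R * R) : disk2 w ->
  (log_density w * rate n w `^ p)%:E @[n --> \oo] --> 0%E.
Proof using p1 psi_hol psi1 psiC.
move=> wD; have base0 := log_density_ge0 w; have hp := p1.
apply/ereal_cvg0P; first by move=> n; rewrite lee_fin mulr_ge0 ?powR_ge0.
move=> e e0.
have := psi1 wD; rewrite le_eqVlt => /predU1P[contact|noncontact].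
  exists 0%N => n _; rewrite lee_fin /log_density.
  rewrite (contact_critical wD (hol_cdiff psi_hol wD) psi1 contact) normc0.
  by rewrite (@powR0 _ p) ?mulr0 ?mul0r ?(ltW e0) // gt_eqF //; lra.
pose eta := Num.min 1 (e / (log_density w + 1)).
have eta0 : 0 < eta by rewrite lt_min ltr01 divr_gt0 //; lra.
have [n0 hn0] := @eventually_rate w eta noncontact eta0.
exists n0 => n /hn0; rewrite le_min => /andP[r1 r2]; rewrite lee_fin.
have r0 := rate_ge0 n w.
have rp : rate n w `^ p <= rate n w.
  rewrite (powR_split r0 p1) ler_piMr //.
  have one : 1 `^ (p - 1) = 1 :> R by rewrite powR1.
  by rewrite -[leRHS]one; apply: ge0_ler_powR; rewrite ?nnegrE //; lra.
move: r2; rewrite ler_pdivlMr; last by lra.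
by nra.
Qed.

Lemma rate_dominated n (w : R * R) : disk2 w ->
  (`|(log_density w * rate n w `^ p)%:E|
    <= ((C + 2 * C ^+ 2 + 2 * C) `^ p * log_density w)%:E)%E.
Proof using p1 psi1 psiC.
move=> wD; have hp := p1.
rewrite gee0_abs ?lee_fin ?mulr_ge0 ?powR_ge0 ?log_density_ge0 //.
rewrite mulrC; apply: ler_wpM2r; first exact: log_density_ge0.
apply: ge0_ler_powR; rewrite ?nnegrE ?rate_ge0 ?rate_le //; first by lra.
by have := C0; have := A0; lra.
Qed.

Lemma rate_integral_cvg : rate_integral n @[n --> \oo] --> 0%E.
Proof using p1 psi_hol psi1 psiC psi_log.
have mD := @disk2_measurable R.
have hp := p1; have p0 : 0 <= p by lra.
pose M := (C + 2 * C ^+ 2 + 2 * C) `^ p.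
have M0 : 0 <= M by exact: powR_ge0.
have mb : measurable_fun disk2 (fun w => (log_density w)%:E).
  by apply/measurable_EFinP; exact: log_density_measurable.
have b0 w : (0 <= (log_density w)%:E)%E by rewrite lee_fin log_density_ge0.
have ib : mu2.-integrable disk2 (fun w => (log_density w)%:E).
  apply/integrableP; split; first exact: mb.
  apply: le_lt_trans psi_log; apply: ge0_le_integral => //.
  - exact: measurableT_comp.
  - by move=> w _; rewrite gee0_abs.
have ig : mu2.-integrable disk2 (fun w => (M * log_density w)%:E).
  by apply: (@integrableZl _ _ _ mu2 disk2 _ M _ ib); exact: disk2_measurable.
have [|n||||_ _] := @dominated_convergence _ _ _ mu2 disk2 _
  (fun n w => (log_density w * rate n w `^ p)%:E) (cst 0%E)
  (fun w => (M * log_density w)%:E) _ _ _ ig _.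
- exact: disk2_measurable.
- by apply/measurable_EFinP; exact: rate_integrand_measurable.
- exact: measurable_cst.
- by apply: aeW => w wD; exact: rate_pointwise.
- by apply: aeW => w n wD; exact: rate_dominated.
- by rewrite integral0.
Qed.

(** The product rule; in the term that carries [psi'] the growth bound of [f]
    replaces [|f| ^ p] by the logarithmic weight of [log_density]. *)
Lemma cesaro_density f (Cg : R) n w : 0 <= Cg -> besov p f -> (0 < n)%N -> disk2 w ->
  (forall z, unit_disk z -> normc (f z) `^ p <= Cg * logw z `^ (p - 1) * besov_norm p f `^ p) ->
  density p (fun z => mean_poly n (psi z) * f z) w <=
    2 `^ p * Cg * besov_norm p f `^ p * (log_density w * rate n w `^ p)
    + 2 `^ p * (2 * C * n%:R^-1) `^ p * density p f w.
Proof using p1 psi_hol psi1 psiC.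
move=> Cg0 [hf _ _] n0 wD hCg.
have [d' dq qle] := mean_poly_deriv psi1 psiC wD (hol_cdiff psi_hol wD) n0.
have dF := cdiffM dq (hol_cdiff hf wD).
set z := w.1 +i* w.2 in dq qle dF *.
have hp := p1; have p0 : 0 <= p by lra.
have r0 := rate_ge0 n w.
have bC : 0 <= 2 * C * n%:R^-1 by rewrite !mulr_ge0 ?invr_ge0 ?ler0n // C0.
apply: (le_trans (cdiff_density_le (M := normc (cderive psi z) * rate n w * normc (f z)
   + 2 * C * n%:R^-1 * normc (cderive f z)) p0 dF _)).
  apply: (le_trans (normcD _ _)); rewrite (normcM d') (normcM (mean_poly n _)); apply: lerD.
    by apply: ler_wpM2r; rewrite ?normc_ge0.
  by apply: ler_wpM2r; rewrite ?normc_ge0 //; exact: (mean_poly_bound psi1 psiC n wD).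
apply: (@le_trans _ _ (2 `^ p * ((normc (cderive psi z) * rate n w * normc (f z)) `^ p
   + (2 * C * n%:R^-1 * normc (cderive f z)) `^ p) * weight (p - 2) w)).
  apply: ler_wpM2r; first exact: weight_ge0.
  by apply: powRD_le => //; rewrite !mulr_ge0 ?normc_ge0.
have a0 := normc_ge0 (cderive psi z); have f0 := normc_ge0 (f z).
rewrite (powRM _ (mulr_ge0 a0 r0) f0) (powRM _ a0 r0) (powRM _ bC (normc_ge0 (cderive f z))).
have alg (t k m W a L r B b F : R) : 0 <= t -> 0 <= W -> 0 <= a * r -> F <= k * L * m ->
    t * (a * r * F + B * b) * W <= t * k * m * (W * a * L * r) + t * B * (b * W).
  move=> t0 W0 ar0 hF.
  have -> : t * k * m * (W * a * L * r) + t * B * (b * W) =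
    t * (a * r * (k * L * m) + B * b) * W by ring.
  by apply: ler_wpM2r => //; apply: ler_wpM2l => //; rewrite lerD2r; apply: ler_wpM2l.
apply: alg; [exact: powR_ge0|exact: weight_ge0| |exact: (hCg z wD)].
by rewrite mulr_ge0 ?powR_ge0.
Qed.

End Sufficiency.

(** * Sufficiency *)

Section Operators.
Context {R : realType}.
Local Notation mu := (@lebesgue_measure R).
Local Notation mu2 := (mu \x mu)%E.
Implicit Types (f g psi : R[i] -> R[i]) (z x d : R[i]) (n m : nat) (p : R).

Lemma besov0 p : 1 < p -> besov p (fun=> 0 : R[i]).
Proof.
move=> p1; have := besovZ 0 p1 (besov_one p1).
by rewrite (_ : (fun z => 0 * disk_one z) = (fun=> 0)) //; apply/funext => z; rewrite mul0r.
Qed.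

Lemma besov_norm0 p : 1 < p -> besov_norm p (fun=> 0 : R[i]) = 0.
Proof.
move=> p1; have := besov_normZ 0 p1 (besov_one p1).
rewrite (_ : (fun z => 0 * disk_one z) = (fun=> 0)); last by apply/funext => z; rewrite mul0r.
by rewrite normc0 mul0r.
Qed.

Lemma operator_norm_ge0 p (S : (R[i] -> R[i]) -> R[i] -> R[i]) : 1 < p ->
  (0 <= operator_norm (besov p) (besov_norm p) S)%E.
Proof.
move=> p1; apply: (@le_trans _ _ (besov_norm p (S (fun=> 0)))%:E).
  by rewrite lee_fin besov_norm_ge0.
apply: ereal_sup_ubound; exists (fun=> 0) => //.
by split; [exact: besov0|rewrite besov_norm0].
Qed.

Lemma operator_norm_le p (S : (R[i] -> R[i]) -> R[i] -> R[i]) (e : R) :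
  (forall f, besov p f -> besov_norm p f <= 1 -> besov_norm p (S f) <= e) ->
  (operator_norm (besov p) (besov_norm p) S <= e%:E)%E.
Proof.
by move=> h; apply: ge_ereal_sup => _ [f [fB f1] <-]; rewrite lee_fin; exact: h.
Qed.

Lemma slack_le (e eps : R) : 0 <= e -> 0 < eps -> eps / (e + 1) * e <= eps.
Proof. by move=> e0 eps0; rewrite mulrAC ler_pdivrMr; [nra|lra]. Qed.

Lemma powR_eighth p (B e : R) : 1 < p -> 0 <= B -> B <= e / 8 ->
  2 `^ p * B `^ p <= (e / 2) `^ p / 2.
Proof.
move=> p1 B0 Be; have e0 : 0 <= e / 2 by lra.
have B2 : 0 <= 2 * B by lra.
rewrite -powRM // (powR_split B2 p1) (powR_split e0 p1).
have -> : e / 2 * (e / 2) `^ (p - 1) / 2 = e / 4 * (e / 2) `^ (p - 1) by field.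
apply: ler_pM; [exact: B2|exact: powR_ge0|lra|].
by apply: ge0_ler_powR; rewrite ?nnegrE; lra.
Qed.

(** Normalising by a number slightly larger than the norm of [f] also covers the
    functions of norm 0. *)
Lemma operator_norm_bound p (S : (R[i] -> R[i]) -> R[i] -> R[i]) (e : R) : 1 < p ->
  0 <= e -> (operator_norm (besov p) (besov_norm p) S <= e%:E)%E ->
  (forall f, besov p f -> besov p (S f)) ->
  (forall (c : R[i]) f, besov p f -> S (fun z => c * f z) = (fun z => c * S f z)) ->
  forall f, besov p f -> besov_norm p (S f) <= e * besov_norm p f.
Proof.
move=> p1 e0 he SB Shom f fB.
have n0 := besov_norm_ge0 p f; have e1 : 0 < e + 1 by lra.
apply/ler_addgt0Pr => eps eps0.
pose M := besov_norm p f + eps / (e + 1).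
have q0 : 0 < eps / (e + 1) by rewrite divr_gt0.
have M0 : 0 < M by rewrite /M; lra.
have cB := besovZ (M^-1)%:C p1 fB.
have cn : besov_norm p (fun z => (M^-1)%:C * f z) <= 1.
  rewrite (besov_normZ _ p1 fB) normc_real gtr0_norm ?invr_gt0 //.
  by rewrite ler_pdivrMl // mulr1 /M; lra.
have : ((besov_norm p (S (fun z => (M^-1)%:C * f z)))%:E <= e%:E)%E.
  apply: le_trans he; apply: ereal_sup_ubound.
  by exists (fun z => (M^-1)%:C * f z).
rewrite lee_fin (Shom _ _ fB) (besov_normZ _ p1 (SB _ fB)).
rewrite normc_real gtr0_norm ?invr_gt0 // ler_pdivrMl // => h.
apply: (le_trans h); rewrite /M mulrDl (mulrC _ e) lerD2l.
exact: slack_le.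
Qed.

(** The means tend to 0 in operator norm: the Besov integral of [mean_poly n psi * f]
    is at most a multiple of [rate_integral n], which tends to 0 independently of
    [f], plus a term of order [n ^- p]. *)
Lemma mean_ergodic_of_bounded_inverse p psi (C : R) : 1 < p -> holomorphic psi ->
  (forall z, unit_disk z -> normc (psi z) <= 1) ->
  (forall z, unit_disk z -> 1 <= C * normc (1 - psi z)) ->
  (\int[mu2]_(w in disk2) (log_density p psi w)%:E < +oo)%E ->
  uniformly_mean_ergodic (besov p) (besov_norm p) (multiplication psi).
Proof.
move=> p1 psi_hol psi1 psiC psi_log; have hC := inverse_const_ge0 psiC.
exists (fun _ _ => 0).
  split.
  - by move=> f _; exact: besov0.
  - move=> a f g _ _; apply/funext => z.
    by change (0 = a * 0 + 0 :> R[i]); rewrite mulr0 addr0.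
  - by exists 0 => f _; rewrite besov_norm0 // mul0r.
apply/ereal_cvg0P; first by move=> n; exact: operator_norm_ge0.
move=> e e0.
have [Cg Cg0 hCg] := besov_growth p1.
have p0 : 0 < p by lra.
have t0 : 0 < 2 `^ p :> R by rewrite powR_gt0.
have e20 : 0 <= e / 2 by lra.
have e_split : e / 8 + e / 2 <= e by lra.
(* The Besov integrals have to fall below [eta] for the p-th root to be below [e / 2]. *)
pose eta := (e / 2) `^ p.
have eta0 : 0 < eta by rewrite powR_gt0 //; lra.
pose k := 2 `^ p * Cg.
have k0 : 0 <= k by rewrite mulr_ge0 // ltW.
have q0 : 0 < eta / 2 / (k + 1) by rewrite divr_gt0 //; lra.
have /(ereal_cvg0P (rate_integral_ge0 p psi C))/(_ _ q0)[n1 hn1] :=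
  rate_integral_cvg p1 psi_hol psi1 psiC psi_log.
have C2 : 0 <= 2 * C by rewrite mulr_ge0.
have e8 : 0 < e / 8 by rewrite divr_gt0.
have [n2 hn2] := eventually_inv C2 e8.
exists (maxn 1 (maxn n1 n2)) => n; rewrite !geq_max => /and3P[n_gt0 /hn1 hI /hn2 hB].
apply: operator_norm_le => f fB f1.
have -> : (cesaro_mean (multiplication psi) n f - (fun=> 0)) = (fun z => mean_poly n (psi z) * f z).
  rewrite cesaro_multiplication; apply/funext => z.
  by change (mean_poly n (psi z) * f z - 0 = mean_poly n (psi z) * f z); rewrite subr0.
set F := fun z => _; set B := 2 * C * n%:R^-1 in hB.
have B0 : 0 <= B by rewrite mulr_ge0 // invr_ge0 ler0n.
have N0 := besov_norm_ge0 p f.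
have Np : besov_norm p f `^ p <= 1.
  have one : 1 `^ p = 1 :> R by rewrite powR1.
  by rewrite -[leRHS]one; apply: ge0_ler_powR; rewrite ?nnegrE // ltW.
have hf : holomorphic f by case: fB.
have If : (besov_integral p f < +oo)%E by case: fB.
have Ifin : besov_integral p f = (fine (besov_integral p f))%:E.
  by rewrite fineK // ge0_fin_numE // besov_integral_ge0.
have I1 : fine (besov_integral p f) <= 1 by exact: le_trans (besov_integral_le_norm f p1) Np.
have Bp : 2 `^ p * B `^ p <= eta / 2.
  exact: powR_eighth.
have hF : holomorphic F.
  apply: cdiff_hol => z zD.
  have [d' dq _] := mean_poly_deriv psi1 psiC zD (hol_cdiff psi_hol zD) n_gt0.
  exists (d' * f z + mean_poly n (psi z) * cderive f z).
  exact: cdiffM dq (hol_cdiff hf zD).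
have mD := density_measurable p hf.
have mDF := density_measurable p hF.
have mr := rate_integrand_measurable p C psi_hol n.
have intF : (besov_integral p F <= eta%:E)%E.
  have k1 : 0 <= k * besov_norm p f `^ p by rewrite mulr_ge0 ?powR_ge0.
  have k2 : 0 <= 2 `^ p * B `^ p by rewrite mulr_ge0 ?powR_ge0.
  apply: (@le_trans _ _ ((k * besov_norm p f `^ p)%:E * rate_integral p psi C n +
      (2 `^ p * B `^ p)%:E * besov_integral p f)%E).
    rewrite !besov_integralE /rate_integral.
    apply: (ge0_integral_le2 mr mD mDF _ _ _ k1 k2).
    + by move=> w; rewrite mulr_ge0 ?powR_ge0 ?log_density_ge0.
    + by move=> w; exact: density_ge0.
    + by move=> w; exact: density_ge0.
    + move=> w wD.
      exact: (cesaro_density p1 psi_hol psi1 psiC Cg0 fB n_gt0 wD (fun z zD => hCg f z fB zD)).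
  have hI2 : ((k * besov_norm p f `^ p)%:E * rate_integral p psi C n <= (eta / 2)%:E)%E.
    apply: (@le_trans _ _ ((k * besov_norm p f `^ p)%:E * (eta / 2 / (k + 1))%:E)%E).
      by apply: lee_wpmul2l; rewrite ?lee_fin.
    rewrite -EFinM lee_fin mulrA ler_pdivrMr; last by lra.
    have : k * besov_norm p f `^ p <= k by rewrite ler_piMr.
    by move: k1; move: (k * _) => y; nra.
  have hf2 : ((2 `^ p * B `^ p)%:E * besov_integral p f <= (eta / 2)%:E)%E.
    rewrite Ifin -EFinM lee_fin; apply: le_trans Bp.
    by rewrite ler_piMr.
  apply: (le_trans (leeD hI2 hf2)).
  by rewrite -EFinD lee_fin; lra.
have I0 := besov_integral_ge0 p F.
have Ffin : besov_integral p F \is a fin_num.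
  by rewrite (ge0_fin_numE I0); exact: le_lt_trans intF (ltry _).
have fineF : fine (besov_integral p F) <= eta by rewrite -lee_fin (fineK Ffin).
have root : fine (besov_integral p F) `^ p^-1 <= e / 2.
  have -> : e / 2 = eta `^ p^-1.
    by rewrite /eta -powRrM (divff (lt0r_neq0 p0)) (powRr1 e20).
  apply: ge0_ler_powR.
  - by rewrite invr_ge0 ltW.
  - by rewrite nnegrE; exact: fine_ge0.
  - by rewrite nnegrE ltW.
  - exact: fineF.
have F0 : normc (F 0) <= e / 8.
  rewrite /F normcM; apply: le_trans hB; rewrite -[leRHS]mulr1.
  apply: ler_pM; rewrite ?normc_ge0 //.
    exact: (mean_poly_bound psi1 psiC n unit_disk0).
  by apply: le_trans f1; exact: normc0_le_norm.
exact: le_trans (lerD F0 root) e_split.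
Qed.

Lemma mean_poly_one n : (0 < n)%N -> mean_poly n (1 : R[i]) = 1.
Proof.
move=> n_gt0; rewrite /mean_poly (eq_bigr (fun=> 1)); last by move=> m _; rewrite expr1n.
by rewrite big_const_nat subn1 /= iter_addr_0 mulVf // pnatr_eq0 -lt0n.
Qed.

Lemma mean_ergodic_of_one p psi : 1 < p -> (forall z, unit_disk z -> psi z = 1) ->
  uniformly_mean_ergodic (besov p) (besov_norm p) (multiplication psi).
Proof.
move=> p1 psi1; exists id.
  by split => //; exists 1 => f _; rewrite mul1r.
apply/ereal_cvg0P; first by move=> n; exact: operator_norm_ge0.
move=> e e0; exists 1%N => n n_gt0; apply: operator_norm_le => f fB _.
have -> : cesaro_mean (multiplication psi) n f - id f = (fun=> 0).
  rewrite cesaro_multiplication; apply/funext => z.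
  change (mean_poly n (psi z) * f z - f z = 0).
  have [zD|zD] := pselect (unit_disk z); last first.
    by case: fB => _ -> //; rewrite mulr0 subr0.
  by rewrite psi1 // mean_poly_one // mul1r subrr.
by rewrite besov_norm0 // ltW.
Qed.

End Operators.

(** * Necessity *)

Section Necessity.
Context {R : realType}.
Implicit Types (f g psi : R[i] -> R[i]) (z x d : R[i]) (n m : nat) (p : R).

Lemma bernoulli_ineq (h : R) m : 0 <= h -> 1 + m%:R * h <= (1 + h) ^+ m.
Proof.
move=> h0; elim: m => [|m IH]; first by rewrite mul0r addr0 expr0.
rewrite exprS -natr1; have m0 : 0 <= m%:R :> R by exact: ler0n.
by have := ler_wpM2l (ltac:(lra) : 0 <= 1 + h) IH; nra.
Qed.

(** If [t = 1 + h] with [h > 0], then [t ^ (2 m) >= (m h) ^ 2] by the squared Bernoulli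
    inequality, which outgrows any linear function of [m]. *)
Lemma le1_of_linear_growth (t B : R) (n0 : nat) : 0 <= t ->
  (forall n, (n0 <= n)%N -> t ^+ n.+1 <= 2 * n.+1%:R * B) -> t <= 1.
Proof.
move=> t0 ht; rewrite leNgt; apply/negP => t1.
pose h := t - 1; have h0 : 0 < h by rewrite /h; lra.
have h2 : 0 < h ^+ 2 by rewrite exprn_gt0.
pose k := Num.bound (4 * `|B| / h ^+ 2).
have hk : 4 * `|B| / h ^+ 2 < k%:R.
  by apply: archi_boundP; rewrite divr_ge0 ?mulr_ge0 // ltW.
pose m := (k + n0).+1.
have km : k%:R <= m%:R :> R by rewrite ler_nat /m ltnW // ltnS leq_addr.
have m0 : 0 < m%:R :> R by rewrite ltr0n.
have mm : (m * 2 = (m + m).-1.+1)%N by rewrite muln2 -addnn.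
have n0m : (n0 <= (m + m).-1)%N.
  by rewrite {1}/m addSn /=; apply: leq_trans (leq_addl k n0) (leq_addr _ _).
have := ht _ n0m.
rewrite -mm exprM => hle.
have b1 := bernoulli_ineq m (ltW h0).
have e1 : 1 + h = t by rewrite /h; ring.
rewrite e1 in b1.
have b2 : (m%:R * h) ^+ 2 <= (t ^+ m) ^+ 2.
  rewrite ler_sqr ?nnegrE ?exprn_ge0 ?mulr_ge0 ?(ltW m0) ?(ltW h0) //.
  by apply: le_trans b1; rewrite lerDr.
have b3 : m%:R * h ^+ 2 <= 4 * B.
  rewrite -(ler_pM2l m0).
  have -> : m%:R * (m%:R * h ^+ 2) = (m%:R * h) ^+ 2 by ring.
  have -> : m%:R * (4 * B) = 2 * (m * 2)%:R * B by rewrite natrM; ring.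
  exact: le_trans b2 hle.
move: hk; rewrite ltr_pdivrMr // => hk.
have : k%:R * h ^+ 2 <= m%:R * h ^+ 2 by rewrite ler_pM2r.
by have := ler_norm B; lra.
Qed.

Lemma mean_poly_diff n x :
  x ^+ n.+1 = n.+1%:R * mean_poly n.+1 x - n%:R * mean_poly n x.
Proof.
have cancel k : k%:R * mean_poly k x = \sum_(1 <= m < k.+1) x ^+ m.
  case: k => [|k]; first by rewrite mul0r big_geq.
  by rewrite /mean_poly mulrA mulfV ?mul1r // pnatr_eq0.
by rewrite !cancel [in RHS]big_nat_recr //= addrAC subrr add0r.
Qed.

Lemma one_minus_pow x m : normc x <= 1 -> normc (1 - x ^+ m) <= m%:R * normc (1 - x).
Proof.
move=> x1; elim: m => [|m IH]; first by rewrite expr0 subrr normc0 mul0r.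
have -> : 1 - x ^+ m.+1 = (1 - x) + x * (1 - x ^+ m) by rewrite exprS; ring.
apply: (le_trans (normcD _ _)); rewrite normcM -natr1 mulrDl mul1r addrC lerD2r.
by apply: le_trans IH; rewrite ler_piMl ?normc_ge0.
Qed.

Lemma one_minus_mean n x : (0 < n)%N -> normc x <= 1 ->
  normc (1 - mean_poly n x) <= n%:R * normc (1 - x).
Proof.
move=> n_gt0 x1; have n0 : 0 < n%:R :> R by rewrite ltr0n.
have -> : 1 - mean_poly n x = n%:R^-1 * \sum_(1 <= m < n.+1) (1 - x ^+ m).
  rewrite sumrB mulrBr -/(mean_poly n x) big_const_nat subn1 /= iter_addr_0 mulVf //.
  by rewrite pnatr_eq0 -lt0n.
rewrite normcM normc_natV ler_pdivrMl //.
have normc_sum k : (k <= n)%N -> normc (\sum_(1 <= m < k.+1) (1 - x ^+ m))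
    <= k%:R * (n%:R * normc (1 - x)).
  elim: k => [|k IH] kn; first by rewrite big_geq // normc0 mul0r.
  rewrite big_nat_recr //=; apply: (le_trans (normcD _ _)).
  rewrite -natr1 mulrDl mul1r; apply: lerD; first exact: IH (ltnW kn).
  apply: (le_trans (one_minus_pow k.+1 x1)).
  by apply: ler_wpM2r; rewrite ?normc_ge0 ?ler_nat.
exact: normc_sum.
Qed.

Lemma iter_besov p psi m f : (forall f, besov p f -> besov p (multiplication psi f)) ->
  besov p f -> besov p (fun z => psi z ^+ m * f z).
Proof.
move=> TB fB; have -> : (fun z => psi z ^+ m * f z) = iter m (multiplication psi) f.
  by apply/funext => z; rewrite iter_multiplication.
by elim: m => [|m IH]; [exact: fB|rewrite iterS; exact: TB].
Qed.

Lemma mean_poly_besov p psi n f : 1 < p ->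
  (forall f, besov p f -> besov p (multiplication psi f)) ->
  besov p f -> besov p (fun z => mean_poly n (psi z) * f z).
Proof.
move=> p1 TB fB.
have sB k : besov p (fun z => (\sum_(1 <= m < k.+1) psi z ^+ m) * f z).
  elim: k => [|k IH].
    have := besov0 p1; rewrite (_ : (fun=> 0) = (fun z => (\sum_(1 <= m < 1) psi z ^+ m) * f z)) //.
    by apply/funext => z; rewrite big_geq // mul0r.
  have := besovD p1 IH (iter_besov k.+1 TB fB).
  rewrite (_ : (fun z => _ + _) = (fun z => (\sum_(1 <= m < k.+2) psi z ^+ m) * f z)) //.
  by apply/funext => z; rewrite [in RHS]big_nat_recr //= mulrDl.
have := besovZ n%:R^-1 p1 (sB n).
rewrite (_ : (fun z => _ * (_ * _)) = (fun z => mean_poly n (psi z) * f z)) //.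
by apply/funext => z; rewrite /mean_poly mulrA.
Qed.

(** Differentiating [g * g = g] gives [(2 g - 1) g' = 0], and [2 g - 1] is 1 or -1. *)
Lemma idempotent_constant g : holomorphic g ->
  (forall z, unit_disk z -> g z = 0 \/ g z = 1) ->
  forall z, unit_disk z -> g z = g 0.
Proof.
move=> hg g01 z zD.
have dg0 w : unit_disk w -> cderive g w = 0.
  move=> wD; have dg := hol_cdiff hg wD.
  have r0 : 0 < 1 - normc w by rewrite subr_gt0.
  have dgg : cdiff g w (cderive g w * g w + g w * cderive g w).
    apply: (cdiff_local r0 _ (cdiffM dg dg)) => h hr.
    have : unit_disk (w + h) by apply: (@unit_disk_ball _ w); rewrite addrAC subrr add0r.
    by move=> /g01[->|->]; rewrite ?mul0r ?mul1r.
  have := cdiff_uniq dg dgg; case: (g01 w wD) => ->.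
    by rewrite mulr0 mul0r addr0.
  rewrite mulr1 mul1r => h; apply: (addrI (cderive g w)).
  by rewrite -h addr0.
have path (t : R) : 0 <= t <= 1 -> unit_disk (0 + t%:C * (z - 0)).
  move=> tI; have := @normc_segment _ 0 0 z 1 t; rewrite !subr0 normc0 ltr01.
  by apply.
have := @mean_value_ineq _ g (cderive g) 0 z 0 (fun t tI => hol_cdiff hg (path t tI)).
rewrite mul0r mulr0 => /(_ _) h; apply/eqP; rewrite -subr_eq0; apply/eqP.
apply: eq0_normc; apply/eqP; rewrite eq_le normc_ge0 andbT; apply: h => t tI.
by rewrite dg0 ?normc0 //; exact: path.
Qed.

(** Everything follows from boundedness of point evaluations. The limit operator
    acts by [P f = g f] with [g] the pointwise limit of [mean_poly n psi], which is 1
    where [psi = 1] and 0 elsewhere; being holomorphic it is constant. If it is 1,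
    so is [psi]. If it is 0, some mean has norm at most 1/4; its powers tend to 0
    geometrically, so its multiplier is at most 1/2 in modulus, and
    [1 - mean_poly n psi] is bounded away from 0. As [1 - x] divides
    [1 - mean_poly n x], so is [1 - psi]. *)
Lemma mean_ergodic_necessary p psi : 1 < p ->
  bounded_operator (besov p) (besov_norm p) (multiplication psi) ->
  uniformly_mean_ergodic (besov p) (besov_norm p) (multiplication psi) ->
  (forall z, unit_disk z -> normc (psi z) <= 1) /\
  ((forall z, unit_disk z -> psi z = 1) \/
   exists C : R, forall z, unit_disk z -> 1 <= C * normc (1 - psi z)).
Proof.
move=> p1 [TB _ _] [P [PB Plin _] cv].
pose S n f : R[i] -> R[i] := fun z => mean_poly n (psi z) * f z - P f z.
have SE n : (fun f => cesaro_mean (multiplication psi) n f - P f) = S n.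
  by apply/funext => f; rewrite cesaro_multiplication.
have P0 : P (fun=> 0) = (fun=> 0).
  have B0 := besov0 p1; have h := Plin 1 _ _ B0 B0.
  have e0 : 1 *: (fun=> 0) + (fun=> 0) = (fun=> 0) :> (R[i] -> R[i]).
    by apply/funext => z; change (1 * 0 + 0 = 0 :> R[i]); rewrite mulr0 addr0.
  rewrite e0 in h; apply/funext => z.
  have : P (fun=> 0) z = 1 * P (fun=> 0) z + P (fun=> 0) z by rewrite {1}h.
  by rewrite mul1r => h2; apply: (addrI (P (fun=> 0) z)); rewrite -h2 addr0.
have Pz (c : R[i]) f : besov p f -> P (fun z => c * f z) = (fun z => c * P f z).
  move=> fB; have h := Plin c _ _ fB (besov0 p1).
  have e0 : c *: f + (fun=> 0) = (fun z => c * f z) :> (R[i] -> R[i]).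
    by apply/funext => z; change (c * f z + 0 = c * f z); rewrite addr0.
  rewrite e0 P0 in h; rewrite h; apply/funext => z.
  by change (c * P f z + 0 = c * P f z); rewrite addr0.
have SB n f : besov p f -> besov p (S n f).
  move=> fB; have := besovD p1 (mean_poly_besov n p1 TB fB) (besovZ (- 1) p1 (PB f fB)).
  rewrite (_ : (fun z => _ + _) = S n f) //.
  by apply/funext => z; rewrite mulN1r.
have Sz n (c : R[i]) f : besov p f -> S n (fun z => c * f z) = (fun z => c * S n f z).
  by move=> fB; apply/funext => z; rewrite /S (Pz _ _ fB) mulrBr mulrCA.
have est (e : R) : 0 < e -> exists n0, forall n, (n0 <= n)%N ->
    forall f, besov p f -> besov_norm p (S n f) <= e * besov_norm p f.
  move=> e0.
  have /(_ e e0)[n0 hn0] := proj1 (ereal_cvg0P (fun n => operator_norm_ge0 _ p1)) cv.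
  exists n0 => n /hn0; rewrite SE => hS f fB.
  exact: (operator_norm_bound p1 (ltW e0) hS (SB n) (Sz n)).
have ptw f z (e : R) : besov p f -> unit_disk z -> 0 < e -> exists n0,
    forall n, (n0 <= n)%N -> normc (mean_poly n (psi z) * f z - P f z) <= e.
  move=> fB zD e0; have [C C0 hC] := point_evaluation p1 zD.
  have N0 := besov_norm_ge0 p f.
  have CN : 0 <= C * besov_norm p f by rewrite mulr_ge0.
  have e1 : 0 < e / (C * besov_norm p f + 1) by rewrite divr_gt0 //; lra.
  have [n0 hn0] := est _ e1; exists n0 => n /hn0/(_ f fB) hS.
  apply: (le_trans (hC _ (SB n f fB))).
  apply: (le_trans (ler_wpM2l C0 hS)); rewrite mulrCA.
  exact: slack_le.
pose g := P disk_one.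
have oneB := besov_one p1.
have qcv z (e : R) : unit_disk z -> 0 < e -> exists n0, forall n, (n0 <= n)%N ->
    normc (mean_poly n (psi z) - g z) <= e.
  move=> zD e0; have [n0 hn0] := ptw _ z e oneB zD e0.
  by exists n0 => n /hn0; rewrite disk_oneE // mulr1.
have psi1 z : unit_disk z -> normc (psi z) <= 1.
  move=> zD; have [n0 hn0] := qcv z 1 zD ltr01.
  apply: (@le1_of_linear_growth _ (normc (g z) + 1) n0); first exact: normc_ge0.
  have bq n : (n0 <= n)%N -> normc (mean_poly n (psi z)) <= normc (g z) + 1.
    move=> /hn0; have := normcD (mean_poly n (psi z) - g z) (g z).
    by rewrite subrK; lra.
  move=> n hn; rewrite -normcX mean_poly_diff; apply: (le_trans (normcB _ _)).
  rewrite (normcM n.+1%:R) (normcM n%:R) !normcMn !normc1.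
  have b1 := bq n hn; have b2 := bq n.+1 (leqW hn).
  have c1 := ler_wpM2l (ler0n R n.+1) b2; have c2 := ler_wpM2l (ler0n R n) b1.
  have g0 := normc_ge0 (g z).
  have c3 : n%:R * (normc (g z) + 1) <= n.+1%:R * (normc (g z) + 1).
    by apply: ler_wpM2r; [lra|rewrite ler_nat].
  by rewrite -mulrA mulr_natl mulr2n; lra.
split; first exact: psi1.
have g_one z : unit_disk z -> psi z = 1 -> g z = 1.
  move=> zD pz; apply/eqP; rewrite eq_sym -subr_eq0; apply/eqP.
  apply: eq0_normc; apply/eqP; rewrite eq_le normc_ge0 andbT.
  apply/ler_addgt0Pr => e e0; rewrite add0r.
  have [n0 hn0] := qcv z e zD e0.
  have := hn0 (maxn 1 n0) (leq_maxr _ _).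
  by rewrite pz mean_poly_one // leq_max.
have g_ann z : unit_disk z -> (1 - psi z) * g z = 0.
  move=> zD; apply: eq0_normc; apply/eqP; rewrite eq_le normc_ge0 andbT.
  apply/ler_addgt0Pr => e e0; rewrite add0r.
  have e4 : 0 < e / 4 by lra.
  have e2 : 0 < e / 2 by lra.
  have [n0 hn0] := qcv z _ zD e4.
  have [n1 hn1] := @eventually_inv R 2 _ (ltac:(by []) : 0 <= 2) e2.
  pose n := maxn n0 n1.
  have h1 := hn0 n (leq_maxl _ _); have h2 := hn1 n (leq_maxr _ _).
  have -> : (1 - psi z) * g z =
     (1 - psi z) * mean_poly n (psi z) - (1 - psi z) * (mean_poly n (psi z) - g z) by ring.
  apply: (le_trans (normcB _ _)); rewrite mean_polyE !normcM normc_natV.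
  have x1 := psi1 z zD; have x0 := normc_ge0 (psi z).
  have h3 : normc (1 - psi z) <= 2.
    by apply: (le_trans (normcB _ _)); rewrite normc1; lra.
  have h4 : normc (psi z - psi z ^+ n.+1) <= 2.
    apply: (le_trans (normcB _ _)); rewrite normcX.
    by have := exprn_ile1 n.+1 x0 x1; lra.
  have h5 : normc (1 - psi z) * normc (mean_poly n (psi z) - g z) <= 2 * (e / 4).
    by apply: ler_pM; rewrite ?normc_ge0.
  have h6 : n%:R^-1 * normc (psi z - psi z ^+ n.+1) <= n%:R^-1 * 2.
    by apply: ler_wpM2l => //; rewrite invr_ge0 ler0n.
  by rewrite mulrC in h2; lra.
have g01 z : unit_disk z -> g z = 0 \/ g z = 1.
  move=> zD; have [pz|pz] := eqVneq (psi z) 1; first by right; exact: g_one.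
  left; have /eqP := g_ann z zD; rewrite mulf_eq0 => /orP[|/eqP //].
  by rewrite subr_eq0 eq_sym (negbTE pz).
have hg : holomorphic g by case: (PB _ oneB).
have gc := idempotent_constant hg g01.
case: (g01 0 unit_disk0) => g0E; last first.
  left => z zD; have := g_ann z zD; rewrite gc // g0E mulr1 => /eqP.
  by rewrite subr_eq0 => /eqP <-.
right.
have pneq z : unit_disk z -> 1 - psi z != 0.
  move=> zD; apply/eqP => /eqP; rewrite subr_eq0 eq_sym => /eqP pz.
  have := g_one z zD pz; rewrite gc // g0E => /eqP.
  by rewrite eq_sym oner_eq0.
have Pzero f : besov p f -> P f = (fun=> 0).
  move=> fB; apply/funext => z; have [zD|zD] := pselect (unit_disk z); last first.
    by case: (PB f fB) => _ ->.
  apply: eq0_normc; apply/eqP; rewrite eq_le normc_ge0 andbT.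
  apply/ler_addgt0Pr => e e0; rewrite add0r.
  have e2 : 0 < e / 2 by lra.
  have f0 := normc_ge0 (f z).
  have ef : 0 < e / 2 / (normc (f z) + 1) by rewrite divr_gt0 //; lra.
  have [n0 hn0] := ptw f z _ fB zD e2; have [n1 hn1] := qcv z _ zD ef.
  have := hn0 (maxn n0 n1) (leq_maxl _ _); have := hn1 (maxn n0 n1) (leq_maxr _ _).
  set q := mean_poly _ _; rewrite gc // g0E subr0 ler_pdivlMr; last by lra.
  move=> h1 h2.
  have := normcB (q * f z) (q * f z - P f z).
  have -> : q * f z - (q * f z - P f z) = P f z by ring.
  rewrite normcM; have := normc_ge0 q.
  by move: h1; rewrite mulrDr mulr1; lra.
have q4 : 0 < (4%:R)^-1 :> R by rewrite invr_gt0.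
have [n0 hn0] := est _ q4.
pose n := maxn 1 n0.
have n_gt0 : (0 < n)%N by rewrite leq_max.
have contr f : besov p f ->
    besov_norm p (fun z => mean_poly n (psi z) * f z) <= 4^-1 * besov_norm p f.
  move=> fB; have := hn0 n (leq_maxr _ _) f fB.
  rewrite (_ : S n f = (fun z => mean_poly n (psi z) * f z)) //.
  by apply/funext => z; rewrite /S Pzero // subr0.
(* Powers of the mean applied to 1 decay geometrically in norm. *)
have qB k : besov p (fun z => mean_poly n (psi z) ^+ k * disk_one z) /\
    besov_norm p (fun z => mean_poly n (psi z) ^+ k * disk_one z) <= 4^-1 ^+ k.
  elim: k => [|k [IH1 IH2]].
    rewrite (_ : (fun z => _) = disk_one); last by apply/funext => z; rewrite expr0 mul1r.
    by split; [exact: oneB|rewrite besov_norm_one].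
  rewrite (_ : (fun z => _) = (fun z => mean_poly n (psi z) * (mean_poly n (psi z) ^+ k * disk_one z))); last first.
    by apply/funext => z; rewrite exprS mulrA.
  split; first exact: (mean_poly_besov n p1 TB IH1).
  apply: (le_trans (contr _ IH1)); rewrite exprS.
  by apply: ler_wpM2l; [exact: ltW|exact: IH2].
have q_half z : unit_disk z -> normc (mean_poly n (psi z)) <= 2^-1.
  move=> zD; have [C C0 hC] := point_evaluation p1 zD.
  set q := mean_poly n (psi z).
  have hk k : (4 * normc q) ^+ k <= C.
    have [h1 h2] := qB k; have := hC _ h1; rewrite disk_oneE // mulr1 normcX => h3.
    have h4 : normc q ^+ k <= C * 4^-1 ^+ k by apply: (le_trans h3); exact: ler_wpM2l.
    have p4 : 0 < 4 ^+ k :> R by rewrite exprn_gt0.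
    by rewrite exprMn mulrC -ler_pdivlMr // -exprVn.
  rewrite leNgt; apply/negP => hq.
  have [k hk2] := @exists_pow2 R C 1 ltr01.
  have := hk k; rewrite leNgt => /negP; apply; apply: (lt_le_trans hk2); rewrite mul1r.
  by apply: lerXn2r; rewrite ?nnegrE ?mulr_ge0 ?normc_ge0 //; lra.
exists (2 * n%:R) => z zD.
have h1 := one_minus_mean n_gt0 (psi1 z zD); have h2 := q_half z zD.
have := normcD (1 - mean_poly n (psi z)) (mean_poly n (psi z)); rewrite subrK normc1.
by lra.
Qed.

End Necessity.

(** * The characterisation *)

Unset Implicit Arguments.

Theorem theorem3p5 (R : realType) (p : R) (psi : R[i] -> R[i])
  (p_gt1 : 1 < p)
  (psi_hol : holomorphic psi)
  (psi_log : (disk_integral (fun z =>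
      ((1 - normc z ^+ 2) `^ (p - 2) * normc (cderive psi z) `^ p
       * ln (2 / (1 - normc z ^+ 2)) `^ (p - 1))%R) < +oo)%E)
  (Mpsi_bounded :
    bounded_operator (besov p) (besov_norm p) (multiplication psi)) :
  uniformly_mean_ergodic (besov p) (besov_norm p) (multiplication psi) <->
  (sup_norm psi <= 1)%E /\
  ((exists2 xi : R[i], normc xi = 1 & forall z, unit_disk z -> psi z = xi) \/
   ((forall z, unit_disk z -> 1 - psi z != 0) /\
    Hinfty (fun z => (1 - psi z)^-1))).
Proof.
split => [ume|[/sup_norm_le psi1 psi_alt]].
  have [psi1 psi_alt] := mean_ergodic_necessary p_gt1 Mpsi_bounded ume.
  split; first exact/sup_norm_le.
  case: psi_alt => [psiE|[C psiC]].
    by left; exists 1; [exact: normc1|exact: psiE].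
  right; split; first by move=> z zD; exact: symbol_neq1 psiC _ zD.
  split.
    apply: cdiff_hol => z zD; exists (- (0 - cderive psi z) / (1 - psi z) ^+ 2).
    apply: (cdiffV (F := fun x => 1 - psi x)); first exact: symbol_neq1 psiC _ zD.
    by apply: cdiffB; [exact: cdiff_cst|exact: hol_cdiff].
  apply: (@le_lt_trans _ _ C%:E); last exact: ltry.
  by apply/sup_norm_le => z zD; exact: inverse_bound psiC _ zD.
have ergodic (C : R) : (forall z, unit_disk z -> 1 <= C * normc (1 - psi z)) ->
    uniformly_mean_ergodic (besov p) (besov_norm p) (multiplication psi).
  by move=> psiC; apply: (mean_ergodic_of_bounded_inverse p_gt1 psi_hol psi1 psiC psi_log).
case: psi_alt => [[xi xi1 psiE]|[psi_neq [_ inv_fin]]].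
  have [xiE|xi_neq1] := eqVneq xi 1.
    by apply: mean_ergodic_of_one => // z zD; rewrite psiE.
  have n0 : 0 < normc (1 - xi) by rewrite normc_gt0 subr_eq0 eq_sym.
  by apply: (ergodic (normc (1 - xi))^-1) => z zD; rewrite psiE // mulVf ?gt_eqF.
have [M hM] : exists M : R, (sup_norm (fun z => ((1 - psi z)^-1)%R) <= M%:E)%E.
  case: (sup_norm _) inv_fin => [r _|//|_]; first by exists r.
  by exists 0; rewrite leNye.
apply: (ergodic M) => z zD; move/sup_norm_le : hM => /(_ z zD).
by rewrite normcV -[X in X <= _]mul1r ler_pdivrMr ?normc_gt0 ?psi_neq.
Qed.
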